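(* Let $u^*_\alpha$ be the extremal solution of $(P_{\lambda,\alpha})$. Then, as $\alpha\to\infty$: (i) $u^*_\alpha(x)\to 0$ for every $x\in B\setminus\{0\}$, and $u^*_\alpha(0)\to\infty$; (ii) $\displaystyle\int_B u^*_\alpha(x)\,dx\to 0$ and $\displaystyle\int_B\psi(x)f(u^*_\alpha(x))\,dx\to f(0)\int_B\psi(x)\,dx$, where $\psi(x)=\psi(|x|)$.
   Context: $B$ is the open unit disk in $\mathbb{R}^2$ centered at the origin, and $r=|x|$. Standing assumptions: $f:[0,\infty)\to(0,\infty)$ is a $C^1$ convex non-decreasing function with $\int_0^\infty \frac{ds}{f(s)}<\infty$; $\varphi,\psi$ are non-negative, non-increasing, Lipschitz continuous functions on $[0,1]$ with $\varphi(0)=\psi(0)=1$ and $\varphi>0$ on $[0,1)$; and $\int_0^1 M(s)\,ds<\infty$, where $M(s):=\max_{r\in[0,s]}\frac{\psi(r)}{\varphi(r)}$. For parameters $\lambda>0$, $\alpha>0$ consider the problem $$-\Delta u-\alpha r\varphi(r)\frac{\partial u}{\partial r}=\lambda\psi(r)f(u)\ \text{ in } B,\qquad u>0\ \text{ in } B,\qquad u=0\ \text{ on }\partial B. \quad (P_{\lambda,\alpha})$$ For each fixed $\alpha>0$, $\lambda^*(\alpha)\in(0,\infty)$ denotes the extremal value of $\lambda$: $(P_{\lambda,\alpha})$ has a unique minimal (pointwise smallest) classical solution $u_{\lambda,\alpha}$ for every $\lambda\in(0,\lambda^*(\alpha))$, and has no solution for $\lambda>\lambda^*(\alpha)$. The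 extremal solution is $u^*_\alpha(x):=\lim_{\lambda\uparrow\lambda^*(\alpha)}u_{\lambda,\alpha}(x)$; it is a classical solution of $(P_{\lambda,\alpha})$ with $\lambda=\lambda^*(\alpha)$, radially symmetric and strictly decreasing in $|x|$. *)

(* Defs.v *)
From mathcomp Require Export all_boot all_order all_algebra.
From mathcomp Require Export all_classical all_reals all_analysis.

Set Implicit Arguments.
Unset Strict Implicit.
Unset Printing Implicit Defensive.

Export Order.TTheory GRing.Theory Num.Theory.
Export numFieldNormedType.Exports.

Local Open Scope classical_set_scope.
Local Open Scope ring_scope.

(* [g] is the derivative of [f] relative to [0, +oo), hence one-sided at 0. *)
Definition C1_on_nonneg (R : realType) (f : R -> R) : Prop :=
  exists2 g : R -> R, {within [set s | 0 <= s], continuous g} &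
    forall x, 0 <= x ->
      (f y - f x) / (y - x) @[y --> within [set s | 0 <= s] x^'] --> g x.

Section Disk.
Variable R : realType.
Implicit Types (u : R * R -> R) (x : R * R).

(* The library norm on [R * R] is the sup norm, hence an explicit Euclidean
   norm. *)
Definition enorm x : R := Num.sqrt (x.1 ^+ 2 + x.2 ^+ 2).
Definition disk : set (R * R) := [set x | enorm x < 1].
Definition closed_disk : set (R * R) := [set x | enorm x <= 1].

Definition dx1 u : R * R -> R := 'D_(1, 0) u.
Definition dx2 u : R * R -> R := 'D_(0, 1) u.

Definition C1_on_disk u : Prop :=
  forall x, disk x ->
    [/\ derivable u x (1, 0), derivable u x (0, 1),
        {for x, continuous (dx1 u)} & {for x, continuous (dx2 u)}].

Definition C2_on_disk u : Prop :=
  [/\ C1_on_disk u, C1_on_disk (dx1 u) & C1_on_disk (dx2 u)].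

Definition laplacian u x : R := dx1 (dx1 u) x + dx2 (dx2 u) x.

(* At the origin the direction is [0^-1 *: 0 = 0], so the value is 0; this is
   harmless since the radial derivative only occurs multiplied by [enorm x]. *)
Definition radial_derivative u x : R := 'D_((enorm x)^-1 *: x) u x.

Definition disk_integral u : \bar R :=
  (\int[@lebesgue_measure R \x @lebesgue_measure R]_(x in disk) (u x)%:E)%E.

Definition radially_symmetric u : Prop :=
  forall x y, closed_disk x -> closed_disk y -> enorm x = enorm y -> u x = u y.

Definition radially_decreasing u : Prop :=
  forall x y, closed_disk x -> closed_disk y -> enorm x < enorm y -> u y < u x.

End Disk.

Section Problem.
Variables (R : realType) (f phi psi : R -> R).
Implicit Types (alpha lambda L s : R) (u v : R * R -> R).

(* At [s = 1] the quotient may be a division by [phi 1 = 0]; only [s < 1] is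
   used, where the supremum is attained because [phi] and [psi] are
   continuous. *)
Definition max_ratio s : R := sup [set psi r / phi r | r in `[0, s]].

(* Functions on the plane are only constrained on the closed disk. *)
Definition classical_solution alpha lambda u : Prop :=
  [/\ {within @closed_disk R, continuous u},
      C2_on_disk u,
      forall x, disk x ->
        - laplacian u x
          - alpha * enorm x * phi (enorm x) * radial_derivative u x
        = lambda * psi (enorm x) * f (u x),
      forall x, disk x -> 0 < u x
    & forall x, enorm x = 1 -> u x = 0].

(* Being pointwise smallest, a minimal solution is unique on the closed disk. *)
Definition minimal_solution alpha lambda u : Prop :=
  classical_solution alpha lambda u /\
  forall v, classical_solution alpha lambda v ->
    forall x, closed_disk x -> u x <= v x.

Definition extremal_value alpha L : Prop :=
  [/\ 0 < L,
      forall lambda, 0 < lambda < L -> exists u, minimal_solution alpha lambda u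
    & forall lambda, L < lambda ->
        ~ exists u, classical_solution alpha lambda u].

Definition extremal_solution alpha L u : Prop :=
  exists2 umin : R -> R * R -> R,
    forall lambda, 0 < lambda < L ->
      minimal_solution alpha lambda (umin lambda) &
    forall x, closed_disk x -> umin lambda x @[lambda --> L^'-] --> u x.

End Problem.

(* Main.v *)
Require Import Defs.
From mathcomp Require Import ring lra measurable_realfun.

(* Put t = |x|^2 and b = lambda / (2 alpha).  A radial solution U(x) = V(t)
   satisfies (t A V')' = - (lambda / 4) A Psi f(V), where
   A(t) = exp ((alpha / 2) int_0^t Phi), Phi(t) = phi (sqrt t) and
   Psi(t) = psi (sqrt t).  Since Psi and f(V) are nonincreasing,
   - V' >= b Psi f(V) (1 - 1 / A) / t; with G(u) = int_0^u ds / f(s),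
   F = sup G and J(t) = int_0^t Psi (1 - 1 / A) ds / s, it follows that
   G(V(t)) + b J(t) is nonincreasing, so that b J(1) <= G(V(0)) < F.
   Conversely, for c < F and alpha large, a supersolution
   G^-1 ((1 + eta) b (K - int_0^t M (1 - 1 / A) ds / s)), with K = J(1) + O(1)
   and b = c / K, yields a solution for that b; hence bstar J(1) --> F, as no
   solution exists above lambda_star.  So G(ustar(0)) --> F, i.e. ustar(0) --> oo, whereas
   G(V(t)) < F - bstar J(t) <= F - bstar J(1) + bstar |ln t| --> 0 for t > 0.
   Near the origin, int f(ustar) is controlled by integrating the equation: the
   drift contributes a multiple of int ustar, which is absorbed through
   K u <= f(u) + K C exp (eps K), a consequence of the convergence of
   int ds / f(s). *)

(** In the variable t the drift is [a * Phi * P] with P = t V', free of powers of the radius. As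
    |x|^2 is smooth at the origin, V(|x|^2) is C2 once V' and t V'' are continuous and t V'' tends
    to 0 at 0; V' itself need not be differentiable there. The hard half is the lower bound on
    lambda_star. It has to be sharp to first order, so the supersolution may lose only a factor
    tending to 1. There are two losses. Using the weight M in place of Psi changes J(1) by an amount
    bounded in alpha: M - Psi is at most of order sqrt t near 0, where 1 / t is singular, and M is
    integrable up to 1, where Phi may vanish. Freezing f(ubar) in the integral of A' costs an error
    of relative order 1 / K, paid for by eta. Both are negligible because J(1) grows at least
    logarithmically in alpha. The integral estimate needs b only up to constants: K = 4 / b is at
    most a multiple of J(1), and half of the burn is already reached at some tau <= exp (- J(1) /
    2), a factor that beats exp (eps K) once eps is small compared with F. *)

Set Implicit Arguments.
Unset Strict Implicit.
Unset Printing Implicit Defensive.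

Local Open Scope classical_set_scope.
Local Open Scope ring_scope.

(** * Derivatives and primitives *)

Section RealAnalysis.
Variable R : realType.
Implicit Types (F G d e g h : R -> R) (l r x y : R).
Notation leb := (@lebesgue_measure R).

(* Unlike [is_derive], not a type class: instances are chosen explicitly. *)
Definition has_deriv F x (a : R) : Prop := is_derive x 1 F a.

Lemma derD F G x (a b : R) : has_deriv F x a -> has_deriv G x b ->
  has_deriv (fun y => F y + G y) x (a + b).
Proof. exact: is_deriveD. Qed.

Lemma derN F x (a : R) : has_deriv F x a -> has_deriv (fun y => - F y) x (- a).
Proof. exact: is_deriveN. Qed.

Lemma derM F G x (a b : R) : has_deriv F x a -> has_deriv G x b ->
  has_deriv (fun y => F y * G y) x (F x * b + G x * a).
Proof. by move=> ? ?; exact: is_deriveM. Qed.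

Lemma derV F x (a : R) : F x != 0 -> has_deriv F x a ->
  has_deriv (fun y => (F y)^-1) x (- (F x) ^- 2 * a).
Proof. by move=> ? ?; exact: is_deriveV. Qed.

Lemma derC (c : R) x : has_deriv (fun=> c) x (0 : R).
Proof. exact: is_derive_cst. Qed.

Lemma derI x : has_deriv (fun y => y) x (1 : R).
Proof. exact: is_derive_id. Qed.

Lemma der_comp F G x (a b : R) : has_deriv F (G x) a -> has_deriv G x b ->
  has_deriv (fun y => F (G y)) x (a * b).
Proof. by move=> ? ?; exact: is_derive1_comp. Qed.

Lemma der_eq F x (a b : R) : has_deriv F x a -> a = b -> has_deriv F x b.
Proof. by move=> ? <-. Qed.

Lemma has_deriv_continuous F x (a : R) : has_deriv F x a -> {for x, continuous F}.
Proof.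
by move=> [H _]; exact/differentiable_continuous/derivable1_diffP.
Qed.

Lemma continuous_within_itv F l r :
  (forall x, l <= x <= r -> {for x, continuous F}) -> {within `[l, r], continuous F}.
Proof.
by move=> H; apply: continuous_in_subspaceT => x; rewrite inE /= in_itv; exact: H.
Qed.

Lemma derive_ge0_le F d l r : l <= r ->
  (forall x, l < x < r -> has_deriv F x (d x)) ->
  (forall x, l < x < r -> 0 <= d x) ->
  {within `[l, r], continuous F} -> F l <= F r.
Proof.
move=> lr dF d0 cF; apply: (@ger0_derive1_le_cc R F l r) => //.
- by move=> x; rewrite in_itv /= => /dF [].
- move=> x; rewrite in_itv /= => xlr; rewrite derive1E.
  by have [_ ->] := dF _ xlr; exact: d0.
- by rewrite in_itv /= lexx.
- by rewrite in_itv /= lexx lr.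
Qed.

Lemma derive_le_le F d G e l r : l <= r ->
  (forall x, l < x < r -> has_deriv F x (d x)) ->
  (forall x, l < x < r -> has_deriv G x (e x)) ->
  (forall x, l < x < r -> d x <= e x) ->
  {within `[l, r], continuous F} -> {within `[l, r], continuous G} ->
  F r - F l <= G r - G l.
Proof.
move=> lr dF dG de cF cG.
have : (G - F) l <= (G - F) r.
  apply: (@derive_ge0_le _ (fun x => e x - d x)) => //.
  - by move=> x xlr; have := dF _ xlr; have := dG _ xlr => ? ?; exact: is_deriveB.
  - by move=> x xlr; rewrite subr_ge0 de.
  - by move=> x; apply: continuousD _; [exact: cG|apply: continuousN; exact: cF].
by rewrite /= !fctE => ?; lra.
Qed.

Lemma derive_le_le_in F d G e l r : l <= r ->
  (forall x, l <= x <= r -> has_deriv F x (d x)) ->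
  (forall x, l <= x <= r -> has_deriv G x (e x)) ->
  (forall x, l <= x <= r -> d x <= e x) ->
  F r - F l <= G r - G l.
Proof.
move=> lr dF dG de.
have W x : l < x < r -> l <= x <= r by move=> /andP[/ltW -> /ltW ->].
apply: (derive_le_le (d := d) (e := e)) => //.
- by move=> x /W; exact: dF.
- by move=> x /W; exact: dG.
- by move=> x /W; exact: de.
- by apply: continuous_within_itv => x /dF; exact: has_deriv_continuous.
- by apply: continuous_within_itv => x /dG; exact: has_deriv_continuous.
Qed.

(** The primitive vanishing at 0. Integrating from -1 makes 0 an interior point, so that the
    derivative there is two-sided. *)
Definition primitive g x : R :=
  \int[leb]_(t in `[-1, x]) g t - \int[leb]_(t in `[-1, 0]) g t.

Lemma primitive0 g : primitive g 0 = 0.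
Proof. by rewrite /primitive subrr. Qed.

(** [c] marks a possible singularity of [g] on the right, such as 1 for the maximal ratio when
    [phi 1 = 0]. *)
Lemma has_deriv_primitive g c x :
  (forall y, y < c -> {for y, continuous g}) -> -1 < x < c ->
  has_deriv (primitive g) x (g x).
Proof.
move=> cg /andP[x1 xc].
have xu : x < (x + c) / 2 by lra.
have ig : leb.-integrable `[-1, (x + c) / 2] (EFin \o g).
  apply: continuous_compact_integrable; first exact: segment_compact.
  by apply: continuous_within_itv => y yc; apply: cg; lra.
have [dP eP] := continuous_FTC1_closed xu ig x1 (cg _ xc).
rewrite -[g x]subr0 /primitive.
have D1 : is_derive x 1 (fun x => \int[leb]_(t in `[-1, x]) g t) (g x).
  by rewrite -eP derive1E; exact: derivableP.
exact: is_deriveB.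
Qed.

Lemma primitive_integral g c x :
  (forall y, y < c -> {for y, continuous g}) -> 0 < x < c ->
  (\int[leb]_(t in `[0%R, x]) (g t)%:E)%E = (primitive g x)%:E.
Proof.
move=> cg /andP[x0 xc]; rewrite (@continuous_FTC2 R g (primitive g)) //.
- by rewrite primitive0 sube0.
- by apply: continuous_within_itv => y yx; apply: cg; lra.
- have dP z : 0 <= z <= x -> has_deriv (primitive g) z (g z).
    by move=> zx; apply: has_deriv_primitive cg _; lra.
  split.
  + move=> z; rewrite in_itv /= => zx; have zx' : 0 <= z <= x by lra.
    by have [] := dP _ zx'.
  + apply: cvg_at_right_filter.
    by apply: (has_deriv_continuous (a := g 0)); apply: dP; lra.
  + apply: cvg_at_left_filter.
    by apply: (has_deriv_continuous (a := g x)); apply: dP; lra.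
- move=> z; rewrite in_itv /= => zx; rewrite derive1E.
  have zc : -1 < z < c by lra.
  by have [] := has_deriv_primitive cg zc.
Qed.

Lemma primitive_le_integral g c x (D : set R) : measurable D ->
  (forall y, y < c -> {for y, continuous g}) -> 0 <= x < c ->
  `[0, x] `<=` D -> (forall y, D y -> 0 <= g y) -> measurable_fun D g ->
  (\int[leb]_(t in D) (g t)%:E < +oo)%E ->
  primitive g x <= fine (\int[leb]_(t in D) (g t)%:E)%E.
Proof.
move=> mD cg /andP[]; rewrite le_eqVlt => /predU1P[<- _ _ g0 mg _|x0 xc xD g0 mg fin].
  by rewrite primitive0 fine_ge0 // integral_ge0 // => y /g0; rewrite lee_fin.
have I0 : (0 <= \int[leb]_(t in D) (g t)%:E)%E.
  by rewrite integral_ge0 // => y /g0; rewrite lee_fin.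
rewrite -lee_fin fineK; last by rewrite ge0_fin_numE.
rewrite -(primitive_integral cg) ?x0 //.
apply: ge0_subset_integral => //; exact/measurable_EFinP.
Qed.

Lemma dist_le_continuous F (L : R) : 0 <= L ->
  (forall x y, `|F x - F y| <= L * `|x - y|) -> continuous F.
Proof.
move=> L0 H x; apply/cvgrPdist_lt => e e0.
have L1 : 0 < L + 1 by lra.
near=> y; apply: le_lt_trans (H _ _) _.
apply: (@le_lt_trans _ _ ((L + 1) * `|x - y|)); first by rewrite ler_wpM2r //; lra.
rewrite mulrC -ltr_pdivlMr //; near: y; apply: cvgr_dist_lt; first exact: cvg_id.
exact: divr_gt0.
Unshelve. all: by end_near. Qed.

Lemma clamp_dist x y :
  `|Num.min (Num.max x 0) 1 - Num.min (Num.max y 0) 1| <= `|x - y|.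
Proof.
have E (g : R -> R) : (forall x y, x <= y -> g x <= g y <= g x + (y - x)) ->
    forall x y, `|g x - g y| <= `|x - y|.
  move=> Hg s t; have [xy|/ltW xy] := leP s t; have /andP[h1 h2] := Hg _ _ xy.
    by rewrite distrC [`|s - t|]distrC !ger0_norm ?subr_ge0 //; lra.
  by rewrite !ger0_norm ?subr_ge0 //; lra.
apply: (@le_trans _ _ `|Num.max x 0 - Num.max y 0|).
  by apply: (E (fun x => Num.min x 1)) => s t st; rewrite /Num.min;
    case: ltP => ?; case: ltP => ?; lra.
by apply: (E (fun x => Num.max x 0)) => s t st; rewrite /Num.max;
  case: ltP => ?; case: ltP => ?; lra.
Qed.

(* The removable singularity at 0 of [h x / x], extended by [c] to [x <= 0]. *)
Definition slope0 (c : R) h x : R := if x <= 0 then c else h x / x.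

Lemma slope0_gt0 c h x : 0 < x -> slope0 c h x = h x / x.
Proof. by move=> x0; rewrite /slope0 leNgt x0. Qed.

Lemma near_eq_continuous (T : topologicalType) (g h : T -> R) (x : T) :
  (\near x, g x = h x) -> {for x, continuous g} -> {for x, continuous h}.
Proof.
move=> gh cg; change (h y @[y --> x] --> h x); rewrite -(nbhs_singleton gh).
by apply: cvg_trans cg; apply: near_eq_cvg.
Qed.

Lemma continuous_slope0 (c : R) h : has_deriv h 0 c -> h 0 = 0 ->
  (forall x, 0 < x -> {for x, continuous h}) -> continuous (slope0 c h).
Proof.
move=> dh h0 ch.
suff H (x : R) : {for x, continuous (slope0 c h)} by exact: H.
have [xn|xp|->] := ltgtP x 0.
- apply: (@near_eq_continuous _ (cst c)); last exact: cst_continuous.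
  by near=> y; rewrite /slope0 ifT //; apply: ltW; near: y; exact: lt_nbhsl.
- apply: (@near_eq_continuous _ (fun y => h y / y)).
    by near=> y; rewrite slope0_gt0 //; near: y; exact: lt_nbhsr.
  apply: continuousM; first exact: ch.
  by apply: continuousV; [rewrite gt_eqF|exact: cvg_id].
- have {dh} : h y / y @[y --> 0^'] --> c.
    have [D <-] := dh.
    apply: cvg_trans D; apply: near_eq_cvg; near=> y.
    by rewrite /= h0 subr0 addr0 [_%:A]mulr1 mulrC.
  move=> /cvgrPdist_lt dh; apply/cvgrPdist_lt => eps e0.
  have := dh _ e0; rewrite near_withinE => H; near=> y.
  rewrite /slope0 lexx; case: ifPn => [_|]; first by rewrite subrr normr0.
  rewrite -ltNge => y0; have := near H y; rewrite gt_eqF //; exact.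
Unshelve. all: by end_near. Qed.

End RealAnalysis.

Ltac derive_tac :=
  repeat first [eassumption | apply: derC | apply: derI | apply: derN
               | apply: derD | apply: derM ].

(** * The nonlinearity and its Osgood integral *)

Section Nonlinearity.
Variables (R : realType) (f : R -> R).
Notation leb := (@lebesgue_measure R).
Hypotheses (f_gt0 : forall s : R, 0 <= s -> 0 < f s)
    (f_C1 : C1_on_nonneg f)
    (f_convex : convex_function [set s : R | 0 <= s] f)
    (f_ndecr : forall s t : R, 0 <= s -> s <= t -> f s <= f t)
    (f_int :
      (\int[leb]_(s in `[0%R, +oo[) ((f s)^-1)%:E < +oo)%E).

Lemma C1_on_nonneg_derive : exists2 g : R -> R,
  (forall x : R, 0 < x -> has_deriv f x (g x)) &
  forall N : R, 0 <= N -> exists C : R, forall x, 0 <= x <= N -> g x <= C.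
Proof.
have [g cg dg] := f_C1; exists g => [x x0|N N0]; last first.
  have [|c _ cmax] := @EVT_max R g 0 N N0.
    apply: continuous_subspaceW cg => z /=.
    by rewrite in_itv /= => /andP[].
  by exists (g c) => x xN; apply: cmax; rewrite in_itv.
suff H : h^-1 *: ((f \o shift x) (h *: 1) - f x) @[h --> 0^'] --> g x.
  by apply: DeriveDef; [apply/cvg_ex; exists (g x)|exact: cvg_lim].
apply/cvgrPdist_lt => e e0.
have /cvgrPdist_lt /(_ _ e0) := dg x (ltW x0).
rewrite !near_withinE => /nbhs_ballP [r /= r0 H].
apply/nbhs_ballP; exists (Num.min r x); first by rewrite /= lt_min r0.
move=> h; rewrite /ball /= sub0r normrN lt_min => /andP[hr hx] hn.
have := H (h + x); rewrite /ball /=.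
have -> : x - (h + x) = - h by ring.
rewrite normrN => /(_ hr).
have -> : h + x - x = h by ring.
rewrite [h *: 1]mulr1 [h^-1 *: _]mulrC; apply.
- by rewrite -subr_eq0 addrK.
- by move: hx; rewrite ltr_norml; lra.
Qed.

(* [f] is only constrained on the half-line. *)
Definition extend_nonneg s : R := f (Num.max s 0).
Local Notation fe := extend_nonneg.

Lemma extend_nonnegE (s : R) : 0 <= s -> fe s = f s.
Proof. by move=> s0; rewrite /fe max_l. Qed.

Lemma extend_nonneg_gt0 (s : R) : 0 < fe s.
Proof. by apply: f_gt0; rewrite le_max lexx orbT. Qed.

Lemma extend_nonneg_ge0 (s : R) : 0 <= fe s.
Proof. by rewrite ltW // extend_nonneg_gt0. Qed.

Lemma extend_nonneg_homo (s t : R) : s <= t -> fe s <= fe t.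
Proof.
move=> st; apply: f_ndecr; first by rewrite le_max lexx orbT.
by rewrite ge_max !le_max lexx st orbT.
Qed.

Lemma continuous_extend_nonneg : continuous fe.
Proof.
have [g _ dg] := f_C1.
(* Near [x] the difference quotients stay within 1 of [g x], so increments of [f] from [x] are at
   most [|g x| + 1] times the distance. *)
have K (x : R) : 0 <= x -> forall e, 0 < e ->
    exists2 r, 0 < r & forall y, 0 <= y -> `|y - x| < r -> `|f y - f x| < e.
  move=> x0 e e0.
  have /cvgrPdist_lt /(_ _ ltr01) := dg x x0.
  rewrite !near_withinE => /nbhs_ballP [r /= r0 H].
  have C0 : 0 < `|g x| + 1 by apply: ltr_wpDl.
  exists (Num.min r (e / (`|g x| + 1))); first by rewrite lt_min r0 divr_gt0.
  move=> y y0; rewrite lt_min => /andP[yr].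
  have [->|yx] := eqVneq y x; first by rewrite !subrr normr0.
  have := H y; rewrite /ball /= distrC => /(_ yr yx y0) H1.
  rewrite ltr_pdivlMr // => ye; apply: le_lt_trans ye.
  have yx0 : y - x != 0 by rewrite subr_eq0.
  have -> : f y - f x = (y - x) * ((f y - f x) / (y - x)).
    by rewrite mulrCA divff ?mulr1.
  rewrite normrM ler_wpM2l // -lerBlDl.
  by apply: le_trans (ltW H1); rewrite distrC lerB_dist.
move=> x; apply/cvgrPdist_lt => e e0.
have x0 : 0 <= Num.max x 0 by rewrite le_max lexx orbT.
have [r r0 H] := K _ x0 e e0.
near=> y; rewrite distrC; apply: H; first by rewrite le_max lexx orbT.
apply: (@le_lt_trans _ _ `|x - y|); last first.
  by near: y; exact: cvgr_dist_lt.
have h1 := ler_norm (x - y); have := ler_norm (y - x); rewrite distrC => h2.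
by rewrite ler_norml /Num.max; case: ltP => ?; case: ltP => ?; lra.
Unshelve. all: by end_near. Qed.

Local Notation G := (primitive (fun s => (fe s)^-1)).

Let cinv (y : R) : {for y, continuous (fun s => (fe s)^-1)}.
Proof.
apply: continuousV; first by rewrite gt_eqF // extend_nonneg_gt0.
exact: continuous_extend_nonneg.
Qed.

Lemma has_deriv_osgood (x : R) : -1 < x -> has_deriv G x (fe x)^-1.
Proof.
move=> x1; apply: (@has_deriv_primitive _ _ (x + 1)); last lra.
by move=> y _; exact: cinv.
Qed.

Lemma osgood_le (x y : R) : 0 <= x -> x <= y -> G x <= G y.
Proof.
move=> x0 xy; apply: (derive_ge0_le (d := fun x => (fe x)^-1)) => //.
- by move=> z zxy; apply: has_deriv_osgood; lra.
- by move=> z zxy; rewrite invr_ge0 ltW // extend_nonneg_gt0.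
- apply: continuous_within_itv => z zxy.
  by apply: has_deriv_continuous; apply: has_deriv_osgood; lra.
Qed.

Lemma osgood_lt (x y : R) : 0 <= x -> x < y -> G x < G y.
Proof.
move=> x0 xy; have [z|  |z _ e] := MVT_segment (ltW xy) (f := G) (df := fun x => (fe x)^-1).
- by rewrite in_itv /= => zxy; apply: has_deriv_osgood; lra.
- apply: continuous_within_itv => z zxy.
  by apply: has_deriv_continuous; apply: has_deriv_osgood; lra.
- by rewrite -subr_gt0 e mulr_gt0 ?subr_gt0 // invr_gt0 extend_nonneg_gt0.
Qed.

(** The value of the Osgood integral of 1 / f over the whole half-line. *)
Definition osgood_sup : R := sup [set G x | x in [set x | 0 <= x]].
Local Notation F := osgood_sup.

Let has_sup_G : has_sup [set G x | x in [set x | 0 <= x]].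
Proof.
split; first by exists (G 0), 0 => /=.
exists (fine (\int[leb]_(s in `[0%R, +oo[) ((fe s)^-1)%:E)%E) => _ [x /= x0 <-].
apply: (@primitive_le_integral _ _ (x + 1)).
- exact: measurable_itv.
- by move=> y _; exact: cinv.
- lra.
- by move=> y /=; rewrite !in_itv /= => /andP[-> _].
- by move=> y _; rewrite invr_ge0 ltW // extend_nonneg_gt0.
- apply: measurable_funTS; apply: continuous_measurable_fun => y; exact: cinv.
- suff <- : (\int[leb]_(s in `[0%R, +oo[) ((f s)^-1)%:E =
      \int[leb]_(s in `[0%R, +oo[) ((fe s)^-1)%:E)%E by [].
  apply: eq_integral => y.
  by rewrite inE /= in_itv /= andbT => y0; rewrite extend_nonnegE.
Qed.

Lemma osgood_lt_sup (x : R) : 0 <= x -> G x < F.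
Proof.
move=> x0; apply: (@lt_le_trans _ _ (G (x + 1))); first by apply: osgood_lt => //; lra.
by apply: sup_ubound; [exact: has_sup_G.2|exists (x + 1) => //=; lra].
Qed.

Lemma osgood_sup_gt0 : 0 < F.
Proof. by rewrite -[X in X < _](primitive0 (fun s => (fe s)^-1)) osgood_lt_sup. Qed.

Lemma osgood_gt (c : R) : c < F -> exists2 N, 0 <= N & c < G N.
Proof.
move=> cF; have e0 : 0 < F - c by rewrite subr_gt0.
have [_ [N N0 <-]] := sup_adherent e0 has_sup_G.
by rewrite /F subKr; exists N.
Qed.

Lemma osgood_inverse : exists Gi : R -> R,
  [/\ forall x, 0 <= x -> Gi (G x) = x,
      forall y : R, 0 <= y < F -> 0 <= Gi y /\ G (Gi y) = y &
      forall y : R, 0 < y < F -> has_deriv Gi y (fe (Gi y))].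
Proof.
have Ginj (x y : R) : 0 <= x -> 0 <= y -> G x = G y -> x = y.
  move=> x0 y0; have [xy e|xy e|//] := ltgtP x y.
    by have := osgood_lt x0 xy; rewrite e ltxx.
  by have := osgood_lt y0 xy; rewrite e ltxx.
pose Gi y := xget 0 [set x | 0 <= x /\ G x = y].
have GiG (x : R) : 0 <= x -> Gi (G x) = x.
  move=> x0; rewrite /Gi; case: xgetP => [z _ [z0 zx]|/(_ x)].
    exact: Ginj.
  by case; split.
have GGi (y : R) : 0 <= y < F -> 0 <= Gi y /\ G (Gi y) = y.
  move=> /andP[y0 /osgood_gt [N N0 yN]].
  have [||c c0N cy] := @IVT R G 0 N y N0.
  - apply: continuous_within_itv => z zN.
    by apply: has_deriv_continuous; apply: has_deriv_osgood; lra.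
  - by rewrite primitive0 ge_min le_max y0 (ltW yN) orbT.
  rewrite in_itv /= in c0N.
  by rewrite -cy GiG; lra.
exists Gi; split => // y /andP[y0 yF].
have [|Giy0 eGi] := GGi y; first by rewrite yF ltW.
have Giy : 0 < Gi y.
  rewrite lt_neqAle Giy0 andbT; apply/eqP => e.
  by move: y0; rewrite -eGi -e primitive0 ltxx.
rewrite /has_deriv -[X in is_derive X](eGi) -[X in is_derive _ _ _ X]invrK.
apply: is_derive_inverse.
- near=> x; apply: GiG; apply: ltW; near: x; exact: lt_nbhsr.
- near=> x; apply: has_deriv_continuous; apply: has_deriv_osgood.
  by near: x; apply: lt_nbhsr; lra.
- by apply: has_deriv_osgood; lra.
- by rewrite invr_eq0 gt_eqF // extend_nonneg_gt0.
Unshelve. all: by end_near. Qed.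

(* Finiteness of the Osgood integral makes [f] grow faster than [K u] up to
   [u] subexponential in [K]. *)
Lemma superlinear (e : R) : 0 < e -> exists2 C : R, 0 <= C & forall K u : R, 1 <= K -> 0 <= u ->
  K * u <= f u + K * (C * expR (e * K)).
Proof.
move=> e0.
(* Beyond [u0] less than [e] of the Osgood integral is left. *)
have [|u0 u00 Hu0] := @osgood_gt (F - e); first by lra.
have f0 : 0 < f 0 by exact: f_gt0.
exists (f 0 + u0); first lra.
move=> K u K1 u_ge0.
have fu := f_gt0 u_ge0.
have E1 : 1 <= expR (e * K) by rewrite -expR0 ler_expR; nra.
have [?|Kf] := leP (K * u) (f u).
  have : 0 <= K * ((f 0 + u0) * expR (e * K)) by rewrite !mulr_ge0 ?expR_ge0 //; lra.
  lra.
suff : u <= (f 0 + u0) * expR (e * K).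
  by move=> /(ler_wpM2l (_ : 0 <= K)); nra.
have [uu0|u0u] := leP u u0; first nra.
(* If [f u < K * u], convexity keeps [f] on [0, u] below the chord from [f 0] to [K * u]. Hence 1 /
   f is at least 1 / (K (f 0 + s)) there, and the Osgood mass left beyond [u0] bounds ln ((f 0 + u)
   / (f 0 + u0)) by [e * K]. *)
have chord (s : R) : 0 <= s <= u -> fe s <= K * (f 0 + s).
  move=> /andP[s0 su]; rewrite extend_nonnegE //.
  have u_gt0 : 0 < u by lra.
  have su1 : 0 <= s / u <= 1.
    by rewrite divr_ge0 //= ler_pdivrMr // mul1r.
  have [t te] : exists t : {i01 R}, t%:num = s / u.
    have /andP[a0 a1] := su1; exists (Itv01 a0 a1); by [].
  have := f_convex t; move=> /(_ u 0); rewrite !inE /= => /(_ u_ge0 (lexx 0)).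
  set z := conv t _ _; have -> : z = s.
    by rewrite /z [LHS](convRE u 0) te mulr0 addr0 divfK ?gt_eqF.
  rewrite convRE te => /le_trans; apply.
  have : s / u * f u <= s * K.
    by rewrite -mulrA ler_wpM2l // mulrC ler_pdivrMr // ltW.
  rewrite /unstable.onem; set q := s / u in su1 *.
  nra.
have : G u0 + (ln (f 0 + u) - ln (f 0 + u0)) / K <= G u.
  have : (ln (f 0 + u) / K) - (ln (f 0 + u0) / K) <= G u - G u0.
    apply: (derive_le_le_in (F := fun s => ln (f 0 + s) / K) (ltW u0u)
       (d := fun s => (f 0 + s)^-1 / K) (e := fun s => (fe s)^-1)).
    - move=> x xu.
      have fx : 0 < f 0 + x by lra.
      have D : has_deriv (fun s => ln (f 0 + s)) x ((f 0 + x)^-1 * (0 + 1)).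
        apply: (der_comp (F := @ln R)); first exact: is_derive1_ln.
        derive_tac.
      by apply: der_eq; [derive_tac|rewrite /=; ring].
    - by move=> x xu; apply: has_deriv_osgood; lra.
    - move=> x xu; rewrite -invfM lef_pV2 ?posrE ?extend_nonneg_gt0 //.
      + by rewrite mulrC chord //; lra.
      + by rewrite mulr_gt0 //; lra.
  rewrite mulrBl; lra.
have := osgood_lt_sup u_ge0.
have K0 : 0 < K by lra.
move=> H1 H2.
have : (ln (f 0 + u) - ln (f 0 + u0)) / K < e by lra.
rewrite ltr_pdivrMr // => H3.
have : ln (f 0 + u) <= ln ((f 0 + u0) * expR (e * K)).
  rewrite lnM ?posrE ?expR_gt0 //; last lra.
  rewrite expRK; lra.
rewrite ler_ln ?posrE; first lra.
- lra.
- by rewrite mulr_gt0 ?expR_gt0; lra.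
Unshelve. all: by end_near. Qed.

End Nonlinearity.

(** * The integrating factor *)

Section Weights.
Variables (R : realType) (Phi Psi : R -> R).
Hypotheses (cPhi : continuous Phi) (cPsi : continuous Psi)
  (Phi_ge0 : forall t : R, 0 <= Phi t) (Psi_ge0 : forall t : R, 0 <= Psi t)
  (Phi_le1 : forall t : R, Phi t <= 1) (Psi_le1 : forall t : R, Psi t <= 1)
  (Phi0 : Phi 0 = 1) (Psi0 : Psi 0 = 1).

Lemma primitive_has_deriv (g : R -> R) (t : R) : continuous g -> -1 < t ->
  has_deriv (primitive g) t (g t).
Proof.
move=> cg t1; apply: (@has_deriv_primitive _ _ (t + 1)); last by lra.
by move=> y _; exact: cg.
Qed.

(* The integrating factor: [drift a (r ^ 2) = exp (alpha * int_0^r s phi s)]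
   for [a = alpha / 2]. *)
Definition drift (a t : R) : R := expR (a * primitive Phi t).

Lemma drift0 a : drift a 0 = 1.
Proof. by rewrite /drift primitive0 mulr0 expR0. Qed.

Lemma drift_gt0 a t : 0 < drift a t.
Proof. exact: expR_gt0. Qed.

Lemma drift_ge0 a t : 0 <= drift a t.
Proof. by rewrite ltW // drift_gt0. Qed.

Lemma has_deriv_drift (a t : R) : -1 < t ->
  has_deriv (drift a) t (a * Phi t * drift a t).
Proof.
move=> t1; have D := primitive_has_deriv cPhi t1.
apply: der_eq.
  apply: (der_comp (F := @expR R)); first exact: is_derive_expR.
  by derive_tac.
by rewrite /drift /=; ring.
Qed.

Lemma drift_homo (a s t : R) : 0 <= a -> -1 < s -> s <= t -> drift a s <= drift a t.
Proof.
move=> a0 s1 st; rewrite -subr_ge0.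
have := @derive_le_le_in R (fun=> 0) (fun=> 0) (drift a)
  (fun t => a * Phi t * drift a t) s t st.
rewrite subrr; apply.
- by move=> x xst; exact: derC.
- by move=> x xst; apply: has_deriv_drift; lra.
- by move=> x xst; rewrite !mulr_ge0 // ltW // drift_gt0.
Qed.

Lemma drift_ge1 (a t : R) : 0 <= a -> 0 <= t -> 1 <= drift a t.
Proof. by move=> a0 t0; rewrite -(drift0 a) drift_homo //; lra. Qed.

(** A smoothed min (a, 1 / t): the weight 1 / t, truncated in a layer of width about 1 / a at the
    origin. *)
Definition layer a t : R := slope0 a (fun t => 1 - (drift a t)^-1) t.

Lemma layerE a t : 0 < t -> t * layer a t = 1 - (drift a t)^-1.
Proof. by move=> t0; rewrite /layer slope0_gt0 // mulrC divfK // gt_eqF. Qed.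

Lemma continuous_layer a : continuous (layer a).
Proof.
have D (t : R) : -1 < t ->
    has_deriv (fun t => 1 - (drift a t)^-1) t (a * Phi t * (drift a t)^-1).
  move=> t1; have DA := has_deriv_drift a t1.
  have DV := derV (lt0r_neq0 (drift_gt0 a t)) DA.
  apply: der_eq; first by derive_tac.
  by field; rewrite gt_eqF // drift_gt0.
apply: continuous_slope0.
- by apply: (der_eq (D 0 _)); [lra|rewrite Phi0 drift0 invr1 !mulr1].
- by rewrite drift0 invr1 subrr.
- by move=> t t0; apply: has_deriv_continuous (D t _); lra.
Qed.

Lemma layer_ge0 a t : 0 <= a -> 0 <= layer a t.
Proof.
move=> a0; rewrite /layer /slope0; case: (leP t 0) => //= t0.
apply: divr_ge0; last exact: ltW.
by rewrite subr_ge0 invf_le1 ?drift_gt0 // drift_ge1 // ltW.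
Qed.

Lemma layer_le a t : 0 <= a -> layer a t <= a.
Proof.
move=> a0; rewrite /layer /slope0; case: (leP t 0) => //= t0.
rewrite ler_pdivrMr // /drift -expRN.
have : 1 + - (a * primitive Phi t) <= expR (- (a * primitive Phi t)) by exact: expR_ge1Dx.
have : primitive Phi t - primitive Phi 0 <= t - 0.
  apply: (derive_le_le_in (d := Phi) (e := fun=> 1) (ltW t0) (G := fun t => t)).
  - by move=> x xt; apply: primitive_has_deriv => //; lra.
  - by move=> x xt; exact: derI.
  - by move=> x xt; exact: Phi_le1.
rewrite primitive0 => H1 H2.
have : a * primitive Phi t <= a * t by apply: ler_wpM2l => //; lra.
lra.
Qed.

Lemma layer_mul_le1 a t : 0 <= a -> 0 < t -> t * layer a t <= 1.
Proof. by move=> a0 t0; rewrite layerE // gerBl invr_ge0 ltW // drift_gt0. Qed.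

(* [lambda / (2 alpha) * burn a t] bounds from below the decrease of the Osgood
   integral of a solution between [0] and [|x|^2 = t]. *)
Definition burn a t : R := primitive (fun t => Psi t * layer a t) t.

Lemma continuous_burn_rate a : continuous (fun t => Psi t * layer a t).
Proof. by move=> t; apply: continuousM; [exact: cPsi|exact: continuous_layer]. Qed.

Lemma has_deriv_burn a t : -1 < t -> has_deriv (burn a) t (Psi t * layer a t).
Proof. by move=> t1; apply: primitive_has_deriv => //; exact: continuous_burn_rate. Qed.

Lemma burn0 a : burn a 0 = 0. Proof. exact: primitive0. Qed.

Lemma burn_homo a s t : 0 <= a -> 0 <= s -> s <= t -> burn a s <= burn a t.
Proof.
move=> a0 s0 st; rewrite -subr_ge0.
have := @derive_le_le_in R (fun=> 0) (fun=> 0) (burn a)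
  (fun t => Psi t * layer a t) s t st.
rewrite subrr; apply.
- by move=> x xst; exact: derC.
- by move=> x xst; apply: has_deriv_burn; lra.
- by move=> x xst; rewrite mulr_ge0 // layer_ge0.
Qed.

(** [layer] is at most [a] and at most 1 / t, hence at most their geometric mean. This crude power
    of [a] is enough to make [a * b] grow at least linearly in [burn a 1]. *)
Lemma burn_le_sqrt a : 0 <= a -> burn a 1 <= 2 * Num.sqrt a.
Proof.
move=> a0.
have : burn a 1 - burn a 0 <= 2 * Num.sqrt a * Num.sqrt 1 - 2 * Num.sqrt a * Num.sqrt 0.
  apply: (derive_le_le (d := fun t => Psi t * layer a t)
     (e := fun t => Num.sqrt a / Num.sqrt t) (G := fun t => 2 * Num.sqrt a * Num.sqrt t)) => //.
  - by move=> x x01; apply: has_deriv_burn; lra.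
  - move=> x /andP[x0 _].
    have D : has_deriv (@Num.sqrt R) x (2 * Num.sqrt x)^-1 by exact: is_derive1_sqrt.
    apply: der_eq; first by derive_tac.
    by rewrite /=; field; rewrite gt_eqF // sqrtr_gt0.
  - move=> x /andP[x0 _].
    apply: (@le_trans _ _ (layer a x)); first by rewrite ler_piMl // layer_ge0.
    rewrite -sqrtrV; last exact: ltW.
    rewrite -sqrtrM // -[leLHS]ger0_norm ?layer_ge0 // -sqrtr_sqr.
    rewrite ler_sqrt; last by rewrite mulr_ge0 // invr_ge0 ltW.
    rewrite ler_pdivlMr // expr2 -mulrA -[leRHS]mulr1.
    apply: ler_pM; rewrite ?layer_ge0 ?layer_le //.
      by rewrite mulr_ge0 ?layer_ge0 // ltW.
    by rewrite mulrC layer_mul_le1.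
  - apply: continuous_within_itv => x x01.
    by apply: has_deriv_continuous (has_deriv_burn a _); lra.
  - apply: continuous_within_itv => x x01.
    by apply: continuousM; [exact: cst_continuous|exact: sqrt_continuous].
by rewrite burn0 sqrtr1 sqrtr0; lra.
Qed.

Lemma burn_tail_le a t : 0 <= a -> 0 < t <= 1 -> burn a 1 - burn a t <= - ln t.
Proof.
move=> a0 /andP[t0 t1].
have : burn a 1 - burn a t <= ln 1 - ln t.
  apply: (derive_le_le_in (d := fun t => Psi t * layer a t) (e := fun t => t^-1)) => //.
  - by move=> x x1; apply: has_deriv_burn; lra.
  - by move=> x /andP[tx _]; apply: is_derive1_ln; lra.
  - move=> x /andP[tx _]; have x0 : 0 < x by lra.
    apply: (@le_trans _ _ (layer a x)); first by rewrite ler_piMl // layer_ge0.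
    by rewrite -[leRHS]mul1r ler_pdivlMr // mulrC layer_mul_le1.
by rewrite ln1; lra.
Qed.

Lemma Psi_half : exists2 t1 : R, 0 < t1 < 1 & forall t, 0 <= t <= t1 ->
  2^-1 <= Phi t /\ 2^-1 <= Psi t.
Proof.
have H (g : R -> R) : continuous g -> g 0 = 1 -> exists2 r : R, 0 < r & forall t,
    `|t| < r -> 2^-1 <= g t.
  move=> cg g0.
  have /cvgrPdist_lt /(_ 2^-1) := cg 0.
  rewrite invr_gt0 ltr0n => /(_ isT); rewrite g0 => /nbhs_ballP [r /= r0 Hr].
  exists r => // t tr; have := Hr t; rewrite /ball /= sub0r normrN => /(_ tr).
  by rewrite ltr_norml; lra.
have [r r0 Hr] := H _ cPhi Phi0; have [q q0 Hq] := H _ cPsi Psi0.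
exists (Num.min (Num.min r q) 1 / 2).
  by rewrite divr_gt0 ?lt_min ?r0 ?q0 //= ltr_pdivrMr // gt_min; apply/orP; right; lra.
move=> t /andP[t0 tm].
have m0 : 0 < Num.min (Num.min r q) 1 by rewrite !lt_min r0 q0 /=.
have : `|t| < Num.min (Num.min r q) 1 by rewrite ger0_norm //; lra.
by rewrite !lt_min => /andP[/andP[/Hr ? /Hq ?] _].
Qed.

(** On [2 / a, t1], where Phi and Psi are at least 1 / 2, the drift is at least 2 and the integrand
    at least 1 / (4 t). So [burn a 1] is at least ln (a t1 / 2) / 4, and [a0] makes this [|N|]. *)
Lemma burn_unbounded (N : R) : exists2 a0 : R, 0 < a0 & forall a, a0 <= a -> N <= burn a 1.
Proof.
have [t1 /andP[t10 t11] Ht] := Psi_half.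
exists (2 / t1 * expR (4 * `|N|)); first by rewrite mulr_gt0 ?expR_gt0 // divr_gt0.
move=> a Ha.
have E1 : 1 <= expR (4 * `|N|) by rewrite -expR0 ler_expR mulr_ge0.
have a_ge : 2 / t1 <= a.
  by apply: le_trans Ha; rewrite ler_peMr // divr_ge0 // ltW.
have a_gt0 : 0 < a by apply: lt_le_trans a_ge; rewrite divr_gt0.
have s0 : 0 < 2 / a by rewrite divr_gt0.
have st : 2 / a <= t1 by rewrite ler_pdivrMr // mulrC -ler_pdivrMr.
have : ln t1 / 4 - ln (2 / a) / 4 <= burn a t1 - burn a (2 / a).
  apply: (derive_le_le_in (d := fun t => t^-1 / 4) (e := fun t => Psi t * layer a t)
    (F := fun t => ln t / 4)) => //.
  - move=> x /andP[sx _].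
    have D : has_deriv (@ln R) x x^-1 by apply: is_derive1_ln; lra.
    by apply: der_eq; [derive_tac|rewrite /=; ring].
  - by move=> x x1; apply: has_deriv_burn; lra.
  - move=> x /andP[sx xt]; have x0 : 0 < x by lra.
    have [|_ Hpsi] := Ht x; first lra.
    rewrite /layer slope0_gt0 // mulrA.
    rewrite -[leLHS]mulrC ler_pM2r ?invr_gt0 //.
    have : x / 2 - 0 / 2 <= primitive Phi x - primitive Phi 0.
      apply: (derive_le_le_in (d := fun t => 2^-1) (e := Phi) (F := fun t => t / 2)) => //.
      - exact: ltW.
      - move=> y y1; apply: der_eq; first by derive_tac.
        by rewrite /=; ring.
      - by move=> y y1; apply: primitive_has_deriv => //; lra.
      - by move=> y y1; have [] := Ht y; lra.
    rewrite primitive0 mul0r !subr0 => HP.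
    have : 1 <= a * primitive Phi x.
      have : 2 <= a * x by rewrite mulrC -ler_pdivrMr.
      have := ler_wpM2l (ltW a_gt0) HP; lra.
    move=> H1.
    have : 2 <= drift a x.
      by rewrite /drift; have := expR_ge1Dx (a * primitive Phi x); lra.
    move=> H2.
    have : (drift a x)^-1 <= 2^-1 by rewrite lef_pV2 ?posrE ?drift_gt0.
    by nra.
have Ts : burn a t1 <= burn a 1 by rewrite burn_homo // ltW.
have Ss : 0 <= burn a (2 / a) by rewrite -(burn0 a) burn_homo // ltW.
have : ln (expR (4 * `|N|)) <= ln (t1 / (2 / a)).
  rewrite ler_ln ?posrE ?expR_gt0 ?divr_gt0 //.
  have -> : t1 / (2 / a) = a * (t1 / 2) by field; rewrite gt_eqF.
  have -> : expR (4 * `|N|) = 2 / t1 * expR (4 * `|N|) * (t1 / 2).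
    by field; rewrite gt_eqF.
  by rewrite ler_wpM2r // divr_ge0 // ltW.
rewrite expRK ln_div ?posrE // => H1.
have := ler_norm N; lra.
Qed.

End Weights.

(** * Existence from a supersolution *)

Section LipschitzFixpoint.
Variables (R : realType) (L : R) (hi : R -> R) (T : (R -> R) -> R -> R).
Hypotheses (L0 : 0 <= L) (hi0 : forall t : R, 0 <= hi t).

Definition lipschitz_box (v : R -> R) : Prop :=
  (forall s t : R, `|v s - v t| <= L * `|s - t|) /\ forall t : R, 0 <= v t <= hi t.
Local Notation S := lipschitz_box.

Hypotheses (TS : forall v, S v -> S (T v))
  (T_homo : forall v w, S v -> S w -> (forall t, v t <= w t) -> forall t, T v t <= T w t).

(* Knaster-Tarski; a supremum of [L]-Lipschitz functions is [L]-Lipschitz, so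
   no compactness is needed. *)
Lemma lipschitz_box_fixpoint : exists2 u, S u & forall t, T u t = u t.
Proof.
pose E := [set v | S v /\ forall t, v t <= T v t].
have S0 : S (fun=> 0).
  by split=> [s t|t]; rewrite ?subrr ?normr0 ?mulr_ge0 // lexx hi0.
have E0 : E (fun=> 0) by split=> // t; have [_ /(_ t) /andP[]] := TS S0.
pose u t := sup [set v t | v in E].
have hsup t : has_sup [set v t | v in E].
  split; first by exists 0, (fun=> 0).
  by exists (hi t) => _ [v [[_ /(_ t) /andP[_ vt]] _] <-].
have vu v t : E v -> v t <= u t.
  by move=> Ev; apply: sup_ubound; [exact: (hsup t).2|exists v].
have us t z : (forall v, E v -> v t <= z) -> u t <= z.
  move=> H; apply: ge_sup; first exact: (hsup t).1.
  by move=> _ [v Ev <-]; exact: H.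
have lip1 s t : u s - u t <= L * `|s - t|.
  rewrite lerBlDr; apply: us => v Ev; rewrite -lerBlDr.
  have := vu v t Ev; have [[/(_ s t) H _] _] := Ev.
  have := ler_norm (v s - v t); lra.
have Su : S u.
  split=> [s t|t].
    by rewrite ler_norml lip1 andbT; have := lip1 t s; rewrite distrC; lra.
  rewrite (vu _ t E0) us // => v [[_ /(_ t) /andP[]] //].
have uT t : u t <= T u t.
  apply: us => v [Sv vT]; apply: le_trans (vT t) _.
  by apply: T_homo => // s; apply: vu; split.
exists u => // t; apply/eqP; rewrite eq_le uT andbT.
by apply: vu; split; [exact: TS|exact: T_homo (TS Su) uT].
Qed.

End LipschitzFixpoint.

(** * Construction of radial solutions below an explicit supersolution *)

Section Existence.
Variables (R : realType) (f Phi Psi M : R -> R) (B C : R).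
Hypotheses (f_gt0 : forall s : R, 0 <= s -> 0 < f s)
    (f_C1 : C1_on_nonneg f)
    (f_ndecr : forall s t : R, 0 <= s -> s <= t -> f s <= f t)
    (f_int :
      (\int[@lebesgue_measure R]_(s in `[0%R, +oo[) ((f s)^-1)%:E < +oo)%E).
Hypotheses (cPhi : continuous Phi) (cPsi : continuous Psi)
  (Phi_ge0 : forall t : R, 0 <= Phi t) (Psi_ge0 : forall t : R, 0 <= Psi t)
  (Phi_le1 : forall t : R, Phi t <= 1) (Psi_le1 : forall t : R, Psi t <= 1)
  (Phi0 : Phi 0 = 1) (Psi0 : Psi 0 = 1)
  (Phi_gt0 : forall t : R, t < 1 -> 0 < Phi t)
  (Phi_nincr : forall s t : R, s <= t -> Phi t <= Phi s).
Hypotheses (cM : forall t : R, t < 1 -> {for t, continuous M})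
  (M_ge0 : forall t : R, t < 1 -> 0 <= M t)
  (M_ndecr : forall s t : R, s <= t -> t < 1 -> M s <= M t)
  (Psi_leM : forall t : R, 0 <= t < 1 -> Psi t <= Phi t * M t)
  (M_int : forall t : R, 0 <= t < 1 -> primitive M t <= B)
  (C_ge0 : 0 <= C)
  (M_near0 : forall t : R, 0 < t <= 4^-1 -> M t - Psi t <= C * Num.sqrt t).

Local Notation fe := (extend_nonneg f).
Local Notation G := (primitive (fun s => (fe s)^-1)).
Local Notation F := (osgood_sup f).
Local Notation drift := (drift Phi).
Local Notation layer := (layer Phi).
Local Notation burn := (burn Phi Psi).
Local Notation D := (2 * C + 4 * B).

Definition burn_max (a t : R) : R := primitive (fun t => M t * layer a t) t.

Lemma has_deriv_burn_max a t : -1 < t < 1 ->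
  has_deriv (burn_max a) t (M t * layer a t).
Proof.
move=> t1; apply: (has_deriv_primitive (c := 1)) => // y y1.
by apply: continuousM; [exact: cM|exact: continuous_layer].
Qed.

Lemma has_deriv_primM t : -1 < t < 1 -> has_deriv (primitive M) t (M t).
Proof. by move=> t1; apply: (has_deriv_primitive (c := 1)). Qed.

Lemma primM_ge0 t : 0 <= t < 1 -> 0 <= primitive M t.
Proof.
move=> /andP[t0 t1]; rewrite -(primitive0 M) -subr_ge0.
rewrite -[X in X <= _](subrr (0:R)).
apply: (derive_le_le_in (d := fun=> 0) (e := M) t0 (F := fun=> 0)).
- by move=> x _; exact: derC.
- by move=> x xt; apply: has_deriv_primM; lra.
- by move=> x xt; apply: M_ge0; lra.
Qed.

Lemma B_ge0 : 0 <= B.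
Proof. by rewrite -(primitive0 M) M_int // lexx ltr01. Qed.

Lemma burn_max_ge0 a t : 0 <= a -> 0 <= t < 1 -> 0 <= burn_max a t.
Proof.
move=> a0 /andP[t0 t1]; rewrite -(primitive0 (fun t => M t * layer a t)) -subr_ge0.
rewrite -[X in X <= _](subrr (0:R)).
apply: (derive_le_le_in (d := fun=> 0) (e := fun t => M t * layer a t) t0 (F := fun=> 0)).
- by move=> x _; exact: derC.
- by move=> x xt; apply: has_deriv_burn_max; lra.
- by move=> x xt; rewrite mulr_ge0 ?layer_ge0 // M_ge0 //; lra.
Qed.

(** The gap between the weights M and Psi is bounded uniformly in [a]. For t <= 1 / 4 the difference
    M - Psi <= C sqrt t leaves C / sqrt t, with integral at most 2 C; for t > 1 / 4, [layer] is at
    most 4 and the integral of M at most B. *)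
Lemma burn_max_le a t : 0 <= a -> 0 <= t < 1 -> burn_max a t <= burn a 1 + D.
Proof.
move=> a0 /andP[t0 t1].
have dZ x : 0 <= x <= t -> has_deriv (fun t => burn_max a t - burn a t) x
    (M x * layer a x - Psi x * layer a x).
  move=> xt.
  have D1 : has_deriv (burn_max a) x (M x * layer a x) by apply: has_deriv_burn_max; lra.
  have D2 : has_deriv (burn a) x (Psi x * layer a x) by apply: has_deriv_burn => //; lra.
  by apply: der_eq; [derive_tac|rewrite /=; ring].
have dP x : 0 <= x <= t -> has_deriv (primitive M) x (M x).
  by move=> xt; apply: has_deriv_primM; lra.
have : (burn_max a t - burn a t) - (burn_max a 0 - burn a 0) <=
    (2 * C * Num.sqrt t + 4 * primitive M t) - (2 * C * Num.sqrt 0 + 4 * primitive M 0).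
  apply: (derive_le_le t0 (F := fun t => burn_max a t - burn a t)
    (G := fun t => 2 * C * Num.sqrt t + 4 * primitive M t)
    (d := fun x => M x * layer a x - Psi x * layer a x)
    (e := fun x => C / Num.sqrt x + 4 * M x)).
  - by move=> x xt; apply: dZ; lra.
  - move=> x /andP[x0 xt].
    have D1 : has_deriv (@Num.sqrt R) x (2 * Num.sqrt x)^-1 by exact: is_derive1_sqrt.
    have D2 : has_deriv (primitive M) x (M x) by apply: dP; lra.
    apply: der_eq; first by derive_tac.
    by rewrite /=; field; rewrite gt_eqF // sqrtr_gt0.
  - move=> x /andP[x0 xt]; rewrite -mulrBl.
    have l0 := layer_ge0 cPhi Phi_ge0 x a0.
    have l1 := layer_mul_le1 Phi a0 x0.
    have M0 : 0 <= M x by apply: M_ge0; lra.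
    have s0 : 0 < Num.sqrt x by rewrite sqrtr_gt0.
    have [x4|x4] := leP x 4^-1.
      apply: (@le_trans _ _ (C / Num.sqrt x)); last by rewrite lerDl mulr_ge0.
      apply: (@le_trans _ _ (C * Num.sqrt x * layer a x)).
        by apply: ler_wpM2r => //; apply: M_near0; rewrite x0.
      rewrite -mulrA ler_wpM2l // -[leRHS]mul1r ler_pdivlMr //.
      by rewrite mulrAC -expr2 sqr_sqrtr // ltW.
    have : layer a x <= 4 by nra.
    have : 0 <= C / Num.sqrt x by rewrite divr_ge0 // ltW.
    have := Psi_ge0 x; nra.
  - by apply: continuous_within_itv => x /dZ; exact: has_deriv_continuous.
  - apply: continuous_within_itv => x xt.
    apply: continuousD.
      by apply: continuousM; [exact: cst_continuous|exact: sqrt_continuous].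
    apply: continuousM; first exact: cst_continuous.
    by apply: has_deriv_continuous (dP x xt).
rewrite /burn_max burn0 !primitive0 sqrtr0.
have Pt : primitive M t <= B by apply: M_int; rewrite t0.
have st : Num.sqrt t <= 1 by rewrite -[leRHS]sqrtr1 ler_sqrt // ltW.
have := burn_homo cPhi cPsi Phi_ge0 Psi_ge0 Phi0 a0 t0 (ltW t1).
have : C * Num.sqrt t <= C by rewrite ler_piMr.
lra.
Qed.

(* [ubar = G^-1 z] with [z' = - k M layer] and [z 0 = k K]. *)
Lemma supersolution_exists (a k K : R) : 0 <= a -> 0 < k -> k * K < F ->
  burn a 1 + D < K ->
  exists ubar : R -> R, forall t, 0 <= t < 1 ->
    [/\ 0 < ubar t, G (ubar t) <= k * K &
        has_deriv ubar t (- (k * M t * layer a t * fe (ubar t)))].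
Proof.
move=> a0 k0 kKF KD.
have [Gi [GiG GGi dGi]] := osgood_inverse f_gt0 f_C1 f_int.
pose z t := k * (K - burn_max a t).
exists (fun t => Gi (z t)) => t t01.
have zt : 0 < z t <= k * K.
  have := burn_max_le a0 t01; have := burn_max_ge0 a0 t01.
  by rewrite /z pmulr_rgt0 // => ? ?; apply/andP; split; nra.
have [|G0 GE] := GGi (z t); first by lra.
have zF : 0 < z t < F by lra.
split.
- rewrite lt_neqAle G0 andbT; apply/eqP => e.
  by move: zt; rewrite -GE -e primitive0 ltxx.
- by rewrite GE; lra.
- have D1 : has_deriv (burn_max a) t (M t * layer a t) by apply: has_deriv_burn_max; lra.
  have D2 : has_deriv z t (- (k * M t * layer a t)).
    by apply: der_eq; [rewrite /z; derive_tac|rewrite /=; ring].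
  apply: der_eq; first exact: (der_comp (dGi _ zF) D2).
  by rewrite mulrN mulrC.
Qed.

Lemma has_deriv_extend_nonneg (g : R -> R) (x : R) : 0 < x ->
  has_deriv f x (g x) -> has_deriv fe x (g x).
Proof.
move=> x0; apply: near_eq_is_derive; near=> y.
by rewrite extend_nonnegE //; apply: ltW; near: y; exact: lt_nbhsr.
Unshelve. all: by end_near. Qed.

(** The right-hand side of (t A V')' = - mu A Psi f(v) without the factor - mu. The drift is frozen
    for t < 0 because it is controlled only for -1 < t, whereas continuity is wanted on the whole
    line. *)
Definition source (a : R) (v : R -> R) (t : R) : R := drift a (Num.max t 0) * Psi t * fe (v t).

Definition flux (a : R) (v : R -> R) (t : R) : R := primitive (source a v) t.

Lemma flux0 (a : R) (v : R -> R) : flux a v 0 = 0. Proof. exact: primitive0. Qed.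

Lemma sourceE (a : R) (v : R -> R) (t : R) : 0 <= t -> source a v t = drift a t * Psi t * fe (v t).
Proof. by move=> t0; rewrite /source max_l. Qed.

Lemma continuous_source (a : R) (v : R -> R) : continuous v -> continuous (source a v).
Proof.
move=> cv t.
suff : {for t, continuous (fun t : R => drift a (Num.max t 0) * Psi t * fe (v t))} by [].
apply: continuousM; first apply: continuousM.
- apply: (@continuous_comp _ _ _ (fun t : R => Num.max t 0) (drift a)).
    by apply: continuous_max; [exact: cvg_id|exact: cst_continuous].
  have m0 : -1 < Num.max t 0 :> R by rewrite lt_max; apply/orP; right; lra.
  by apply: has_deriv_continuous (has_deriv_drift cPhi a m0).
- exact: cPsi.
- apply: (@continuous_comp _ _ _ v fe); first exact: cv.
  exact: continuous_extend_nonneg.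
Qed.

Lemma has_deriv_flux (a : R) (v : R -> R) (t : R) : continuous v -> -1 < t ->
  has_deriv (flux a v) t (source a v t).
Proof. by move=> cv t1; apply: primitive_has_deriv => //; exact: continuous_source. Qed.

Lemma source_ge0 (a : R) (v : R -> R) (t : R) : 0 <= source a v t.
Proof.
rewrite /source !mulr_ge0 ?drift_ge0 //; exact: extend_nonneg_ge0.
Qed.

Lemma flux_ge0 (a : R) (v : R -> R) (t : R) : continuous v -> 0 <= t -> 0 <= flux a v t.
Proof.
move=> cv t0; rewrite -(primitive0 (source a v)) -subr_ge0 -[X in X <= _](subrr (0:R)).
apply: (derive_le_le_in (d := fun=> 0) (e := source a v) t0 (F := fun=> 0)).
- by move=> x _; exact: derC.
- by move=> x xt; apply: has_deriv_flux => //; lra.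
- by move=> x xt; exact: source_ge0.
Qed.

(** Psi may vanish away from the origin; positivity comes from the initial interval where it is at
    least 1 / 2. *)
Lemma flux_gt0 (a : R) (v : R -> R) (t : R) : 0 <= a -> continuous v -> 0 < t -> 0 < flux a v t.
Proof.
move=> a0 cv t0; have [t1 /andP[t10 t11] Ht] := Psi_half cPhi cPsi Phi0 Psi0.
pose s := Num.min t t1.
have s0 : 0 < s by rewrite lt_min t0.
have st : s <= t by rewrite ge_min lexx.
have st1 : s <= t1 by rewrite ge_min lexx orbT.
have f0 : 0 < fe 0 by exact: extend_nonneg_gt0.
have [m m0 Hm] : exists2 m : R, 0 < m & forall x, m <= fe (v x).
  exists (fe 0) => // x; rewrite {1}/extend_nonneg maxxx /extend_nonneg.
  by apply: f_ndecr => //; rewrite le_max lexx orbT.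
have : 2^-1 * m * s - 2^-1 * m * 0 <= flux a v s - flux a v 0.
  apply: (derive_le_le_in (d := fun=> 2^-1 * m) (e := source a v) (ltW s0)
    (F := fun x => 2^-1 * m * x)).
  - by move=> x _; apply: der_eq; [derive_tac|rewrite /=; ring].
  - by move=> x xt; apply: has_deriv_flux => //; lra.
  - move=> x xt; rewrite sourceE; last by lra.
    have [|_ P2] := Ht x; first by lra.
    have A1 : 1 <= drift a x by apply: drift_ge1 => //; lra.
    apply: ler_pM => //; [exact: ltW|].
    by rewrite -[leLHS]mul1r; apply: ler_pM.
have : 0 <= flux a v t - flux a v s.
  rewrite -[X in X <= _](subrr (0:R)).
  apply: (derive_le_le_in (d := fun=> 0) (e := source a v) st (F := fun=> 0)).
  - by move=> x _; exact: derC.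
  - by move=> x xt; apply: has_deriv_flux => //; lra.
  - by move=> x xt; exact: source_ge0.
have : 0 < 2^-1 * m * s by rewrite !mulr_gt0.
by rewrite flux0; lra.
Qed.

(* If [V' = - mu * slope a v], then [V] solves the radial equation with the
   nonlinearity frozen to [fe (v t)]. *)
Definition slope (a : R) (v : R -> R) (t : R) : R :=
  slope0 (fe (v 0)) (fun t => flux a v t / drift a t) t.

Lemma has_deriv_flux_drift (a : R) (v : R -> R) (t : R) : continuous v -> -1 < t ->
  has_deriv (fun t => flux a v t / drift a t) t
    (source a v t / drift a t - a * Phi t * (flux a v t / drift a t)).
Proof.
move=> cv t1; have D1 := has_deriv_flux a cv t1.
have D2 := derV (lt0r_neq0 (drift_gt0 Phi a t)) (has_deriv_drift cPhi a t1).
by apply: der_eq; [derive_tac|rewrite /=; field; rewrite gt_eqF // drift_gt0].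
Qed.

Lemma continuous_slope (a : R) (v : R -> R) : continuous v -> continuous (slope a v).
Proof.
move=> cv; apply: continuous_slope0.
- apply: der_eq; first by apply: has_deriv_flux_drift => //; lra.
  by rewrite sourceE // flux0 drift0 Psi0 invr1; ring.
- by rewrite flux0 mul0r.
- move=> t t0; apply: has_deriv_continuous (has_deriv_flux_drift _ cv _); lra.
Qed.

Lemma slope_ge0 (a : R) (v : R -> R) (t : R) : continuous v -> 0 <= slope a v t.
Proof.
move=> cv; rewrite /slope /slope0; case: (leP t 0) => /= t0.
  by rewrite extend_nonneg_ge0.
by apply: divr_ge0 (ltW t0); apply: divr_ge0 (drift_ge0 _ _ _); apply: flux_ge0 => //; exact: ltW.
Qed.

Lemma slope_gt0 (a : R) (v : R -> R) (t : R) : 0 <= a -> continuous v -> 0 < slope a v t.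
Proof.
move=> a0 cv; rewrite /slope /slope0; case: (leP t 0) => /= t0.
  by rewrite extend_nonneg_gt0.
by rewrite !divr_gt0 ?flux_gt0 // drift_gt0.
Qed.

(** Since the drift is nondecreasing, dividing the flux by [drift a t] removes it from the bound.
    The result depends neither on [v] nor on [a] and provides the Lipschitz constant of the box. *)
Lemma slope_le (a : R) (v : R -> R) (N t : R) : 0 <= a -> continuous v ->
  (forall s, v s <= N) -> t <= 1 ->
  slope a v t <= fe N.
Proof.
move=> a0 cv vN t1; rewrite /slope /slope0; case: (leP t 0) => /= t0.
  exact: extend_nonneg_homo.
have A0 := drift_gt0 Phi a t.
rewrite ler_pdivrMr // ler_pdivrMr //.
have : flux a v t - flux a v 0 <= fe N * drift a t * t - fe N * drift a t * 0.
  apply: (derive_le_le_in (e := fun=> fe N * drift a t) (d := source a v) (ltW t0)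
    (G := fun x => fe N * drift a t * x)).
  - by move=> x xt; apply: has_deriv_flux => //; lra.
  - by move=> x _; apply: der_eq; [derive_tac|rewrite /=; ring].
  - move=> x xt; rewrite sourceE; last by lra.
    rewrite [leRHS]mulrC; apply: ler_pM.
    + by rewrite mulr_ge0 ?drift_ge0.
    + by rewrite extend_nonneg_ge0.
    + rewrite -[leRHS]mulr1; apply: ler_pM; [exact: drift_ge0|exact: Psi_ge0| |exact: Psi_le1].
      by apply: drift_homo => //; lra.
    + exact: extend_nonneg_homo.
rewrite flux0 mulr0 !subr0 => /le_trans; apply.
by rewrite mulrAC.
Qed.

Lemma slope_homo (a : R) (v w : R -> R) (t : R) : continuous v -> continuous w ->
  (forall s, v s <= w s) ->
  slope a v t <= slope a w t.
Proof.
move=> cv cw vw; rewrite /slope /slope0; case: (leP t 0) => /= t0.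
  exact: extend_nonneg_homo.
rewrite ler_pM2r ?invr_gt0 // ler_pM2r ?invr_gt0 ?drift_gt0 //.
have : flux a v t - flux a v 0 <= flux a w t - flux a w 0.
  apply: (derive_le_le_in (d := source a v) (e := source a w) (ltW t0)).
  - by move=> x xt; apply: has_deriv_flux => //; lra.
  - by move=> x xt; apply: has_deriv_flux => //; lra.
  - move=> x xt; apply: ler_wpM2l; last exact: extend_nonneg_homo.
    by rewrite mulr_ge0 ?drift_ge0.
by rewrite !flux0 !subr0.
Qed.

Let quarter_lt1 : (4^-1 : R) < 1. Proof. by lra. Qed.

Let one_M : 0 <= M 4^-1 / Phi 4^-1.
Proof. by rewrite divr_ge0 // M_ge0. Qed.

(* The second summand dominates the error made when [fe (ubar s)] is replaced
   by [fe (ubar t)] in [int_0^t A' fe (ubar s) ds]. *)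
Lemma flux_le (a k eta N Cf : R) (g ubar v : R -> R) : 0 <= a -> 0 <= k -> 0 <= Cf ->
  (forall t, 0 <= t < 1 -> 0 < ubar t <= N /\
     has_deriv ubar t (- (k * M t * layer a t * fe (ubar t)))) ->
  (forall x, 0 < x <= N -> has_deriv fe x (g x) /\ g x * fe x <= Cf) ->
  k * Cf * (M 4^-1 / Phi 4^-1 + 4 * B) <= eta * f 0 ->
  continuous (source a v) -> (forall t, 0 <= t < 1 -> v t <= ubar t) ->
  forall t, 0 <= t < 1 ->
    a * flux a v t <= (1 + eta) * M t * (drift a t - 1) * fe (ubar t).
Proof.
move=> a0 k0 Cf0 Hu Hg small csrc vu t /andP[t0 t1].
set C1 := M 4^-1 / Phi 4^-1 in small.
have C10 : 0 <= C1 by exact: one_M.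
have C1E : C1 = M 4^-1 / Phi 4^-1 by [].
clearbody C1.
have M0 : 0 <= M t by exact: M_ge0.
have dA x : 0 <= x <= t -> has_deriv (drift a) x (a * Phi x * drift a x).
  by move=> xt; apply: has_deriv_drift => //; lra.
have dP x : 0 <= x <= t -> has_deriv (primitive M) x (M x).
  by move=> xt; apply: has_deriv_primM; lra.
(* Built so that X' dominates (A - 1) M layer: on [0, 1 / 4] the first summand does it, through
   layer <= a, A' = a Phi A and Phi >= Phi (1 / 4); beyond, the derivative of [primitive M] does it,
   through layer <= 4. Yet X is at most (A - 1) (C1 + 4 B). *)
pose X s := C1 * (drift a s - 1) + 4 * (drift a s - 1) * primitive M s.
pose X' s := C1 * (a * Phi s * drift a s) +
  4 * (a * Phi s * drift a s) * primitive M s + 4 * (drift a s - 1) * M s.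
have dX x : 0 <= x <= t -> has_deriv X x (X' x).
  move=> xt; have D1 := dA _ xt; have D2 := dP _ xt.
  by apply: der_eq; [rewrite /X; derive_tac|rewrite /X' /=; ring].
have dfu x : 0 <= x <= t -> has_deriv (fun s => fe (ubar s)) x
    (g (ubar x) * - (k * M x * layer a x * fe (ubar x))).
  move=> xt; have [|ux dux] := Hu x; first by lra.
  by have [dg _] := Hg _ ux; exact: (der_comp dg dux).
have A1 x : 0 <= x <= t -> 1 <= drift a x by move=> xt; apply: drift_ge1 => //; lra.
have XX' x : 0 < x <= t -> (drift a x - 1) * M x * layer a x <= X' x.
  move=> xt.
  have Mx : 0 <= M x by apply: M_ge0; lra.
  have Ax : 1 <= drift a x by apply: A1; lra.
  have P0 : 0 <= primitive M x by apply: primM_ge0; lra.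
  have l0 := layer_ge0 cPhi Phi_ge0 x a0.
  have l1 : layer a x <= a by apply: layer_le.
  have T2 : 0 <= 4 * (a * Phi x * drift a x) * primitive M x.
    by rewrite !mulr_ge0 //; lra.
  rewrite /X'; have [x4|x4] := leP x 4^-1.
    have M1 : M x <= M 4^-1 by exact: M_ndecr.
    have Ph1 : Phi 4^-1 <= Phi x by exact: Phi_nincr.
    have Ph0 : 0 < Phi 4^-1 by rewrite Phi_gt0.
    have T3 : 0 <= 4 * (drift a x - 1) * M x by rewrite !mulr_ge0 //; lra.
    suff : (drift a x - 1) * M x * layer a x <= C1 * (a * Phi x * drift a x) by lra.
    apply: (@le_trans _ _ (drift a x * M 4^-1 * a)).
      by apply: ler_pM => //; [rewrite mulr_ge0 //; lra|apply: ler_pM => //; lra].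
    have -> : C1 * (a * Phi x * drift a x) =
        drift a x * M 4^-1 * a * (Phi x / Phi 4^-1).
      by rewrite C1E; field; rewrite gt_eqF.
    rewrite ler_peMr ?ler_pdivlMr ?mul1r // !mulr_ge0 //; lra.
  have l4 : layer a x <= 4.
    have x0 : 0 < x by lra.
    by have := layer_mul_le1 Phi a0 x0; nra.
  have T1 : 0 <= C1 * (a * Phi x * drift a x) by rewrite !mulr_ge0 //; lra.
  have : (drift a x - 1) * M x * layer a x <= (drift a x - 1) * M x * 4.
    by apply: ler_wpM2l => //; rewrite mulr_ge0 //; lra.
  lra.
(* Since a Psi A <= M(t) A' on [0, t], the flux is compared with M(t) times the integral of A'
   f(ubar). The product rule for (A - 1) f(ubar) loses (A - 1) k M layer g f, where g f <= Cf; the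
   term with X restores it. *)
pose H s := M t * ((drift a s - 1) * fe (ubar s) + k * Cf * X s).
have dH x : 0 <= x <= t -> has_deriv H x (M t * (a * Phi x * drift a x * fe (ubar x)
    - (drift a x - 1) * (g (ubar x) * (k * M x * layer a x * fe (ubar x)))
    + k * Cf * X' x)).
  move=> xt; have D1 := dA _ xt; have D2 := dX _ xt; have D3 := dfu _ xt.
  by apply: der_eq; [rewrite /H; derive_tac|rewrite /=; ring].
have dY x : 0 <= x <= t -> has_deriv (fun s => a * flux a v s) x (a * source a v x).
  move=> xt; have D1 : has_deriv (flux a v) x (source a v x).
    by apply: primitive_has_deriv => //; lra.
  by apply: der_eq; [derive_tac|rewrite /=; ring].
have : a * flux a v t - a * flux a v 0 <= H t - H 0.
  apply: (derive_le_le t0 (F := fun s => a * flux a v s)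
    (d := fun x => a * source a v x) (e := fun x => M t *
    (a * Phi x * drift a x * fe (ubar x)
    - (drift a x - 1) * (g (ubar x) * (k * M x * layer a x * fe (ubar x)))
    + k * Cf * X' x))).
  - by move=> x xt; apply: dY; lra.
  - by move=> x xt; apply: dH; lra.
  - move=> x xt; rewrite /source.
    have [|ux _] := Hu x; first by lra.
    have [_ gf] := Hg _ ux; rewrite max_l; last by lra.
    have Ax : 1 <= drift a x by apply: A1; lra.
    have fx : 0 < fe (ubar x) by exact: extend_nonneg_gt0.
    have main : a * (drift a x * Psi x * fe (v x)) <=
        M t * (a * Phi x * drift a x * fe (ubar x)).
      have fv : fe (v x) <= fe (ubar x) by apply: extend_nonneg_homo => //; apply: vu; lra.
      have fv0 : 0 < fe (v x) by exact: extend_nonneg_gt0.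
      have PM : Psi x <= Phi x * M t.
        apply: (@le_trans _ _ (Phi x * M x)); first by apply: Psi_leM; lra.
        by apply: ler_wpM2l => //; apply: M_ndecr => //; lra.
      rewrite [leRHS](_ : _ = a * (drift a x * (Phi x * M t) * fe (ubar x))); last by ring.
      apply: ler_wpM2l => //; apply: ler_pM => //.
      - by rewrite mulr_ge0 //; lra.
      - exact: ltW.
      - by apply: ler_wpM2l => //; lra.
    have rest : 0 <= k * Cf * X' x -
        (drift a x - 1) * (g (ubar x) * (k * M x * layer a x * fe (ubar x))).
      have XX := XX' x; rewrite subr_ge0.
      have Mx : 0 <= M x by apply: M_ge0; lra.
      have l0 := layer_ge0 cPhi Phi_ge0 x a0.
      apply: (@le_trans _ _ (k * Cf * ((drift a x - 1) * M x * layer a x))); last first.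
        by apply: ler_wpM2l; [rewrite mulr_ge0|apply: XX; lra].
      rewrite [leLHS](_ : _ = k * (g (ubar x) * fe (ubar x)) *
         ((drift a x - 1) * M x * layer a x)); last by ring.
      apply: ler_wpM2r; first by rewrite !mulr_ge0 //; lra.
      exact: ler_wpM2l.
    have := mulr_ge0 M0 rest; lra.
  - by apply: continuous_within_itv => x /dY; exact: has_deriv_continuous.
  - by apply: continuous_within_itv => x /dH; exact: has_deriv_continuous.
have H0 : H 0 = 0 by rewrite /H /X drift0 subrr; ring.
rewrite flux0 H0 mulr0 !subr0 => /le_trans; apply; rewrite /H.
have -> : (1 + eta) * M t * (drift a t - 1) * fe (ubar t) =
  M t * ((drift a t - 1) * fe (ubar t) + (drift a t - 1) * (eta * fe (ubar t))) by ring.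
apply: ler_wpM2l => //; rewrite lerD2l.
have At : 1 <= drift a t by apply: A1; lra.
have [|ut _] := Hu t; first by lra.
have f0 : f 0 <= fe (ubar t).
  by rewrite -(extend_nonnegE f (lexx 0)); apply: extend_nonneg_homo => //; lra.
apply: (@le_trans _ _ (k * Cf * ((drift a t - 1) * (C1 + 4 * B)))).
  apply: ler_wpM2l; first by rewrite mulr_ge0.
  rewrite /X -mulrA -[leLHS](_ : (drift a t - 1) * (C1 + 4 * primitive M t) = _); last by ring.
  apply: ler_wpM2l; first by lra.
  by have := M_int (t := t); rewrite t0 t1 => /(_ isT); lra.
rewrite mulrCA; apply: ler_wpM2l; first by lra.
apply: (le_trans small); apply: ler_wpM2l => //.
have := f_gt0 (lexx 0).
have : 0 <= k * Cf * (C1 + 4 * B).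
  by rewrite !mulr_ge0 // addr_ge0 // mulr_ge0 // B_ge0.
move: small; nra.
Qed.

Let clamp (t : R) : R := Num.min (Num.max t 0) 1.

Let clamp_itv t : 0 <= clamp t <= 1.
Proof. by rewrite /clamp le_min le_max lexx orbT ge_min lexx orbT ler01. Qed.

Let clampE t : 0 <= t <= 1 -> clamp t = t.
Proof. by move=> /andP[t0 t1]; rewrite /clamp max_l // min_l. Qed.

(** The solution operator of the problem frozen at [v], with value 0 at t = 1. Clamping makes it
    constant outside [0, 1], so that its Lipschitz bound is global. *)
Let profile_step (mu a : R) (v : R -> R) (t : R) : R :=
  mu * (primitive (slope a v) 1 - primitive (slope a v) (clamp t)).

Let profile_step_dist mu a v N s t : 0 <= mu -> 0 <= a -> continuous v ->
  (forall s, v s <= N) ->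
  `|profile_step mu a v s - profile_step mu a v t| <= mu * fe N * `|s - t|.
Proof.
move=> mu0 a0 cv vN.
have W x y : 0 <= x -> x <= y -> y <= 1 ->
    0 <= primitive (slope a v) y - primitive (slope a v) x <= fe N * (y - x).
  move=> x0 xy y1; apply/andP; split.
    rewrite -[X in X <= _](subrr (0:R)).
    apply: (derive_le_le_in (d := fun=> 0) (e := slope a v) xy (F := fun=> 0)).
    - by move=> z _; exact: derC.
    - move=> z zxy; apply: primitive_has_deriv; [exact: continuous_slope|lra].
    - by move=> z zxy; exact: slope_ge0.
  rewrite mulrBr.
  apply: (derive_le_le_in (e := fun=> fe N) (d := slope a v) xy (G := fun x => fe N * x)).
  - move=> z zxy; apply: primitive_has_deriv; [exact: continuous_slope|lra].
  - by move=> z _; apply: der_eq; [derive_tac|rewrite /=; ring].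
  - by move=> z zxy; apply: slope_le => //; lra.
have Wn x y : 0 <= x <= 1 -> 0 <= y <= 1 ->
    `|primitive (slope a v) x - primitive (slope a v) y| <= fe N * `|x - y|.
  move=> xx yy; have [xy|/ltW xy] := leP x y.
    have /andP[h1 h2] := W x y ltac:(lra) xy ltac:(lra).
    have xy' : 0 <= y - x by lra.
    by rewrite distrC [`|x - y|]distrC !ger0_norm.
  have /andP[h1 h2] := W y x ltac:(lra) xy ltac:(lra).
  have xy' : 0 <= x - y by lra.
  by rewrite !ger0_norm.
rewrite /profile_step -mulrBr normrM (ger0_norm mu0) -mulrA ler_wpM2l //.
have -> : forall x y z : R, x - y - (x - z) = z - y by move=> *; ring.
rewrite distrC; apply: le_trans (Wn _ _ (clamp_itv s) (clamp_itv t)) _.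
by rewrite ler_wpM2l ?(clamp_dist s t) // extend_nonneg_ge0.
Qed.

Let profile_step_ge0 mu a v t : 0 <= mu -> continuous v -> 0 <= profile_step mu a v t.
Proof.
move=> mu0 cv; rewrite /profile_step mulr_ge0 //.
have /andP[c0 c1] := clamp_itv t.
rewrite -[X in X <= _](subrr (0:R)).
apply: (derive_le_le_in (d := fun=> 0) (e := slope a v) c1 (F := fun=> 0)).
- by move=> z _; exact: derC.
- move=> z zxy; apply: primitive_has_deriv; [exact: continuous_slope|lra].
- by move=> z zxy; exact: slope_ge0.
Qed.

Let profile_step_homo mu a v w t : 0 <= mu -> continuous v -> continuous w ->
  (forall s, v s <= w s) -> profile_step mu a v t <= profile_step mu a w t.
Proof.
move=> mu0 cv cw vw; apply: ler_wpM2l; first exact: mu0.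
have /andP[c0 c1] := clamp_itv t.
apply: (derive_le_le_in (d := slope a v) (e := slope a w) c1).
- move=> z zxy; apply: primitive_has_deriv; [exact: continuous_slope|lra].
- move=> z zxy; apply: primitive_has_deriv; [exact: continuous_slope|lra].
- by move=> z zxy; exact: slope_homo.
Qed.

Lemma D_ge0 : 0 <= D.
Proof. by rewrite addr_ge0 // mulr_ge0 // B_ge0. Qed.

(* For [V] as below, [x |-> V |x|^2] is a solution with [alpha = 2 a] and
   [lambda = 4 a c / (burn a 1 + D + 1)]. *)
Lemma profile_exists (c : R) : 0 < c < F -> exists2 a0 : R, 0 < a0 &
  forall a, a0 <= a -> let mu := a * (c / (burn a 1 + D + 1)) in
  exists V q : R -> R,
  [/\ forall t, -1 < t -> has_deriv V t (- (mu * q t)), continuous q,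
      forall t, 0 < q t, V 1 = 0 /\ q 0 = fe (V 0) &
      forall t, 0 < t < 1 ->
        has_deriv q t ((Psi t * fe (V t) - q t - a * Phi t * (t * q t)) / t)].
Proof.
move=> /andP[c0 cF].
(* (1 + eta) c is the midpoint of c and F: it is still below F, and the room above c pays for the
   error in [flux_le]. *)
pose eta := (F - c) / (2 * c).
have eta0 : 0 < eta by rewrite divr_gt0 //; lra.
have cE : (1 + eta) * c = (F + c) / 2 by rewrite /eta; field; rewrite gt_eqF.
clearbody eta.
(* [N] will bound [ubar] for every [a], so that [Cf] and the threshold [K1] do not depend on [a]. *)
have [|N N0 cN] := @osgood_gt _ _ f_gt0 f_C1 f_int ((1 + eta) * c); first by lra.
have [g dg gb] := C1_on_nonneg_derive f_C1.
have [Cg HCg] := gb _ N0.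
pose Cf := `|Cg| * fe N.
have fN0 : 0 < fe N by exact: extend_nonneg_gt0.
have Cf0 : 0 <= Cf by rewrite mulr_ge0 // ltW.
have Hg x : 0 < x <= N -> has_deriv fe x (g x) /\ g x * fe x <= Cf.
  move=> /andP[x0 xN]; split; first by apply: has_deriv_extend_nonneg => //; exact: dg.
  have gx : g x <= `|Cg|.
    by apply: le_trans (ler_norm _); apply: HCg; rewrite (ltW x0).
  apply: (@le_trans _ _ (`|Cg| * fe x)); first by rewrite ler_wpM2r // extend_nonneg_ge0.
  by rewrite ler_wpM2l // extend_nonneg_homo.
clearbody Cf.
have f00 : 0 < f 0 by exact: f_gt0.
have D0 := D_ge0.
(* With k = (1 + eta) c / K and K > burn a 1, the bound burn a 1 >= K1 is what the smallness
   assumption of [flux_le] asks for. *)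
pose K1 := (1 + eta) * c * Cf * (M 4^-1 / Phi 4^-1 + 4 * B) / (eta * f 0).
have [a0 a00 Ha0] := burn_unbounded cPhi cPsi Phi_ge0 Psi_ge0 Phi0 Psi0 K1.
exists a0 => // a a0a mu.
have a_gt0 : 0 < a by exact: lt_le_trans a0a.
have a_ge0 := ltW a_gt0.
set K := burn a 1 + D + 1 in mu *.
have J0 : 0 <= burn a 1 by rewrite -(burn0 Phi Psi a) burn_homo.
have K0 : 0 < K by rewrite /K; lra.
have [|||ubar Hu] := @supersolution_exists a ((1 + eta) * c / K) K a_ge0.
- by rewrite divr_gt0 // mulr_gt0 // addr_gt0.
- by rewrite divfK ?gt_eqF //; lra.
- by rewrite /K; lra.
set k := (1 + eta) * c / K in Hu.
have k0 : 0 <= k by rewrite divr_ge0 // ?mulr_ge0 // ltW // addr_gt0.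
have kK : k * K = (1 + eta) * c by rewrite /k divfK // gt_eqF.
have uN t : 0 <= t < 1 -> ubar t <= N.
  move=> /Hu [u0 uG _]; rewrite leNgt; apply/negP => Nu.
  have := osgood_lt f_gt0 f_C1 N0 Nu; rewrite kK in uG; lra.
have Hu' t : 0 <= t < 1 -> 0 < ubar t <= N /\
    has_deriv ubar t (- (k * M t * layer a t * fe (ubar t))).
  by move=> t01; have [u0 _ du] := Hu _ t01; rewrite u0 uN.
have small : k * Cf * (M 4^-1 / Phi 4^-1 + 4 * B) <= eta * f 0.
  have Q0 : 0 <= (1 + eta) * c * Cf * (M 4^-1 / Phi 4^-1 + 4 * B).
    have X0 : 0 <= M 4^-1 / Phi 4^-1 + 4 * B by rewrite addr_ge0 ?one_M // mulr_ge0 // B_ge0.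
    by apply: mulr_ge0 X0; rewrite mulr_ge0 // mulr_ge0 ?ltW //; lra.
  have -> : k * Cf * (M 4^-1 / Phi 4^-1 + 4 * B) =
     (1 + eta) * c * Cf * (M 4^-1 / Phi 4^-1 + 4 * B) / K by rewrite /k; ring.
  rewrite ler_pdivrMr // [leRHS]mulrC -ler_pdivrMr ?mulr_gt0 //.
  by apply: (le_trans (Ha0 a a0a)); rewrite /K; lra.
have mu0 : 0 < mu by rewrite /mu !mulr_gt0 // invr_gt0.
(* [ubar] is controlled on [0, 1) only, as M may blow up at 1; elsewhere the constant [N] serves as
   upper barrier. *)
pose hi t := if 0 <= t < 1 then ubar t else N.
have hi0 t : 0 <= hi t.
  by rewrite /hi; case: ifPn => // /Hu [/ltW].
have hiN t : hi t <= N by rewrite /hi; case: ifPn => // /uN.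
have L0 : 0 <= mu * fe N by rewrite mulr_ge0 // ltW.
pose T := profile_step mu a.
have Sc v : lipschitz_box (mu * fe N) hi v -> continuous v.
  by move=> [Sv _]; exact: dist_le_continuous L0 Sv.
have SN v : lipschitz_box (mu * fe N) hi v -> forall s, v s <= N.
  by move=> [_ Sv] s; have /andP[_ /le_trans] := Sv s; apply.
have TS v : lipschitz_box (mu * fe N) hi v -> lipschitz_box (mu * fe N) hi (T v).
  move=> Sv; have cv := Sc _ Sv; have vN := SN _ Sv.
  have Tlip s t : `|T v s - T v t| <= mu * fe N * `|s - t|.
    by apply: profile_step_dist => //; exact: ltW.
  have Tge0 t : 0 <= T v t by apply: profile_step_ge0 => //; exact: ltW.
  have Tu t : 0 <= t < 1 -> T v t <= ubar t.
    move=> /andP[t0 t1].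
    have vu s : 0 <= s < 1 -> v s <= ubar s.
      by move=> s01; have [_ /(_ s)] := Sv; rewrite /hi s01 => /andP[].
    pose Tv s := mu * (primitive (slope a v) 1 - primitive (slope a v) s).
    have TvE s : 0 <= s <= 1 -> T v s = Tv s.
      by move=> s01; rewrite /T /profile_step clampE.
    (* By [flux_le], [ubar] decreases at least as fast as [T v]. *)
    have step s : t <= s < 1 -> ubar s - ubar t <= T v s - T v t.
      move=> /andP[ts s1]; rewrite !TvE; try lra.
      have dTv x : t <= x <= s -> has_deriv Tv x (- (mu * slope a v x)).
        move=> xts; have D1 : has_deriv (primitive (slope a v)) x (slope a v x).
          by apply: primitive_has_deriv; [exact: continuous_slope|lra].
        by apply: der_eq; [rewrite /Tv; derive_tac|rewrite /=; ring].
      have dub x : t <= x <= s -> has_deriv ubar x (- (k * M x * layer a x * fe (ubar x))).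
        by move=> xts; have [|_ _ //] := Hu x; lra.
      apply: (derive_le_le ts (d := fun x => - (k * M x * layer a x * fe (ubar x)))
          (e := fun x => - (mu * slope a v x)) (F := ubar) (G := Tv)).
      - by move=> x xts; apply: dub; lra.
      - by move=> x xts; apply: dTv; lra.
      - move=> x xts; rewrite lerN2.
        have x0 : 0 < x by lra.
        have x1 : 0 <= x < 1 by lra.
        have := flux_le a_ge0 k0 Cf0 Hu' Hg small (@continuous_source a v cv) vu x1.
        rewrite /slope slope0_gt0 // => Hflux.
        have Ax := drift_gt0 Phi a x.
        have -> : mu * (flux a v x / drift a x / x) =
            (c / K) / (drift a x * x) * (a * flux a v x).
          by rewrite /mu; field; rewrite !gt_eqF.
        have -> : k * M x * layer a x * fe (ubar x) =
            (c / K) / (drift a x * x) *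
            ((1 + eta) * M x * (drift a x - 1) * fe (ubar x)).
          rewrite /k /layer slope0_gt0 //; field; rewrite !gt_eqF //.
        apply: ler_wpM2l Hflux.
        by rewrite !divr_ge0 ?mulr_ge0 // ltW.
      - by apply: continuous_within_itv => x /dub; exact: has_deriv_continuous.
      - by apply: continuous_within_itv => x /dTv; exact: has_deriv_continuous.
    (* No boundary value of [ubar] at 1 is available. The comparison stops at some s < 1 so close to
       1 that [T v s <= e], by the Lipschitz bound and [T v 1 = 0], while [ubar s] is positive. *)
    apply/ler_addgt0Pr => e e0.
    pose L := mu * fe N + 1.
    have L1 : 0 < L by rewrite /L; lra.
    pose s := Num.max t (1 - e / L).
    have eL : 0 < e / L by rewrite divr_gt0.
    have s1 : s < 1 by rewrite gt_max t1 /=; lra.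
    have ts : t <= s by rewrite le_max lexx.
    have se : 1 - e / L <= s by rewrite le_max lexx orbT.
    have := step s; rewrite ts s1 => /(_ isT).
    have [|us _ _] := Hu s; first by lra.
    have : T v s <= e.
      have := Tlip s 1; rewrite [T v 1]TvE; last by lra.
      rewrite /Tv subrr mulr0 subr0 => H1.
      apply: le_trans (ler_norm _) _; apply: le_trans H1 _.
      rewrite distrC ger0_norm; last by lra.
      apply: (@le_trans _ _ (L * (1 - s))); first by rewrite ler_wpM2r // /L; lra.
      by rewrite mulrC -ler_pdivlMr //; lra.
    lra.
  split=> // t; rewrite Tge0 /= /hi; case: ifPn => [/Tu //|Ht].
  have [t0|t0] := ltP t 0.
    have -> : T v t = T v 0.
      rewrite /T /profile_step; congr (_ * (_ - primitive _ _)).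
      by rewrite [RHS]clampE ?lexx ?ler01 // /clamp max_r ?min_l // ltW.
    by apply: le_trans (Tu 0 _) (uN _ _); rewrite lexx ltr01.
  have t1 : 1 <= t by rewrite leNgt; apply: contra Ht => ->; rewrite t0.
  have -> : T v t = 0; last by [].
  rewrite /T /profile_step (_ : clamp t = 1) ?subrr ?mulr0 //.
  by rewrite /clamp max_l // min_r.
have TH v w : lipschitz_box (mu * fe N) hi v -> lipschitz_box (mu * fe N) hi w ->
    (forall t, v t <= w t) -> forall t, T v t <= T w t.
  by move=> /Sc cv /Sc cw vw t; apply: profile_step_homo => //; exact: ltW.
have [u Su Tu] := lipschitz_box_fixpoint L0 hi0 TS TH.
have cu := Sc _ Su.
(* Without the clamp the profile is differentiable for all t > -1, in particular at 0 and 1; on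
   [0, 1] it equals the fixed point. *)
exists (fun t => mu * (primitive (slope a u) 1 - primitive (slope a u) t)), (slope a u).
have Vu t : 0 <= t <= 1 -> mu * (primitive (slope a u) 1 - primitive (slope a u) t) = u t.
  by move=> t01; rewrite -[RHS]Tu /T /profile_step clampE.
split.
- move=> t t1.
  have D1 := primitive_has_deriv (@continuous_slope a u cu) t1.
  by apply: der_eq; [derive_tac|rewrite /=; ring].
- exact: continuous_slope.
- by move=> t; exact: slope_gt0.
- by split; rewrite ?subrr ?mulr0 // Vu ?lexx ?ler01 // /slope /slope0 lexx.
- move=> t /andP[t0 t1].
  have D1 : has_deriv (fun t => flux a u t / drift a t) t
      (source a u t / drift a t - a * Phi t * (flux a u t / drift a t)).
    by apply: has_deriv_flux_drift => //; lra.
  have D2 := derV (lt0r_neq0 t0) (derI t).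
  have D3 := derM D1 D2.
  apply: (@near_eq_is_derive _ _ _ (fun t => flux a u t / drift a t / t)).
    by near=> s; rewrite /slope slope0_gt0 //; near: s; exact: lt_nbhsr.
  apply: der_eq; first exact: D3.
  rewrite /slope slope0_gt0 // sourceE ?(ltW t0) // Vu ?(ltW t0) ?(ltW t1) //=.
  by field; rewrite !gt_eqF // drift_gt0.
Unshelve. all: by end_near. Qed.

End Existence.

(** * A priori estimates *)

Section Estimates.
Variables (R : realType) (f Phi Psi : R -> R).
Hypotheses (f_gt0 : forall s : R, 0 <= s -> 0 < f s)
    (f_C1 : C1_on_nonneg f)
    (f_convex : convex_function [set s : R | 0 <= s] f)
    (f_ndecr : forall s t : R, 0 <= s -> s <= t -> f s <= f t)
    (f_int :
      (\int[@lebesgue_measure R]_(s in `[0%R, +oo[) ((f s)^-1)%:E < +oo)%E).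
Hypotheses (cPhi : continuous Phi) (cPsi : continuous Psi)
  (Phi_ge0 : forall t : R, 0 <= Phi t) (Psi_ge0 : forall t : R, 0 <= Psi t)
  (Phi_le1 : forall t : R, Phi t <= 1) (Psi_le1 : forall t : R, Psi t <= 1)
  (Phi0 : Phi 0 = 1) (Psi0 : Psi 0 = 1)
  (Psi_nincr : forall s t : R, s <= t -> Psi t <= Psi s).

Local Notation fe := (extend_nonneg f).
Local Notation G := (primitive (fun s => (fe s)^-1)).
Local Notation F := (osgood_sup f).
Local Notation drift := (drift Phi).
Local Notation layer := (layer Phi).
Local Notation burn := (burn Phi Psi).

(* The radial equation in the variable [t = |x|^2], with [P t = t V'(t)],
   [a = alpha / 2] and [mu = lambda / 4]. *)
Definition radial_profile (a mu : R) (V P : R -> R) : Prop :=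
  [/\ continuous V,
      forall t, 0 <= t <= 1 -> 0 <= V t,
      forall s t, 0 <= s -> s <= t -> t <= 1 -> V t <= V s,
      P 0 = 0 /\ forall t, 0 <= t < 1 -> {for t, continuous P}
    & forall t, 0 < t < 1 -> has_deriv V t (P t / t) /\
        has_deriv P t (- (mu * Psi t * fe (V t)) - a * Phi t * P t)].

Section Profile.
Variables (a b : R) (V P : R -> R).
Hypotheses (a_gt0 : 0 < a) (b_gt0 : 0 < b) (VP : radial_profile a (a * b) V P).

(** On [0, t] the source is at least its value at t with the drift kept, and Phi <= 1 gives a A >=
    A'. The integrand is thus bounded below by a multiple of A', which integrates to A - 1. *)
Lemma profile_slope_ge t : 0 < t < 1 -> b * Psi t * fe (V t) * layer a t <= - (P t / t).
Proof.
move=> /andP[t0 t1]; have [cV V0 Vn [P0 cP] dVP] := VP.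
pose c0 := b * Psi t * fe (V t).
have f0 s : 0 < fe s by exact: extend_nonneg_gt0.
have c00 : 0 <= c0.
  by rewrite /c0 mulr_ge0 ?mulr_ge0 ?Psi_ge0 ?(ltW b_gt0) ?(ltW (f0 _)).
have dA x : 0 <= x <= t -> has_deriv (drift a) x (a * Phi x * drift a x).
  by move=> xt; apply: has_deriv_drift => //; lra.
have : c0 * drift a t - c0 * drift a 0 <= - (drift a t * P t) - - (drift a 0 * P 0).
  apply: (derive_le_le (ltW t0) (F := fun s => c0 * drift a s)
    (G := fun s => - (drift a s * P s)) (d := fun s => c0 * (a * Phi s * drift a s))
    (e := fun s => drift a s * (a * b * Psi s * fe (V s)))).
  - move=> x xt; have D1 : has_deriv (drift a) x (a * Phi x * drift a x) by apply: dA; lra.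
    by apply: der_eq; [derive_tac|rewrite /=; ring].
  - move=> x xt; have D1 : has_deriv (drift a) x (a * Phi x * drift a x) by apply: dA; lra.
    have [|_ D2] := dVP x; first by lra.
    by apply: der_eq; [derive_tac|rewrite /=; ring].
  - move=> x xt; have A0 := drift_ge0 Phi a x.
    have -> : c0 * (a * Phi x * drift a x) = drift a x * (c0 * a * Phi x) by ring.
    apply: ler_wpM2l => //.
    apply: (@le_trans _ _ (c0 * a * 1)).
      by apply: ler_wpM2l; [rewrite mulr_ge0 // ltW|exact: Phi_le1].
    rewrite mulr1 /c0 [leLHS](_ : _ = a * b * (Psi t * fe (V t))); last by ring.
    rewrite -[leRHS]mulrA; apply: ler_wpM2l; first by rewrite mulr_ge0 // ltW.
    apply: ler_pM; [exact: Psi_ge0|exact: ltW|by apply: Psi_nincr; lra|].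
    by apply: extend_nonneg_homo => //; apply: Vn; lra.
  - apply: continuous_within_itv => x xt.
    by apply: continuousM; [exact: cst_continuous|apply: has_deriv_continuous (dA _ xt)].
  - apply: continuous_within_itv => x xt.
    apply: (@continuousN _ _ _ (fun s => drift a s * P s)); apply: continuousM.
      by apply: has_deriv_continuous (dA _ xt).
    by apply: cP; lra.
rewrite P0 drift0 => H.
have A0 := drift_gt0 Phi a t.
rewrite -/c0 {1}/layer slope0_gt0 // -mulNr mulrA ler_pM2r ?invr_gt0 //.
rewrite -(ler_pM2l A0).
have -> : drift a t * (c0 * (1 - (drift a t)^-1)) = c0 * drift a t - c0.
  by field; rewrite gt_eqF.
lra.
Qed.

Lemma profile_slope_le0 t : 0 <= t < 1 -> P t <= 0.
Proof.
move=> /andP[]; rewrite le_eqVlt => /predU1P[<- _|t0 t1].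
  by have [_ _ _ [-> _] _] := VP.
have := @profile_slope_ge t; rewrite t0 t1 => /(_ isT) /(le_trans _) H.
rewrite -oppr_ge0 -(@pmulr_lge0 _ t^-1) ?invr_gt0 // mulNr; apply: H.
by rewrite !mulr_ge0 ?layer_ge0 ?extend_nonneg_ge0 // ltW.
Qed.

Lemma profile_osgood s t : 0 <= s -> s <= t -> t <= 1 ->
  G (V t) + b * burn a t <= G (V s) + b * burn a s.
Proof.
move=> s0 st t1; have [cV V0 Vn _ dVP] := VP.
have dG x : 0 <= x <= 1 -> has_deriv G (V x) (fe (V x))^-1.
  by move=> x1; apply: has_deriv_osgood => //; have := V0 _ x1; lra.
have : b * burn a t - b * burn a s <= - G (V t) - - G (V s).
  apply: (derive_le_le st (F := fun x => b * burn a x) (G := fun x => - G (V x))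
    (d := fun x => b * (Psi x * layer a x)) (e := fun x => - ((fe (V x))^-1 * (P x / x)))).
  - move=> x xst; have D1 : has_deriv (burn a) x (Psi x * layer a x).
      by apply: has_deriv_burn => //; lra.
    by apply: der_eq; [derive_tac|rewrite /=; ring].
  - move=> x xst; have [|D1 _] := dVP x; first by lra.
    by apply: derN; apply: der_comp D1; apply: dG; lra.
  - move=> x xst; have x01 : 0 < x < 1 by lra.
    have H := profile_slope_ge x01.
    have f0 : 0 < fe (V x) by exact: extend_nonneg_gt0.
    rewrite -mulrN -(ler_pM2l f0) [leRHS]mulrA mulrV ?unitfE ?gt_eqF // mul1r.
    by apply: le_trans H; rewrite le_eqVlt; apply/orP; left; apply/eqP; ring.
  - apply: continuous_within_itv => x xst.
    apply: continuousM; first exact: cst_continuous.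
    by apply: has_deriv_continuous (has_deriv_burn cPhi cPsi Phi0 a _); lra.
  - apply: continuous_within_itv => x xst.
    apply: (@continuousN _ _ _ (fun x => G (V x))).
    apply: (@continuous_comp _ _ _ V G); first exact: cV.
    by apply: has_deriv_continuous (dG x _); lra.
lra.
Qed.

Lemma osgood_ge0 x : 0 <= x -> 0 <= G x.
Proof.
by move=> x0; rewrite -(primitive0 (fun s => (fe s)^-1)); apply: osgood_le.
Qed.

Lemma profile_burn_le : b * burn a 1 <= G (V 0).
Proof.
have := profile_osgood (lexx 0) ler01 (lexx 1).
have [_ V0 _ _ _] := VP.
have : 0 <= G (V 1) by apply: osgood_ge0; apply: V0; rewrite ler01 lexx.
rewrite burn0 mulr0; lra.
Qed.

Lemma profile_osgood_lt t : 0 <= t <= 1 -> G (V t) + b * burn a t < F.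
Proof.
move=> /andP[t0 t1]; have := profile_osgood (lexx 0) t0 t1.
have [_ V0 _ _ _] := VP.
have : G (V 0) < F by apply: osgood_lt_sup => //; apply: V0; rewrite lexx ler01.
rewrite burn0 mulr0; lra.
Qed.

Local Notation I := (primitive (fun t => fe (V t))).

Let cfV : continuous (fun t => fe (V t)).
Proof.
have [cV _ _ _ _] := VP => t.
by apply: (@continuous_comp _ _ _ V fe); [exact: cV|exact: continuous_extend_nonneg].
Qed.

(* Multiplying the equation by [1] instead of the integrating factor moves the
   drift onto [V], where convexity of [f] absorbs it. *)
Lemma profile_integral_le (t1 K Q x : R) : 0 < x <= t1 -> t1 < 1 -> K * b = 4 ->
  (forall t, 0 <= t <= t1 -> 2^-1 <= Psi t) ->
  (forall u, 0 <= u -> K * u <= f u + Q) ->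
  I x <= 4 / (a * b) * - P x + Q * x.
Proof.
move=> /andP[x0 xt1] t11 Kb Hpsi HK.
have [cV V0 Vn [P0 cP] dVP] := VP.
have dI s : 0 <= s <= x -> has_deriv I s (fe (V s)).
  by move=> sx; apply: primitive_has_deriv => //; lra.
have dIV s : 0 <= s <= x -> has_deriv (primitive V) s (V s).
  by move=> sx; apply: primitive_has_deriv => //; lra.
(* The right-hand function has derivative - P' - a P, because s V' = P. Replacing the drift a Phi P
   by a P only helps, as P <= 0 and Phi <= 1, and makes the drift integrate exactly in terms of
   V. *)
have H1 : a * b / 2 * I x - a * b / 2 * I 0 <=
    (a * primitive V x - P x - a * (x * V x)) - (a * primitive V 0 - P 0 - a * (0 * V 0)).
  apply: (derive_le_le (ltW x0) (F := fun s => a * b / 2 * I s)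
    (G := fun s => a * primitive V s - P s - a * (s * V s))
    (d := fun s => a * b / 2 * fe (V s))
    (e := fun s => a * b * Psi s * fe (V s) + a * Phi s * P s - a * P s)).
  - move=> s sx; have D1 : has_deriv I s (fe (V s)) by apply: dI; lra.
    by apply: der_eq; [derive_tac|rewrite /=; ring].
  - move=> s sx; have [|D1 D2] := dVP s; first by lra.
    have D3 : has_deriv (primitive V) s (V s) by apply: dIV; lra.
    apply: der_eq; first by derive_tac.
    by rewrite /=; field; rewrite gt_eqF //; lra.
  - move=> s sx.
    have f0 : 0 < fe (V s) by exact: extend_nonneg_gt0.
    have Ps : P s <= 0 by apply: profile_slope_le0; lra.
    have T1 : 0 <= a * (1 - Phi s) * - P s.
      by rewrite !mulr_ge0 ?oppr_ge0 ?subr_ge0 // ltW.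
    have T2 : a * b / 2 * fe (V s) <= a * b * Psi s * fe (V s).
      apply: ler_wpM2r; first exact: ltW.
      by apply: ler_wpM2l; [rewrite mulr_ge0 // ltW|apply: Hpsi; lra].
    lra.
  - apply: continuous_within_itv => s sx.
    by apply: continuousM; [exact: cst_continuous|apply: has_deriv_continuous (dI _ sx)].
  - apply: continuous_within_itv => s sx.
    apply: (@continuousB _ _ _ (fun s => a * primitive V s - P s) (fun s => a * (s * V s))).
      apply: (@continuousB _ _ _ (fun s => a * primitive V s)); last by apply: cP; lra.
      apply: continuousM; first exact: cst_continuous.
      by apply: has_deriv_continuous (dIV _ sx).
    apply: continuousM; first exact: cst_continuous.
    by apply: continuousM; [exact: cvg_id|exact: cV].
have H2 : K * primitive V x - K * primitive V 0 <= (I x + Q * x) - (I 0 + Q * 0).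
  apply: (derive_le_le_in (F := fun s => K * primitive V s)
    (G := fun s => I s + Q * s) (d := fun s => K * V s) (e := fun s => fe (V s) + Q) (ltW x0)).
  - move=> s sx; have D1 := dIV _ sx.
    by apply: der_eq; [derive_tac|rewrite /=; ring].
  - move=> s sx; have D1 := dI _ sx.
    by apply: der_eq; [derive_tac|rewrite /=; ring].
  - move=> s sx; have Vs : 0 <= V s by apply: V0; lra.
    by rewrite extend_nonnegE //; exact: HK.
move: H1 H2; rewrite !primitive0 P0 => H1 H2.
have Vx : 0 <= a * (x * V x).
  by rewrite !mulr_ge0 ?(ltW a_gt0) ?(ltW x0) // V0 //; lra.
have ab0 : 0 < a * b by rewrite mulr_gt0.
have H3 : a * b / 2 * I x <= a * primitive V x - P x by lra.
(* With K b = 4 the term a int V is at most (a b / 4) (I x + Q x), so it absorbs only half of the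
   coefficient a b / 2 on the left. *)
have H4 : a * b * (K * primitive V x) <= a * b * (I x + Q * x).
  by rewrite ler_pM2l //; lra.
have H5 : a * b * (K * primitive V x) = 4 * (a * primitive V x).
  by rewrite -Kb; ring.
rewrite -(ler_pM2l ab0).
have -> : a * b * (4 / (a * b) * - P x + Q * x) = 4 * - P x + a * b * (Q * x).
  by field; rewrite !gt_eqF.
lra.
Qed.

Lemma profile_tail_le (x y N : R) : 0 <= x -> x <= y -> y <= 1 -> V x <= N ->
  I y <= I x + fe N * y.
Proof.
move=> x0 xy y1 VN; have [cV V0 Vn _ _] := VP.
have fN := extend_nonneg_ge0 f_gt0 N.
have : I y - I x <= fe N * y - fe N * x.
  apply: (derive_le_le_in (d := fun s => fe (V s)) (e := fun=> fe N) (G := fun s => fe N * s) xy).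
  - by move=> s sxy; apply: primitive_has_deriv => //; lra.
  - by move=> s sx; apply: der_eq; [derive_tac|rewrite /=; ring].
  - move=> s sx; apply: extend_nonneg_homo => //; apply: le_trans VN.
    by apply: Vn; lra.
have : 0 <= fe N * x by rewrite mulr_ge0.
lra.
Qed.

(* The point [tau] below halves the burn; [- P x <= 2 V tau] for some
   [x] between [tau] and [2 tau] by the mean value theorem. *)
Lemma profile_integral_bound (t1 K Q N y : R) : 0 < y <= t1 -> t1 < 1 -> K * b = 4 -> 0 <= Q ->
  (forall t, 0 <= t <= t1 -> 2^-1 <= Psi t) ->
  (forall u, 0 <= u -> K * u <= f u + Q) ->
  0 < burn a 1 -> 2 * expR (- (burn a 1 / 2)) <= y ->
  0 <= N -> F - b * burn a 1 / 2 <= G N ->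
  I y <= 8 * N / (a * b) + Q * (2 * expR (- (burn a 1 / 2))) + fe N * y.
Proof.
move=> /andP[y0 yt] t11 Kb Q0 Hpsi HK J0 tauy N0 HN.
have [cV V0 Vn [P0 cP] dVP] := VP.
have [||tau] := @IVT R (burn a) 0 1 (burn a 1 / 2) ler01.
- apply: continuous_within_itv => s s01.
  by apply: has_deriv_continuous (has_deriv_burn cPhi cPsi Phi0 a _); lra.
- by rewrite burn0 ge_min le_max; apply/andP; split; apply/orP; [left|right]; lra.
rewrite in_itv /= => /andP[tau0 tau1] btau.
have tau_gt0 : 0 < tau.
  rewrite lt_neqAle tau0 andbT; apply/eqP => e.
  by move: btau; rewrite -e burn0; lra.
(* The other half of the burn occurs on [tau, 1], where it is at most [- ln tau]. *)
have tau_le : tau <= expR (- (burn a 1 / 2)).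
  have := @burn_tail_le _ _ _ cPhi cPsi Phi_ge0 Psi_le1 Phi0 a tau (ltW a_gt0).
  rewrite tau_gt0 tau1 => /(_ isT); rewrite btau => H.
  by rewrite -[leLHS](lnK (_ : tau \is Num.pos)) ?posrE // ler_expR; lra.
(* At [tau] half of [b * burn a 1] has been spent, whence
   [G (V tau) < F - b * burn a 1 / 2 <= G N]. *)
have VtauN : V tau <= N.
  rewrite leNgt; apply/negP => Ntau; have := osgood_lt f_gt0 f_C1 N0 Ntau.
  have := @profile_osgood_lt tau; rewrite tau0 tau1 btau => /(_ isT); lra.
have [|s|//|x] := @MVT R V (fun x => P x / x) tau (2 * tau); first by lra.
- by rewrite in_itv /= => s2; have [|//] := dVP s; lra.
- by apply: continuous_subspaceT.
rewrite in_itv /= => /andP[x1 x2] HV.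
have x0 : 0 < x by lra.
have V2 : 0 <= V (2 * tau) by apply: V0; lra.
have Px : - P x <= 2 * N.
  have pe : P x = P x / x * x by rewrite divfK // gt_eqF.
  have px : P x / x <= 0.
    by rewrite ler_pdivrMr // mul0r; apply: profile_slope_le0; lra.
  move: pe px HV; set p := P x / x => -> px HV; nra.
have := @profile_integral_le t1 K Q x; rewrite x0 => /(_ _ t11 Kb Hpsi HK) HI.
have {}HI := HI ltac:(lra).
have Vx : V x <= N by apply: le_trans VtauN; apply: Vn; lra.
have := profile_tail_le (ltW x0) (_ : x <= y) (_ : y <= 1) Vx.
move=> /(_ ltac:(lra) ltac:(lra)) HT.
have ab0 : 0 < a * b by rewrite mulr_gt0.
have H1 : 4 / (a * b) * - P x <= 8 * N / (a * b).
  rewrite [leRHS](_ : _ = 4 / (a * b) * (2 * N)); last by ring.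
  by apply: ler_wpM2l Px; rewrite divr_ge0 // ltW.
have H2 : Q * x <= Q * (2 * expR (- (burn a 1 / 2))) by apply: ler_wpM2l => //; lra.
lra.
Qed.

End Profile.

End Estimates.

(** * Radial functions on the disk *)

Section Disk.
Variable R : realType.
Implicit Types (x v w : R * R) (F : R * R -> R).

Lemma is_derive_lineP F x v (d : R) :
  is_derive x v F d <-> has_deriv (fun h => F (h *: v + x)) 0 d.
Proof.
have e : (fun h : R => h^-1 *: ((F \o shift x) (h *: v) - F x)) =
  (fun h : R => h^-1 *: (((fun h => F (h *: v + x)) \o shift 0) (h *: 1) -
     (fun h => F (h *: v + x)) 0)).
  by apply/funext => h /=; rewrite scale0r add0r addr0 [h%:A]mulr1.
by split=> -[D <-]; (apply: DeriveDef; [move: D|]); rewrite /derivable /derive e.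
Qed.

Lemma has_deriv_shiftP (g : R -> R) (r d : R) :
  has_deriv g r d <-> has_deriv (fun h => g (h + r)) 0 d.
Proof.
have e : (fun h : R => h^-1 *: ((g \o shift r) (h *: 1) - g r)) =
  (fun h : R => h^-1 *: (((fun h => g (h + r)) \o shift 0) (h *: 1) -
     (fun h => g (h + r)) 0)).
  by apply/funext => h /=; rewrite add0r addr0.
by split=> -[D <-]; (apply: DeriveDef; [move: D|]); rewrite /derivable /derive e.
Qed.

Definition dot v x : R := v.1 * x.1 + v.2 * x.2.
Definition sqn x : R := x.1 ^+ 2 + x.2 ^+ 2.

Lemma sqn_ge0 x : 0 <= sqn x.
Proof. by rewrite addr_ge0 // sqr_ge0. Qed.

Lemma sqn_eq0 x : (sqn x == 0) = (x == 0).
Proof.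
rewrite paddr_eq0 ?sqr_ge0 // !sqrf_eq0.
by case: x => x1 x2; rewrite /= -pair_eqE.
Qed.

Lemma sqn_gt0 x : (0 < sqn x) = (x != 0).
Proof. by rewrite lt_neqAle sqn_ge0 andbT eq_sym sqn_eq0. Qed.

Lemma enormE x : enorm x = Num.sqrt (sqn x). Proof. by []. Qed.

Lemma enorm_sqr x : enorm x ^+ 2 = sqn x.
Proof. by rewrite enormE sqr_sqrtr // sqn_ge0. Qed.

Lemma diskE x : disk x <-> sqn x < 1.
Proof. by rewrite /disk /= enormE -[X in _ < X]sqrtr1 ltr_sqrt. Qed.

Lemma closed_diskE x : closed_disk x <-> sqn x <= 1.
Proof. by rewrite /closed_disk /= enormE -[X in _ <= X]sqrtr1 ler_sqrt. Qed.

Lemma continuous_fst x : {for x, continuous (fun x : R * R => x.1)}.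
Proof. exact: cvg_fst. Qed.

Lemma continuous_snd x : {for x, continuous (fun x : R * R => x.2)}.
Proof. exact: cvg_snd. Qed.

Lemma continuous_dot v x : {for x, continuous (dot v)}.
Proof.
apply: (@continuousD _ _ _ (fun x => v.1 * x.1) (fun x => v.2 * x.2));
  apply: continuousM; try exact: cst_continuous.
- exact: continuous_fst.
- exact: continuous_snd.
Qed.

Lemma continuous_sqn x : {for x, continuous sqn}.
Proof.
apply: (@continuousD _ _ _ (fun x => x.1 ^+ 2) (fun x => x.2 ^+ 2)).
- by apply: (@continuousM _ _ fst fst); exact: continuous_fst.
- by apply: (@continuousM _ _ snd snd); exact: continuous_snd.
Qed.

Lemma continuous_comp_sqn (g : R -> R) x : {for sqn x, continuous g} ->
  {for x, continuous (fun x => g (sqn x))}.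
Proof. by move=> cg; apply: (@continuous_comp _ _ _ sqn g) => //; exact: (@continuous_sqn x). Qed.

Lemma open_disk_near x : disk x -> \forall y \near x, disk y.
Proof.
move=> /diskE x1; have c : {for x, continuous sqn} by exact (@continuous_sqn x).
have H : \forall y \near x, sqn y < 1 by exact: (c [set z | z < 1] (lt_nbhsl x1)).
by near=> y; apply/diskE; near: y.
Unshelve. all: by end_near. Qed.

Lemma has_deriv_sqn_line x v : has_deriv (fun h => sqn (h *: v + x)) 0 (2 * dot v x).
Proof.
rewrite /sqn /dot /= /GRing.scale /=.
by apply: der_eq; [derive_tac|rewrite /=; ring].
Qed.

Lemma has_deriv_dot_line w x v : has_deriv (fun h => dot w (h *: v + x)) 0 (dot w v).
Proof.
rewrite /dot /= /GRing.scale /=.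
by apply: der_eq; [derive_tac|rewrite /=; ring].
Qed.

(** Product rule at a zero of one factor: continuity of the other suffices. This yields second
    derivatives at points where the cofactor is merely known to be continuous, such as [q] at t =
    0. *)
Lemma has_deriv_mul_id (g : R -> R) : {for 0, continuous g} ->
  has_deriv (fun h => h * g h) 0 (g 0).
Proof.
move=> cg.
have H : h^-1 *: (((fun h => h * g h) \o shift 0) (h *: 1) - 0 * g 0) @[h --> 0^'] --> g 0.
  have : g h @[h --> 0^'] --> g 0 by apply: cvg_within_filter; exact: cg.
  apply: cvg_trans; apply: near_eq_cvg.
  near=> h; have h0 : h != 0 by near: h; exact: nbhs_dnbhs_neq.
  by rewrite /= mul0r subr0 addr0 [h%:A]mulr1 /GRing.scale /= mulKf.
by apply: DeriveDef; [apply/cvg_ex; exists (g 0)|exact: cvg_lim].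
Unshelve. all: by end_near. Qed.

(** This direction-dependent factor of the second derivatives has in general no limit at the origin
    but is bounded; multiplied by a function vanishing there it becomes continuous. *)
Lemma dot_bound w v x : exists2 c : R, 0 <= c & forall x, `|dot w x * dot v x / sqn x| <= c.
Proof.
have B u y : `|dot u y| <= (`|u.1| + `|u.2|) * enorm y.
  have Hn (p q : R) : `|p| <= Num.sqrt (p ^+ 2 + q ^+ 2).
    by rewrite -sqrtr_sqr ler_sqrt ?lerDl ?sqr_ge0 // addr_ge0 // sqr_ge0.
  apply: le_trans (ler_normD _ _) _; rewrite !normrM mulrDl; apply: lerD; apply: ler_wpM2l => //.
    exact: Hn.
  by rewrite /enorm addrC; exact: Hn.
exists ((`|w.1| + `|w.2|) * (`|v.1| + `|v.2|)).
  by rewrite mulr_ge0 // addr_ge0.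
move=> y; have [->|y0] := eqVneq y 0.
  rewrite /sqn /= expr0n /= addr0 invr0 mulr0 normr0.
  by rewrite mulr_ge0 // addr_ge0.
rewrite normrM normfV ler_pdivrMr ?normr_gt0 ?sqn_eq0 // (ger0_norm (sqn_ge0 _)).
rewrite -enorm_sqr expr2 normrM.
by rewrite mulrACA; apply: ler_pM.
Qed.

End Disk.

(** * From a radial profile to a C2 function on the disk *)

Section SolutionOfProfile.
Variables (R : realType) (mu : R) (V q e : R -> R).
Implicit Types (x v w : R * R).
Hypotheses (dV : forall t, -1 < t -> has_deriv V t (- (mu * q t)))
  (cq : continuous q) (dq : forall t, 0 < t < 1 -> has_deriv q t (e t / t))
  (ce : forall t, 0 <= t < 1 -> {for t, continuous e}) (e0 : e 0 = 0).

Local Notation U := (fun x => V (sqn x)).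

Lemma is_derive_radial x v : is_derive x v U (- (2 * mu) * (dot v x * q (sqn x))).
Proof.
apply/is_derive_lineP.
have D1 := has_deriv_sqn_line x v.
have E : 0 *: v + x = x by rewrite scale0r add0r.
apply: der_eq.
  apply: (der_comp (F := V)); last exact: D1.
  by rewrite E; apply: dV; apply: lt_le_trans (sqn_ge0 x); lra.
by ring.
Qed.

(** Here e(t) = t q'(t), which stands in for q' because [q] need not be differentiable at 0; at the
    origin the second summand is 0 and [has_deriv_mul_id] applies. *)
Lemma is_derive_dot_radial w x v : disk x ->
  is_derive x v (fun x => dot w x * q (sqn x))
    (dot w v * q (sqn x) + 2 * (dot w x * dot v x / sqn x * e (sqn x))).
Proof.
move=> /diskE x1; apply/is_derive_lineP.
have E : 0 *: v + x = x by rewrite scale0r add0r.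
have D1 := has_deriv_sqn_line x v; have D2 := has_deriv_dot_line w x v.
have [x0|x0] := eqVneq x 0.
  rewrite x0 in E *.
  have -> : (fun h => dot w (h *: v + 0) * q (sqn (h *: v + 0))) =
      (fun h => h * (dot w v * q (h ^+ 2 * sqn v))).
    apply/funext => h; rewrite addr0 mulrA; congr (_ * q _).
      by rewrite /dot /= /GRing.scale /=; ring.
    by rewrite /sqn /= /GRing.scale /=; ring.
  have -> : dot w v * q (sqn 0) + 2 * (dot w 0 * dot v 0 / sqn 0 * e (sqn 0)) =
      dot w v * q (0 ^+ 2 * sqn v).
    by rewrite /sqn /dot /= !mulr0 expr0n /= !mul0r addr0 !mul0r mulr0 addr0.
  apply: (@has_deriv_mul_id _ (fun h => dot w v * q (h ^+ 2 * sqn v))).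
  apply: continuousM; first exact: cst_continuous.
  apply: (@continuous_comp _ _ _ (fun h : R => h ^+ 2 * sqn v) q); last exact: cq.
  apply: continuousM; last exact: cst_continuous.
  by apply: (@continuousM _ _ id id); exact: cvg_id.
have sx : 0 < sqn x by rewrite sqn_gt0.
apply: der_eq.
  apply: derM D2 _; apply: (der_comp (F := q)); last exact: D1.
  by rewrite E; apply: dq; rewrite sx.
by rewrite /= E; field; rewrite gt_eqF.
Qed.

Lemma continuous_partial w v x : disk x ->
  {for x, continuous (fun x => dot w v * q (sqn x) +
     2 * (dot w x * dot v x / sqn x * e (sqn x)))}.
Proof.
move=> /diskE x1.
apply: (@continuousD _ _ _ (fun x => dot w v * q (sqn x))
  (fun x => 2 * (dot w x * dot v x / sqn x * e (sqn x)))).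
  apply: continuousM; first exact: cst_continuous.
  by apply: continuous_comp_sqn; exact: cq.
apply: continuousM; first exact: cst_continuous.
have ces : {for x, continuous (fun x => e (sqn x))}.
  by apply: continuous_comp_sqn; apply: ce; rewrite sqn_ge0.
have [x0|x0] := eqVneq x 0; last first.
  apply: continuousM ces; apply: continuousM.
    by apply: continuousM; exact: (@continuous_dot R _ x).
  by apply: continuousV; [rewrite sqn_eq0|exact: (@continuous_sqn R x)].
have [c c0 Hc] := dot_bound w v x.
have s0 : sqn x = 0 by apply/eqP; rewrite sqn_eq0 x0.
apply/cvgrPdist_lt => eps eps0.
have c1 : 0 < c + 1 by lra.
have /cvgrPdist_lt /(_ (eps / (c + 1))) := ces.
rewrite divr_gt0 // s0 e0 => /(_ isT) H.
near=> y; rewrite mulr0 sub0r normrN normrM.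
apply: (@le_lt_trans _ _ ((c + 1) * `|e (sqn y)|)).
  by apply: ler_wpM2r => //; apply: le_trans (Hc y) _; lra.
rewrite mulrC -ltr_pdivlMr // -normrN -sub0r; near: y; exact: H.
Unshelve. all: by end_near. Qed.

Lemma C2_radial : C2_on_disk U.
Proof.
have DE x v (F : R * R -> R) (d : R) : is_derive x v F d ->
  derivable F x v /\ 'D_v F x = d by case.
have d1E : dx1 U = (fun x => - (2 * mu) * (dot (1, 0) x * q (sqn x))).
  by apply/funext => x; case: (is_derive_radial x (1, 0)).
have d2E : dx2 U = (fun x => - (2 * mu) * (dot (0, 1) x * q (sqn x))).
  by apply/funext => x; case: (is_derive_radial x (0, 1)).
have cF w x : {for x, continuous (fun x => - (2 * mu) * (dot w x * q (sqn x)))}.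
  apply: continuousM; first exact: cst_continuous.
  apply: continuousM; first exact: (@continuous_dot R _ x).
  by apply: continuous_comp_sqn; exact: cq.
have DF w v x : disk x ->
  is_derive x v (fun x => - (2 * mu) * (dot w x * q (sqn x)))
   (- (2 * mu) * (dot w v * q (sqn x) + 2 * (dot w x * dot v x / sqn x * e (sqn x)))).
  by move=> dx; have D := is_derive_dot_radial w v dx; exact: is_deriveZ.
have C1F w : C1_on_disk (fun x => - (2 * mu) * (dot w x * q (sqn x))).
  have cD v x : disk x -> {for x, continuous
      ('D_v (fun x => - (2 * mu) * (dot w x * q (sqn x))))}.
    move=> dx; apply: near_eq_continuous; last first.
      apply: (@continuousM _ _ (fun=> - (2 * mu))); first exact: cst_continuous.
      exact: (@continuous_partial w v x dx).
    have := open_disk_near dx; apply: filterS => y dy.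
    by case: (DF w v y dy).
  move=> x dx; split; [| |exact: cD|exact: cD].
  - by have [] := DF w (1, 0) x dx.
  - by have [] := DF w (0, 1) x dx.
split; last 2 first.
- by rewrite d1E; exact: C1F.
- by rewrite d2E; exact: C1F.
move=> x dx; split.
- by have [] := is_derive_radial x (1, 0).
- by have [] := is_derive_radial x (0, 1).
- by rewrite d1E; exact: cF.
- by rewrite d2E; exact: cF.
Qed.

Lemma laplacian_radial x : disk x -> laplacian U x = - (4 * mu) * (q (sqn x) + e (sqn x)).
Proof.
move=> dx.
have d1E : dx1 U = (fun x => - (2 * mu) * (dot (1, 0) x * q (sqn x))).
  by apply/funext => y; case: (is_derive_radial y (1, 0)).
have d2E : dx2 U = (fun x => - (2 * mu) * (dot (0, 1) x * q (sqn x))).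
  by apply/funext => y; case: (is_derive_radial y (0, 1)).
have DF w v : 'D_v (fun x => - (2 * mu) * (dot w x * q (sqn x))) x =
   - (2 * mu) * (dot w v * q (sqn x) + 2 * (dot w x * dot v x / sqn x * e (sqn x))).
  by have D := is_derive_dot_radial w v dx; have [] := is_deriveZ (- (2 * mu)) D.
rewrite /laplacian d1E d2E /dx1 /dx2 !DF /dot /=.
have [s0|s0] := eqVneq (sqn x) 0.
  by rewrite s0 e0; ring.
have sE : x.1 ^+ 2 + x.2 ^+ 2 = sqn x by [].
have -> : (1 * x.1 + 0 * x.2) * (1 * x.1 + 0 * x.2) = sqn x - x.2 ^+ 2.
  by rewrite -sE; ring.
by field.
Qed.

Lemma radial_derivative_radial x :
  enorm x * radial_derivative U x = - (2 * mu) * (sqn x * q (sqn x)).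
Proof.
rewrite /radial_derivative; have [_ ->] := is_derive_radial x ((enorm x)^-1 *: x).
have -> : dot ((enorm x)^-1 *: x) x = (enorm x)^-1 * sqn x.
  by rewrite /dot /sqn /= /GRing.scale /=; ring.
have [x0|x0] := eqVneq (enorm x) 0.
  by rewrite -enorm_sqr x0; ring.
by field.
Qed.

End SolutionOfProfile.

(** * The coefficients as functions of the squared radius *)

Section Coefficients.
Variables (R : realType).

(* A coefficient [h |x|] as a function of [t = |x|^2]; [Num.sqrt t = 0] for
   [t <= 0]. *)
Definition radial_coef (h : R -> R) (t : R) : R := h (Num.min (Num.sqrt t) 1).

Lemma sqrt_min_itv (t : R) : 0 <= Num.min (Num.sqrt t) 1 <= 1.
Proof. by rewrite le_min sqrtr_ge0 ler01 ge_min lexx orbT. Qed.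

Lemma radial_coefE (h : R -> R) (t : R) : t <= 1 -> radial_coef h t = h (Num.sqrt t).
Proof. by move=> t1; rewrite /radial_coef min_l // -sqrtr1 ler_sqrt. Qed.

Lemma radial_coef0 (h : R -> R) : radial_coef h 0 = h 0.
Proof. by rewrite radial_coefE // sqrtr0. Qed.

Lemma lipschitz_itvP (h : R -> R) : [lipschitz h r | r in `[0, 1]] ->
  exists2 L : R, 0 <= L & forall x y, 0 <= x <= 1 -> 0 <= y <= 1 ->
    `|h x - h y| <= L * `|x - y|.
Proof.
move=> H; have /pinfty_ex_gt0 [L L0 HL] := H.
exists L; first exact: ltW.
by move=> x y x1 y1; apply: (HL (x, y)); split; rewrite /= in_itv.
Qed.

Lemma continuous_radial_coef (h : R -> R) : [lipschitz h r | r in `[0, 1]] ->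
  continuous (radial_coef h).
Proof.
move=> /lipschitz_itvP [L L0 HL].
pose g (r : R) := h (Num.min (Num.max r 0) 1).
have -> : radial_coef h = (fun t => g (Num.sqrt t)).
  by apply/funext => t; rewrite /g /radial_coef max_l // sqrtr_ge0.
have c01 (r : R) : 0 <= Num.min (Num.max r 0) 1 <= 1.
  by rewrite le_min le_max lexx orbT ler01 ge_min lexx orbT.
have cg : continuous g.
  apply: (dist_le_continuous L0) => x y.
  apply: le_trans (HL _ _ (c01 x) (c01 y)) _; apply: ler_wpM2l => //.
  exact: clamp_dist.
by move=> t; apply: (@continuous_comp _ _ _ (@Num.sqrt R) g);
  [exact: sqrt_continuous|exact: cg].
Qed.

Variables (phi psi : R -> R).
Hypotheses
    (phi_ge0 : forall r : R, 0 <= r <= 1 -> 0 <= phi r)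
    (psi_ge0 : forall r : R, 0 <= r <= 1 -> 0 <= psi r)
    (phi_nincr : forall r s : R, 0 <= r -> r <= s -> s <= 1 -> phi s <= phi r)
    (psi_nincr : forall r s : R, 0 <= r -> r <= s -> s <= 1 -> psi s <= psi r)
    (phi_lip : [lipschitz phi r | r in `[0, 1]])
    (psi_lip : [lipschitz psi r | r in `[0, 1]])
    (phi0 : phi 0 = 1) (psi0 : psi 0 = 1)
    (phi_gt0 : forall r : R, 0 <= r < 1 -> 0 < phi r)
    (ratio_int :
      (\int[@lebesgue_measure R]_(s in `[0%R, 1%R[) (max_ratio phi psi s)%:E
         < +oo)%E).

Local Notation M1 := (max_ratio phi psi).

Let phi_le1 (r : R) : 0 <= r <= 1 -> phi r <= 1.
Proof. by move=> /andP[r0 r1]; rewrite -phi0; apply: phi_nincr. Qed.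

Let psi_le1 (r : R) : 0 <= r <= 1 -> psi r <= 1.
Proof. by move=> /andP[r0 r1]; rewrite -psi0; apply: psi_nincr. Qed.

Lemma has_sup_ratio (s : R) : 0 <= s < 1 -> has_sup [set psi r / phi r | r in `[0, s]].
Proof.
move=> /andP[s0 s1]; split.
  by exists (psi 0 / phi 0); exists 0 => //=; rewrite in_itv /= lexx s0.
exists (phi s)^-1 => _ [r /= + <-]; rewrite in_itv /= => /andP[r0 rs].
rewrite -[leRHS]mul1r; apply: ler_pM.
- by apply: psi_ge0; lra.
- by rewrite invr_ge0 phi_ge0 //; lra.
- by apply: psi_le1; lra.
- rewrite lef_pV2 ?posrE; [by apply: phi_nincr => //; lra| |]; apply: phi_gt0; lra.
Qed.

Lemma ratio_le_max (r s : R) : 0 <= r -> r <= s -> s < 1 -> psi r / phi r <= M1 s.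
Proof.
move=> r0 rs s1; apply: sup_ubound; first by apply: (has_sup_ratio _).2; lra.
by exists r => //=; rewrite in_itv /= r0.
Qed.

Lemma max_ratio_le (s c : R) : 0 <= s < 1 ->
  (forall r, 0 <= r <= s -> psi r / phi r <= c) -> M1 s <= c.
Proof.
move=> s1 H; apply: ge_sup; first exact: (has_sup_ratio s1).1.
by move=> _ [r /= + <-]; rewrite in_itv /=; exact: H.
Qed.

Lemma max_ratio0 : M1 0 = 1.
Proof.
have e : psi 0 / phi 0 = 1 by rewrite phi0 psi0 divr1.
apply/eqP; rewrite eq_le; apply/andP; split.
  apply: max_ratio_le; first by rewrite lexx ltr01.
  move=> r r0; have -> : r = 0 by apply/eqP; rewrite eq_le andbC.
  by rewrite e.
by rewrite -[leLHS]e ratio_le_max.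
Qed.

Lemma max_ratio_homo (s t : R) : 0 <= s -> s <= t -> t < 1 -> M1 s <= M1 t.
Proof.
move=> s0 st t1; apply: max_ratio_le; first lra.
by move=> r rs; apply: ratio_le_max; lra.
Qed.

Lemma max_ratio_ge0 (s : R) : 0 <= s < 1 -> 0 <= M1 s.
Proof.
move=> s1; apply: (@le_trans _ _ (M1 0)); first by rewrite max_ratio0.
by apply: max_ratio_homo; lra.
Qed.

(** A running maximum grows no faster than the function itself, and psi / phi is Lipschitz on [0, q]
    since [phi q > 0] bounds the denominators from below. The restriction q < 1 matters because phi
    may vanish at 1. *)
Lemma max_ratio_dist (q : R) : 0 <= q < 1 -> exists2 L : R, 0 <= L &
  forall x y, 0 <= x -> x <= y -> y <= q -> M1 y <= M1 x + L * (y - x).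
Proof.
move=> q01; have /andP[q0 q1] := q01.
have [L1 L10 HL1] := lipschitz_itvP phi_lip.
have [L2 L20 HL2] := lipschitz_itvP psi_lip.
have pq : 0 < phi q by exact: phi_gt0.
exists ((L1 + L2) / phi q ^+ 2); first by rewrite divr_ge0 ?addr_ge0 // sqr_ge0.
set L := _ / _; have L0 : 0 <= L by rewrite divr_ge0 ?addr_ge0 // sqr_ge0.
move=> x y x0 xy yq.
have H (r s : R) : 0 <= r -> r <= s -> s <= q -> psi s / phi s <= psi r / phi r + L * (s - r).
  move=> r0 rs sq.
  have pr : phi q <= phi r by apply: phi_nincr; lra.
  have ps : phi q <= phi s by apply: phi_nincr; lra.
  have h1 := HL1 r s ltac:(lra) ltac:(lra); have h2 := HL2 s r ltac:(lra) ltac:(lra).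
  rewrite -lerBlDl.
  have -> : psi s / phi s - psi r / phi r =
      (psi s * (phi r - phi s) + phi s * (psi s - psi r)) / (phi s * phi r).
    by field; rewrite !gt_eqF //; lra.
  rewrite /L mulrAC; apply: (@le_trans _ _ ((L1 + L2) * (s - r) / (phi s * phi r))); last first.
    apply: ler_wpM2l; first by apply: mulr_ge0; [exact: addr_ge0|lra].
    rewrite lef_pV2 ?posrE ?mulr_gt0 // ?expr2; try lra.
    by apply: ler_pM => //; exact: ltW.
  rewrite ler_pM2r; last by rewrite invr_gt0 mulr_gt0 //; lra.
  have e1 : phi r - phi s <= L1 * (s - r).
    apply: le_trans (ler_norm _) _; apply: le_trans h1 _.
    by rewrite distrC ger0_norm //; lra.
  have e2 : psi s - psi r <= L2 * (s - r).
    apply: le_trans (ler_norm _) _; apply: le_trans h2 _.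
    by rewrite ger0_norm //; lra.
  have s01 : 0 <= s <= 1 by lra.
  have := psi_le1 s01; have := phi_le1 s01; have := psi_ge0 s01; have := phi_ge0 s01.
  have d0 : 0 <= phi r - phi s by rewrite subr_ge0; apply: phi_nincr; lra.
  have b1 : 0 <= L1 * (s - r) by rewrite mulr_ge0 //; lra.
  have b2 : 0 <= L2 * (s - r) by rewrite mulr_ge0 //; lra.
  move: e1 e2 d0 b1 b2; set p1 := L1 * _; set p2 := L2 * _ => *.
  rewrite mulrDl -/p1 -/p2; apply: lerD; nra.
apply: max_ratio_le; first lra.
move=> r /andP[r0 ry].
have Ly : 0 <= L * (y - x) by rewrite mulr_ge0 // subr_ge0.
have [rx|xr] := leP r x.
  by apply: (@le_trans _ _ (M1 x)); [apply: ratio_le_max; lra|lra].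
apply: le_trans (H x r x0 (ltW xr) _) _; first lra.
apply: lerD; first by apply: ratio_le_max => //; lra.
by apply: ler_wpM2l => //; lra.
Qed.

Lemma continuous_max_ratio (r : R) : r < 1 ->
  {for r, continuous (fun r : R => M1 (Num.max r 0))}.
Proof.
move=> r1; pose q := (Num.max r 0 + 1) / 2.
have m1 : Num.max r 0 < 1 by rewrite gt_max r1 ltr01.
have m0 : 0 <= Num.max r 0 by rewrite le_max lexx orbT.
have [|L L0 HL] := @max_ratio_dist q; first by rewrite /q; lra.
have W (x y : R) : Num.max x 0 <= q -> Num.max y 0 <= q ->
    `|M1 (Num.max x 0) - M1 (Num.max y 0)| <= L * `|x - y|.
  have cd (u v : R) : `|Num.max u 0 - Num.max v 0| <= `|u - v|.
    have h1 := ler_norm (u - v); have := ler_norm (v - u); rewrite distrC => h2.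
    by rewrite ler_norml /Num.max; case: ltP => ?; case: ltP => ?; lra.
  move=> xq yq; apply: (@le_trans _ _ (L * `|Num.max x 0 - Num.max y 0|)); last first.
    exact: ler_wpM2l (cd x y).
  have : 0 <= Num.max x 0 by rewrite le_max lexx orbT.
  have : 0 <= Num.max y 0 by rewrite le_max lexx orbT.
  move: xq yq; set x' := Num.max x 0; set y' := Num.max y 0 => xq yq y0 x0.
  have [xy|/ltW xy] := leP x' y'.
    have h := HL _ _ x0 xy yq.
    have h' : M1 x' <= M1 y' by apply: max_ratio_homo; rewrite // /q in yq *; lra.
    rewrite distrC [`|x' - y'|]distrC !ger0_norm ?subr_ge0 //; lra.
  have h := HL _ _ y0 xy xq.
  have h' : M1 y' <= M1 x' by apply: max_ratio_homo; rewrite // /q in xq *; lra.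
  rewrite !ger0_norm ?subr_ge0 //; lra.
apply/cvgrPdist_lt => e e0.
have L1 : 0 < L + 1 by lra.
near=> y.
have yq : Num.max y 0 <= q.
  have ry : y <= q.
    apply: ltW; near: y; apply: lt_nbhsl.
    by apply: (@le_lt_trans _ _ (Num.max r 0)); [rewrite le_max lexx|rewrite /q; lra].
  by rewrite ge_max ry; rewrite /q; lra.
apply: le_lt_trans (W _ _ _ yq) _; first by rewrite /q; lra.
apply: (@le_lt_trans _ _ ((L + 1) * `|r - y|)); first by rewrite ler_wpM2r //; lra.
rewrite mulrC -ltr_pdivlMr //; near: y; apply: cvgr_dist_lt; first exact: cvg_id.
exact: divr_gt0.
Unshelve. all: by end_near. Qed.

Lemma max_ratio_sqrtE (t : R) : M1 (Num.max (Num.sqrt t) 0) = M1 (Num.sqrt t).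
Proof. by rewrite max_l // sqrtr_ge0. Qed.

Let sqrt_lt1 (t : R) : t < 1 -> Num.sqrt t < 1 :> R.
Proof. by move=> t1; rewrite -[X in _ < X]sqrtr1 ltr_sqrt. Qed.

Lemma continuous_max_ratio_sqrt (t : R) : t < 1 ->
  {for t, continuous (fun t : R => M1 (Num.sqrt t))}.
Proof.
move=> t1.
have -> : (fun t : R => M1 (Num.sqrt t)) = (fun t : R => M1 (Num.max (Num.sqrt t) 0)).
  by apply/funext => s; rewrite max_ratio_sqrtE.
apply: (@continuous_comp _ _ _ (@Num.sqrt R) (fun r : R => M1 (Num.max r 0))).
  exact: sqrt_continuous.
by apply: continuous_max_ratio; exact: sqrt_lt1.
Qed.

(** Substituting t = r^2 brings in the Jacobian 2 r <= 2, so the integral in t is at most twice the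
    one in r. *)
Lemma max_ratio_sqrt_int : exists B : R, forall t : R, 0 <= t < 1 ->
  primitive (fun t : R => M1 (Num.sqrt t)) t <= B.
Proof.
have Mg (t : R) : 0 <= t < 1 -> 0 <= M1 (Num.max t 0).
  by move=> t1; rewrite max_l ?max_ratio_ge0 //; lra.
exists (2 * fine (\int[@lebesgue_measure R]_(s in `[0%R, 1%R[) (M1 (Num.max s 0))%:E)%E).
move=> t t01; have /andP[t0 t1] := t01.
have s1 : Num.sqrt t < 1 :> R by exact: sqrt_lt1.
have mf : measurable_fun (`[0%R, 1%R[%classic : set R) (fun r : R => M1 (Num.max r 0)).
  apply: (@measurable_funS _ _ _ _ (`]-oo, 1[%classic : set R)) => //.
    by move=> z /=; rewrite !in_itv /= => /andP[].
  apply: open_continuous_measurable_fun; first exact: interval_open.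
  by move=> z; rewrite inE /= in_itv /=; exact: continuous_max_ratio.
have Ifin : (\int[@lebesgue_measure R]_(s in `[0%R, 1%R[) (M1 (Num.max s 0))%:E < +oo)%E.
  suff -> : (\int[@lebesgue_measure R]_(s in `[0%R, 1%R[) (M1 (Num.max s 0))%:E =
    \int[@lebesgue_measure R]_(s in `[0%R, 1%R[) (M1 s)%:E)%E by [].
  by apply: eq_integral => z; rewrite inE /= in_itv /= => /andP[z0 _]; rewrite max_l.
have H1 := @primitive_le_integral _ (fun r : R => M1 (Num.max r 0)) 1 (Num.sqrt t)
  `[0%R, 1%R[ (measurable_itv _) continuous_max_ratio.
have {}H1 : primitive (fun r : R => M1 (Num.max r 0)) (Num.sqrt t) <=
   fine (\int[@lebesgue_measure R]_(s in `[0%R, 1%R[) (M1 (Num.max s 0))%:E)%E.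
  apply: H1 => //.
  - by rewrite sqrtr_ge0.
  - by move=> z /=; rewrite !in_itv /= => /andP[-> zs]; exact: le_lt_trans s1.
have dM (x : R) : 0 <= x < 1 ->
    has_deriv (primitive (fun t : R => M1 (Num.sqrt t))) x (M1 (Num.sqrt x)).
  move=> x01; apply: (has_deriv_primitive (c := 1)); last lra.
  by move=> y; exact: continuous_max_ratio_sqrt.
have dM1 (x : R) : 0 <= x < 1 ->
    has_deriv (primitive (fun r : R => M1 (Num.max r 0))) x (M1 (Num.max x 0)).
  move=> x01; apply: (has_deriv_primitive (g := fun r : R => M1 (Num.max r 0)) (c := 1)); last lra.
  by move=> y; exact: continuous_max_ratio.
pose G s := 2 * primitive (fun r : R => M1 (Num.max r 0)) (Num.sqrt s).
have sx (x : R) : x <= t -> 0 <= Num.sqrt x < 1.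
  by move=> xt; rewrite sqrtr_ge0 sqrt_lt1 //; lra.
have : primitive (fun t : R => M1 (Num.sqrt t)) t - primitive (fun t : R => M1 (Num.sqrt t)) 0
    <= G t - G 0.
  apply: (derive_le_le t0 (d := fun x => M1 (Num.sqrt x))
     (e := fun x => M1 (Num.sqrt x) / Num.sqrt x)).
  - by move=> x xt; apply: dM; lra.
  - move=> x /andP[x0 xt].
    have D1 : has_deriv (@Num.sqrt R) x (2 * Num.sqrt x)^-1 by exact: is_derive1_sqrt.
    have D2 := dM1 _ (sx x (ltW xt)).
    have D3 := der_comp D2 D1.
    apply: der_eq; first by rewrite /G; apply: derM; [exact: derC|exact: D3].
    by rewrite /= max_ratio_sqrtE; field; rewrite gt_eqF // sqrtr_gt0.
  - move=> x /andP[x0 xt].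
    have /andP[r0 r1] := sx x (ltW xt).
    have p0 : 0 < Num.sqrt x :> R by rewrite sqrtr_gt0.
    have M0 : 0 <= M1 (Num.sqrt x) by apply: max_ratio_ge0; rewrite r0.
    by rewrite ler_pdivlMr // ler_piMr // ltW.
  - by apply: continuous_within_itv => x xt; apply: has_deriv_continuous (dM x _); lra.
  - apply: continuous_within_itv => x /andP[x0 xt].
    apply: continuousM; first exact: cst_continuous.
    apply: (@continuous_comp _ _ _ (@Num.sqrt R) (primitive (fun r : R => M1 (Num.max r 0)))).
      exact: sqrt_continuous.
    by apply: has_deriv_continuous (dM1 _ (sx x xt)).
rewrite /G sqrtr0 !primitive0; lra.
Qed.

(** The maximal ratio and psi both equal 1 at 0 and have linear bounds in r = sqrt t on [0, 1 / 2],
    which is the range t <= 1 / 4. *)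
Lemma max_ratio_sqrt_near0 : exists2 C : R, 0 <= C & forall t : R, 0 < t <= 4^-1 ->
  M1 (Num.sqrt t) - radial_coef psi t <= C * Num.sqrt t.
Proof.
have [|L L0 HL] := @max_ratio_dist 2^-1; first by lra.
have [L2 L20 HL2] := lipschitz_itvP psi_lip.
exists (L + L2); first exact: addr_ge0.
move=> t /andP[t0 t4].
have s2 : Num.sqrt t <= 2^-1 :> R.
  have -> : 2^-1 = Num.sqrt (4^-1 : R).
    have -> : (4^-1 : R) = 2^-1 ^+ 2 by field.
    by rewrite sqrtr_sqr ger0_norm.
  by rewrite ler_sqrt.
have s0 := sqrtr_ge0 t.
rewrite radial_coefE; last lra.
have := HL 0 (Num.sqrt t) (lexx _) s0 s2.
have := HL2 0 (Num.sqrt t) ltac:(lra) ltac:(lra).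
rewrite max_ratio0 psi0 sub0r normrN (ger0_norm s0).
have := ler_norm (1 - psi (Num.sqrt t)); lra.
Qed.

Lemma radial_coef_ratio (t : R) : 0 <= t < 1 ->
  radial_coef psi t <= radial_coef phi t * M1 (Num.sqrt t).
Proof.
move=> /andP[t0 t1]; rewrite !radial_coefE ?(ltW t1) // [leRHS]mulrC -ler_pdivrMr.
  by apply: ratio_le_max => //; exact: sqrt_lt1.
by apply: phi_gt0; rewrite sqrtr_ge0 sqrt_lt1.
Qed.

Lemma max_ratio_sqrt_homo (s t : R) : s <= t -> t < 1 ->
  M1 (Num.sqrt s) <= M1 (Num.sqrt t).
Proof.
move=> st t1; apply: max_ratio_homo; [exact: sqrtr_ge0| |exact: sqrt_lt1].
exact: ler_wsqrtr.
Qed.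

Lemma max_ratio_sqrt_ge0 (t : R) : t < 1 -> 0 <= M1 (Num.sqrt t).
Proof. by move=> t1; apply: max_ratio_ge0; rewrite sqrtr_ge0 sqrt_lt1. Qed.

Lemma radial_coef_bounds (h : R -> R) (t : R) :
  (forall r, 0 <= r <= 1 -> 0 <= h r) ->
  (forall r s : R, 0 <= r -> r <= s -> s <= 1 -> h s <= h r) -> h 0 = 1 ->
  0 <= radial_coef h t <= 1.
Proof.
move=> hg hn h0; have /andP[m0 m1] := sqrt_min_itv t.
rewrite /radial_coef hg ?m0 //=.
by have := hn 0 _ (lexx 0) m0 m1; rewrite h0.
Qed.

Lemma radial_coef_nincr (h : R -> R) (s t : R) :
  (forall r s : R, 0 <= r -> r <= s -> s <= 1 -> h s <= h r) ->
  s <= t -> radial_coef h t <= radial_coef h s.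
Proof.
move=> hn st; have /andP[m0 _] := sqrt_min_itv s; have /andP[_ m1] := sqrt_min_itv t.
apply: hn => //; rewrite le_min !ge_min lexx orbT andbT.
by rewrite ler_wsqrtr.
Qed.

Lemma radial_coef_gt0 (t : R) : t < 1 -> 0 < radial_coef phi t.
Proof.
by move=> t1; rewrite radial_coefE ?(ltW t1) //; apply: phi_gt0; rewrite sqrtr_ge0 sqrt_lt1.
Qed.

End Coefficients.

(** * Reduction to the radial equation *)

Section Solutions.
Variables (R : realType) (f phi psi : R -> R).

Local Notation fe := (extend_nonneg f).
Local Notation Phi := (radial_coef phi).
Local Notation Psi := (radial_coef psi).
Implicit Types (x : R * R).

Hypotheses (f_gt0 : forall s : R, 0 <= s -> 0 < f s) (f_C1 : C1_on_nonneg f)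
    (phi_lip : [lipschitz phi r | r in `[0, 1]])
    (psi_lip : [lipschitz psi r | r in `[0, 1]])
    (psi0 : psi 0 = 1).

Lemma classical_solution_of_profile (a mu : R) (V q : R -> R) : 0 < mu ->
  (forall t, -1 < t -> has_deriv V t (- (mu * q t))) -> continuous q ->
  (forall t, 0 < q t) -> V 1 = 0 -> q 0 = fe (V 0) ->
  (forall t, 0 < t < 1 ->
     has_deriv q t ((Psi t * fe (V t) - q t - a * Phi t * (t * q t)) / t)) ->
  classical_solution f phi psi (2 * a) (4 * mu) (fun x => V (sqn x)).
Proof.
move=> mu0 dV cq q0 V1 q0E dq.
(* By the equation this is t q'(t); the condition [q 0 = fe (V 0)] says that it vanishes at 0. *)
pose e t := Psi t * fe (V t) - q t - a * Phi t * (t * q t).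
have cV (t : R) : -1 < t -> {for t, continuous V}.
  by move=> /dV; exact: has_deriv_continuous.
have ce (t : R) : 0 <= t < 1 -> {for t, continuous e}.
  move=> t01; apply: (@continuousB _ _ _ (fun t => Psi t * fe (V t) - q t)
      (fun t => a * Phi t * (t * q t))).
    apply: (@continuousB _ _ _ (fun t => Psi t * fe (V t))); last exact: cq.
    apply: continuousM; first exact: continuous_radial_coef.
    apply: (@continuous_comp _ _ _ V fe); first by apply: cV; lra.
    exact: continuous_extend_nonneg.
  apply: continuousM; last by apply: continuousM; [exact: cvg_id|exact: cq].
  by apply: continuousM; [exact: cst_continuous|exact: continuous_radial_coef].
have e0 : e 0 = 0 by rewrite /e radial_coef0 psi0 q0E; ring.
have Vdec (s t : R) : 0 <= s -> s < t -> V t < V s.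
  move=> s0 st; have [z| |z _ E] := MVT_segment (ltW st) (f := V) (df := fun t => - (mu * q t)).
  - by rewrite in_itv /= => zst; apply: dV; lra.
  - by apply: continuous_within_itv => z zst; apply: cV; lra.
  - rewrite -subr_lt0 E mulNr oppr_lt0 mulr_gt0 ?subr_gt0 //.
    by rewrite mulr_gt0.
have V0 x : disk x -> 0 < V (sqn x).
  by move=> /diskE x1; rewrite -V1; apply: Vdec => //; exact: sqn_ge0.
split.
- apply: continuous_in_subspaceT => x _; apply: continuous_comp_sqn; apply: cV.
  by apply: lt_le_trans (sqn_ge0 x); lra.
- exact: (C2_radial dV cq dq ce e0).
- move=> x dx; rewrite (laplacian_radial dV cq dq e0 dx).
  have H := radial_derivative_radial dV x.
  rewrite [2 * a * enorm x * phi (enorm x)](_ : _ = 2 * a * phi (enorm x) * enorm x); last by ring.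
  rewrite -[_ * enorm x * _]mulrA H /e.
  have /diskE x1 := dx.
  rewrite !radial_coefE ?(ltW x1) // -enormE (extend_nonnegE f (ltW (V0 x dx))).
  by ring.
- exact: V0.
- move=> x x1; rewrite (_ : sqn x = 1) //.
  by rewrite -enorm_sqr x1 expr1n.
Qed.

(** * From a radial solution on the disk to its profile *)

Section Reduction.
Variables (alpha lambda : R) (U : R * R -> R).
Hypotheses (sol : classical_solution f phi psi alpha lambda U)
  (rad : radially_symmetric U) (dec : radially_decreasing U).

Definition profile_of (t : R) : R := U (Num.min (Num.sqrt t) 1, 0).

Local Notation w := (fun r : R => dx1 U (r, 0)).

Lemma enorm_axis (r : R) : 0 <= r -> enorm (r, 0 : R) = r.
Proof. by move=> r0; rewrite /enorm /= expr0n addr0 sqrtr_sqr ger0_norm. Qed.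

Lemma sqn_axis (r : R) : sqn (r, 0 : R) = r ^+ 2.
Proof. by rewrite /sqn /= expr0n addr0. Qed.

Lemma disk_axis (r : R) : 0 <= r < 1 -> disk (r, 0 : R).
Proof. by move=> /andP[r0 r1]; rewrite /disk /= enorm_axis. Qed.

Lemma radial_solutionE x : closed_disk x -> U x = profile_of (sqn x).
Proof.
move=> cx; have /closed_diskE x1 := cx.
have e1 : Num.sqrt (sqn x) <= 1 by rewrite -[leRHS]sqrtr1 ler_sqrt.
rewrite /profile_of min_l //; apply: rad => //.
  by rewrite /closed_disk /= enorm_axis // sqrtr_ge0.
by rewrite enorm_axis // sqrtr_ge0.
Qed.

Lemma continuous_profile_of : continuous profile_of.
Proof.
have [cU _ _ _ _] := sol.
pose g (t : R) : R * R := (Num.min (Num.sqrt t) 1, 0).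
have cg (t : R) : {for t, continuous g}.
  have ch : {for t, continuous (fun t : R => Num.min (Num.sqrt t) 1)}.
    apply: (@continuous_min _ _ (@Num.sqrt R) (fun=> 1)); last exact: cst_continuous.
    exact: (@sqrt_continuous R t).
  have c0 : {for t, continuous (fun=> 0 : R)} by exact: cst_continuous.
  exact: (@cvg_pair R R R (nbhs t) (nbhs (Num.min (Num.sqrt t) 1)) (nbhs (0 : R)) _ _ _
    (fun t : R => Num.min (Num.sqrt t) 1) (fun=> 0) ch c0).
have gA t : closed_disk (g t).
  by have /andP[m0 m1] := sqrt_min_itv t; rewrite /closed_disk /= enorm_axis.
move=> t; have /subspace_continuousP/(_ (g t) (gA t)) H := cU.
change (U (g s) @[s --> t] --> U (g t)).
apply: (@cvg_comp _ _ _ g U (nbhs t) (within (@closed_disk R) (nbhs (g t)))) H.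
move=> A /=; rewrite /within /= => HA.
have : \forall s \near t, closed_disk (g s) -> A (g s) := cg t _ HA.
by apply: filterS => s; apply.
Qed.

Let dU1 x : disk x -> is_derive x (1, 0) U (dx1 U x).
Proof.
move=> dx; have [_ [C1 _ _] _ _ _] := sol.
by have [D _ _ _] := C1 x dx; exact: DeriveDef.
Qed.

Let axis_deriv (F : R * R -> R) (r d : R) : is_derive (r, 0 : R) (1, 0) F d ->
  has_deriv (fun s => F (s, 0)) r d.
Proof.
move=> /is_derive_lineP D; apply/has_deriv_shiftP.
have -> : (fun h : R => F (h + r, 0)) = (fun h => F (h *: (1, 0) + (r, 0))) => //.
apply/funext => h.
have -> : h *: (1, 0) + (r, 0) = (h * 1 + r, h * 0 + 0) :> R * R by [].
by rewrite mulr1 mulr0 addr0.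
Qed.

(** This is t V'(t), written as r u_r / 2 with r = sqrt t so that it makes sense and is continuous
    at t = 0. *)
Let radial_flux (t : R) : R := Num.sqrt t * dx1 U (Num.sqrt t, 0) / 2.

Let sqrt_itv (t : R) : 0 < t < 1 -> 0 < Num.sqrt t < 1.
Proof. by move=> /andP[t0 t1]; rewrite sqrtr_gt0 t0 -[X in _ < X]sqrtr1 ltr_sqrt. Qed.

Let has_deriv_profile_of (t : R) : 0 < t < 1 -> has_deriv profile_of t (radial_flux t / t).
Proof.
move=> t01; have /andP[t0 t1] := t01; have /andP[r0 r1] := sqrt_itv t01.
have D1 : has_deriv (@Num.sqrt R) t (2 * Num.sqrt t)^-1 by exact: is_derive1_sqrt.
have D2 : has_deriv (fun s => U (s, 0)) (Num.sqrt t) (w (Num.sqrt t)).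
  by apply: axis_deriv; apply: dU1; apply: disk_axis; rewrite (ltW r0).
have D3 := der_comp D2 D1.
apply: (@near_eq_is_derive _ _ _ (fun s => U (Num.sqrt s, 0))).
  near=> s; rewrite /profile_of min_l // -[leRHS]sqrtr1 ler_sqrt //.
  by apply: ltW; near: s; exact: lt_nbhsl.
apply: der_eq; first exact: D3.
rewrite /radial_flux /= -[X in _ = _ / X](sqr_sqrtr (ltW t0)).
by field; rewrite gt_eqF.
Unshelve. all: by end_near. Qed.

Let continuous_radial_flux (t : R) : 0 <= t < 1 -> {for t, continuous radial_flux}.
Proof.
move=> /andP[t0 t1]; have [_ [C1 _ _] _ _ _] := sol.
have r1 : Num.sqrt t < 1 :> R by rewrite -[X in _ < X]sqrtr1 ltr_sqrt.
have [|_ _ c1 _] := C1 (Num.sqrt t, 0); first by apply: disk_axis; rewrite sqrtr_ge0.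
have cs : {for t, continuous (@Num.sqrt R)} by exact: (@sqrt_continuous R t).
apply: (@continuousM _ _ (fun t => Num.sqrt t * dx1 U (Num.sqrt t, 0)) (fun=> 2^-1));
  last exact: cst_continuous.
apply: (@continuousM _ _ (@Num.sqrt R) (fun t => dx1 U (Num.sqrt t, 0))) => //.
apply: (@continuous_comp _ _ _ (fun t : R => (Num.sqrt t, 0 : R)) (dx1 U)); last exact: c1.
have c0 : {for t, continuous (fun=> 0 : R)} by exact: cst_continuous.
exact: (@cvg_pair R R R (nbhs t) (nbhs (Num.sqrt t)) (nbhs (0 : R)) _ _ _
    (@Num.sqrt R) (fun=> 0) cs c0).
Qed.

Let dx2_axis x : disk x -> 0 < sqn x -> dx2 U x = 2 * x.2 * (radial_flux (sqn x) / sqn x).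
Proof.
move=> dx x0; have /diskE x1 := dx.
have D : is_derive x (0, 1) U (2 * x.2 * (radial_flux (sqn x) / sqn x)).
  apply: (@near_eq_is_derive _ _ _ (fun y => profile_of (sqn y))).
    have := open_disk_near dx; apply: filterS => y dy.
    by rewrite radial_solutionE // /closed_disk /=; exact: ltW.
  apply/is_derive_lineP.
  have D1 := has_deriv_sqn_line x (0, 1).
  have E : 0 *: (0, 1) + x = x by rewrite scale0r add0r.
  apply: der_eq.
    apply: (der_comp (F := profile_of)); last exact: D1.
    by rewrite E; apply: has_deriv_profile_of; rewrite x0.
  by rewrite /dot /=; ring.
by case: D.
Qed.

(** The transverse second derivative of a radial function is u_r / r: off the origin [dx2 U] is y.2
    times a continuous function of |y|^2, so on the axis no second derivative of the profile
    enters. *)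
Let dx2dx2_axis (r : R) : 0 < r < 1 -> dx2 (dx2 U) (r, 0) = w r / r.
Proof.
move=> /andP[r0 r1]; have dr : disk (r, 0 : R) by apply: disk_axis; rewrite (ltW r0).
have s0 : 0 < sqn (r, 0 : R) by rewrite sqn_axis exprn_gt0.
have s1 : sqn (r, 0 : R) < 1 by exact/diskE.
pose p t := radial_flux t / t.
have D : is_derive (r, 0 : R) (0, 1) (dx2 U) (w r / r).
  apply: (@near_eq_is_derive _ _ _ (fun y : R * R => 2 * y.2 * p (sqn y))).
    have N0 : \forall y \near (r, 0 : R), 0 < sqn y.
      have c := @continuous_sqn R (r, 0).
      exact: (c [set z | 0 < z] (lt_nbhsr s0)).
    near=> y; rewrite dx2_axis //; first by near: y; exact: open_disk_near.
    by near: y.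
  apply/is_derive_lineP.
  have -> : (fun h : R => 2 * (h *: (0, 1) + (r, 0) : R * R).2 *
        p (sqn (h *: (0, 1) + (r, 0) : R * R))) =
      (fun h => h * (2 * p (r ^+ 2 + h ^+ 2))).
    apply/funext => h; have -> : h *: (0, 1) + (r, 0) = (h * 0 + r, h * 1 + 0) :> R * R by [].
    by rewrite /sqn /= mulr0 mulr1 add0r addr0; ring.
  have -> : w r / r = 2 * p (r ^+ 2 + 0 ^+ 2).
    by rewrite /p /radial_flux expr0n addr0 sqrtr_sqr ger0_norm ?(ltW r0) //; field; rewrite gt_eqF.
  apply: (@has_deriv_mul_id _ (fun h => 2 * p (r ^+ 2 + h ^+ 2))).
  apply: continuousM; first exact: cst_continuous.
  apply: (@continuous_comp _ _ _ (fun h : R => r ^+ 2 + h ^+ 2) p).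
    apply: continuousD; first exact: cst_continuous.
    by apply: (@continuousM _ _ id id); exact: cvg_id.
  rewrite sqn_axis in s0 s1; rewrite expr0n addr0 /p.
  apply: continuousM; first by apply: continuous_radial_flux; rewrite (ltW s0).
  by apply: continuousV; [rewrite gt_eqF|exact: cvg_id].
by case: D.
Unshelve. all: by end_near. Qed.

(** The equation is read on the positive first axis, where [dx1] is the radial derivative and
    [dx2dx2_axis] gives the other second derivative. *)
Lemma radial_profile_of_solution :
  radial_profile f Phi Psi (alpha / 2) (lambda / 4) profile_of
    (fun t => Num.sqrt t * dx1 U (Num.sqrt t, 0) / 2).
Proof.
have [cU [C1 C11 _] eqU U0 U1] := sol.
split.
- exact: continuous_profile_of.
- move=> t /andP[t0 t1]; rewrite /profile_of min_l; last first.
    by rewrite -[leRHS]sqrtr1 ler_sqrt.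
  have : Num.sqrt t <= 1 :> R by rewrite -[leRHS]sqrtr1 ler_sqrt.
  rewrite le_eqVlt => /predU1P[->|r1].
    by rewrite U1 // enorm_axis.
  by apply: ltW; apply: U0; apply: disk_axis; rewrite sqrtr_ge0.
- move=> s t s0 st t1.
  have r1 : Num.sqrt t <= 1 :> R by rewrite -[leRHS]sqrtr1 ler_sqrt.
  have rs : Num.sqrt s <= Num.sqrt t :> R by exact: ler_wsqrtr.
  rewrite /profile_of !min_l //; last exact: le_trans r1.
  move: rs; rewrite le_eqVlt => /predU1P[-> //|rs].
  apply: ltW; apply: dec; rewrite /closed_disk /= ?enorm_axis ?sqrtr_ge0 //.
  by apply: le_trans r1; exact: ltW.
- split; first by rewrite sqrtr0 !mul0r.
  by move=> t; exact: continuous_radial_flux.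
- move=> t t01; split; first exact: has_deriv_profile_of.
  have /andP[t0 t1] := t01; have r01 := sqrt_itv t01; have /andP[r0 r1] := r01.
  have dr : disk (Num.sqrt t, 0 : R) by apply: disk_axis; rewrite (ltW r0).
  have D1 : has_deriv (@Num.sqrt R) t (2 * Num.sqrt t)^-1 by exact: is_derive1_sqrt.
  have D2 : has_deriv w (Num.sqrt t) (dx1 (dx1 U) (Num.sqrt t, 0)).
    apply: axis_deriv; have [D _ _ _] := C11 _ dr; exact: DeriveDef.
  have D3 := der_comp D2 D1.
  have eq := eqU _ dr.
  rewrite /laplacian dx2dx2_axis // enorm_axis ?(ltW r0) // in eq.
  have rdE : radial_derivative U (Num.sqrt t, 0) = w (Num.sqrt t).
    rewrite /radial_derivative enorm_axis ?(ltW r0) //.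
    have -> : (Num.sqrt t)^-1 *: (Num.sqrt t, 0) = (1, 0) :> R * R.
      have -> : (Num.sqrt t)^-1 *: (Num.sqrt t, 0) =
        ((Num.sqrt t)^-1 * Num.sqrt t, (Num.sqrt t)^-1 * 0) :> R * R by [].
      by rewrite mulVf ?gt_eqF // mulr0.
    by [].
  rewrite rdE in eq.
  have Vt : profile_of t = U (Num.sqrt t, 0) by rewrite /profile_of min_l // ltW.
  apply: der_eq.
    apply: derM; last exact: derC.
    by apply: derM; [exact: D1|exact: D3].
  rewrite /= Vt extend_nonnegE; last by apply: ltW; exact: U0.
  rewrite !radial_coefE ?(ltW t1) //.
  set r := Num.sqrt t in eq r0 r1 *.
  have -> : lambda / 4 * psi r * f (U (r, 0)) = (lambda * psi r * f (U (r, 0))) / 4 by ring.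
  by rewrite -eq; field; rewrite gt_eqF.
Qed.

End Reduction.
End Solutions.

(** * Integrals over the disk *)

Section RadialIntegral.
Variables (R : realType) (g : R -> R).
Hypotheses (cg : continuous g) (g_ge0 : forall t : R, 0 <= g t).
Notation leb := (@lebesgue_measure R).

Let csq (s : R) : {for s, continuous (fun s : R => g (s ^+ 2))}.
Proof.
apply: (@continuous_comp _ _ _ (fun s : R => s ^+ 2) g); last exact: cg.
by apply: (@continuousM _ _ id id); exact: cvg_id.
Qed.

Let dI (s : R) : has_deriv (fun s => primitive g (s ^+ 2)) s (2 * s * g (s ^+ 2)).
Proof.
have D1 : has_deriv (primitive g) (s ^+ 2) (g (s ^+ 2)).
  by apply: primitive_has_deriv => //; have := sqr_ge0 s; lra.
have D2 : has_deriv (fun s : R => s ^+ 2) s (s * 1 + s * 1) by exact: (derM (derI s) (derI s)).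
by apply: der_eq; [exact: (der_comp (G := fun s : R => s ^+ 2) D1 D2)|ring].
Qed.

Lemma integral_abs_sqr (d : R) : 0 < d ->
  (\int[leb]_(s in `[(- d)%R, d]) (2 * `|s| * g (s ^+ 2))%:E)%E = (2 * primitive g (d ^+ 2))%:E.
Proof.
move=> d0.
have cabs (s : R) : {for s, continuous (fun s : R => 2 * `|s| * g (s ^+ 2))}.
  apply: continuousM; last exact: csq.
  by apply: continuousM; [exact: cst_continuous|exact: norm_continuous].
have FTC (F : R -> R) (u v : R) : u < v -> (forall s, u <= s <= v -> {for s, continuous F}) ->
    (forall s, u < s < v -> has_deriv F s (2 * `|s| * g (s ^+ 2))) ->
    (\int[leb]_(s in `[u, v]) (2 * `|s| * g (s ^+ 2))%:E)%E = (F v - F u)%:E.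
  move=> uv cF dF; rewrite (@continuous_FTC2 R (fun s => 2 * `|s| * g (s ^+ 2)) F) //.
  - by apply: continuous_within_itv => s _; exact: cabs.
  - split.
    + by move=> z; rewrite in_itv /= => zx; have [] := dF z zx.
    + by apply: cvg_at_right_filter; apply: cF; lra.
    + by apply: cvg_at_left_filter; apply: cF; lra.
  - move=> z; rewrite in_itv /= => zx; rewrite derive1E.
    by have [] := dF z zx.
have mf : measurable_fun setT (fun s : R => 2 * `|s| * g (s ^+ 2)).
  by apply: continuous_measurable_fun => s; exact: cabs.
have dn : - d < 0 by lra.
have -> : `[(- d)%R, d]%classic = `[(- d)%R, 0%R] `|` `]0%R, d] :> set R.
  by rewrite -itv_bndbnd_setU // bnd_simp //; lra.
rewrite ge0_integral_setU //=; last 3 first.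
- by apply/measurable_EFinP; exact: measurable_funTS.
- by move=> s _; rewrite lee_fin !mulr_ge0.
- apply/disj_setPRL => s /=; rewrite !in_itv /= => /andP[s0 _] /andP[_]; lra.
rewrite integral_itv_obnd_cbnd; last by apply/measurable_EFinP; exact: measurable_funTS.
rewrite (FTC (fun s => - primitive g (s ^+ 2)) _ _ dn); last 2 first.
- by move=> s _; exact: has_deriv_continuous (derN (dI s)).
- move=> s sd; rewrite ltr0_norm; last lra.
  by apply: der_eq; [apply: derN; exact: dI|ring].
rewrite (FTC (fun s => primitive g (s ^+ 2)) _ _ d0); last 2 first.
- by move=> s _; exact: has_deriv_continuous (dI s).
- by move=> s sd; rewrite gtr0_norm; [exact: dI|lra].
by rewrite -EFinD sqrrN expr0n primitive0; congr EFin; ring.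
Qed.

Section Bound.
Variable d : R.
Hypothesis d0 : 0 < d.

Let k (s : R) : R := if `|s| <= d then g (s ^+ 2) else 0.

Let k_ge0 s : 0 <= k s.
Proof. by rewrite /k; case: ifP. Qed.

Let mk : measurable_fun setT k.
Proof.
apply: measurable_fun_ifT; last exact: measurable_cst.
  by apply: measurable_fun_ler; [exact: normr_measurable|exact: measurable_cst].
by apply: continuous_measurable_fun => s; exact: csq.
Qed.

Let inner (s : R) :
  (\int[leb]_t (if (`|t| <= `|s|)%R then k s else 0%R)%:E)%E = (2 * `|s| * k s)%:E.
Proof.
have -> : (2 * `|s| * k s)%:E = (\int[leb]_(t in `[(- `|s|)%R, `|s|%R]) (k s)%:E)%E.
  rewrite integral_cst //= lebesgue_measure_itv /= lte_fin.
  have [s0|] := ltP (- `|s|) `|s|.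
    by rewrite -EFinB -EFinM; congr EFin; ring.
  have s0 : 0 <= `|s| by [].
  move=> ss; have -> : `|s| = 0 by apply/eqP; rewrite eq_le s0 andbT; lra.
  by rewrite mulr0 mul0r mule0.
rewrite [RHS]integral_mkcond; apply: eq_integral => t _.
by rewrite patchE mem_setE in_itv /= ler_norml; case: ifP.
Qed.

Let outer : (\int[leb]_s (2 * `|s| * k s)%:E)%E = (2 * primitive g (d ^+ 2))%:E.
Proof.
rewrite -integral_abs_sqr // [RHS]integral_mkcond; apply: eq_integral => s _.
by rewrite patchE mem_setE in_itv /= /k ler_norml; case: ifP => //; rewrite mulr0.
Qed.

(** In place of polar coordinates: on the double cone |x.2| <= |x.1| the majorant depends on x.1
    alone, and the slice over s has length 2 |s|, the Jacobian of t = s^2. The two cones give 4 int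
    g where the exact value is pi int g. *)
Let K1 (x : R * R) : R := if `|x.2| <= `|x.1| then k x.1 else 0.
Let K2 (x : R * R) : R := if `|x.1| <= `|x.2| then k x.2 else 0.

Let mnorm1 : measurable_fun setT (fun x : R * R => `|x.1|).
Proof. by apply: measurableT_comp; [exact: normr_measurable|exact: measurable_fst]. Qed.

Let mnorm2 : measurable_fun setT (fun x : R * R => `|x.2|).
Proof. by apply: measurableT_comp; [exact: normr_measurable|exact: measurable_snd]. Qed.

Let mK1 : measurable_fun setT K1.
Proof.
apply: measurable_fun_ifT; last exact: measurable_cst.
  exact: measurable_fun_ler.
exact: (measurableT_comp mk measurable_fst).
Qed.

Let mK2 : measurable_fun setT K2.
Proof.
apply: measurable_fun_ifT; last exact: measurable_cst.
  exact: measurable_fun_ler.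
exact: (measurableT_comp mk measurable_snd).
Qed.

Let int_K1 : (\int[leb \x leb]_x (K1 x)%:E)%E = (2 * primitive g (d ^+ 2))%:E.
Proof.
rewrite fubini_tonelli1 //=; last 2 first.
- exact/measurable_EFinP.
- by move=> x; rewrite lee_fin /K1; case: ifP.
by rewrite -outer; apply: eq_integral => s _; rewrite -inner.
Qed.

Let int_K2 : (\int[leb \x leb]_x (K2 x)%:E)%E = (2 * primitive g (d ^+ 2))%:E.
Proof.
rewrite fubini_tonelli2 //=; last 2 first.
- exact/measurable_EFinP.
- by move=> x; rewrite lee_fin /K2; case: ifP.
by rewrite -outer; apply: eq_integral => s _; rewrite -inner.
Qed.

Lemma measurable_sqn : measurable_fun setT (@sqn R).
Proof.
apply: measurable_funD; apply: measurable_funX; [exact: measurable_fst|exact: measurable_snd].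
Qed.

Lemma measurable_disk : measurable (@disk R).
Proof.
have -> : @disk R = @sqn R @^-1` `]-oo, 1[.
  by apply/seteqP; split=> x /=; rewrite in_itv /= => /diskE.
by rewrite -[X in measurable X]setTI; apply: measurable_sqn.
Qed.

Hypotheses (d1 : d <= 1)
  (g_nincr : forall s t, 0 <= s -> s <= t -> t <= 1 -> g t <= g s).

(* A nonincreasing radial function is dominated by its values on the
   coordinate axes, on either side of the diagonals. *)
Lemma disk_integral_le : (disk_integral (fun x =>
  if (sqn x < d ^+ 2)%R then g (sqn x) else 0%R) <= (4 * primitive g (d ^+ 2))%:E)%E.
Proof.
have -> : (4 * primitive g (d ^+ 2))%:E =
    (\int[leb \x leb]_x ((K1 x)%:E + (K2 x)%:E))%E.
  rewrite ge0_integralD //=.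
  - by rewrite int_K1 int_K2 -EFinD; congr EFin; ring.
  - by move=> x _; rewrite lee_fin /K1; case: ifP.
  - exact/measurable_EFinP.
  - by move=> x _; rewrite lee_fin /K2; case: ifP.
  - exact/measurable_EFinP.
have mF : measurable_fun setT (fun x : R * R => if sqn x < d ^+ 2 then g (sqn x) else 0).
  apply: measurable_fun_ifT; last exact: measurable_cst.
    by apply: measurable_fun_ltr; [exact: measurable_sqn|exact: measurable_cst].
  apply: (measurableT_comp (f := g)); last exact: measurable_sqn.
  by apply: continuous_measurable_fun.
have K10 x : 0 <= K1 x by rewrite /K1; case: ifP.
have K20 x : 0 <= K2 x by rewrite /K2; case: ifP.
apply: (@le_trans _ _ (\int[leb \x leb]_x (if (sqn x < d ^+ 2)%R then g (sqn x) else 0%R)%:E)%E).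
  apply: ge0_subset_integral => //=.
  - exact: measurable_disk.
  - exact/measurable_EFinP.
  - by move=> x _; rewrite lee_fin; case: ifP.
apply: ge0_le_integral => //=.
- by move=> x _; rewrite lee_fin; case: ifP.
- exact/measurable_EFinP.
- by apply: emeasurable_funD; exact/measurable_EFinP.
move=> x _; rewrite -EFinD lee_fin; case: ifPn => [xd|_]; last exact: addr_ge0.
have key (p q : R) : p ^+ 2 + q ^+ 2 < d ^+ 2 -> g (p ^+ 2 + q ^+ 2) <= k p.
  move=> pq; have q0 := sqr_ge0 q; have p0 := sqr_ge0 p.
  have pd : `|p| <= d.
    by rewrite -(@ler_pXn2r _ 2) ?nnegrE // ?(ltW d0) // real_normK ?num_real //; lra.
  have d21 : d ^+ 2 <= 1 by rewrite expr_le1 // ltW.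
  by rewrite /k pd; apply: g_nincr; lra.
have [x12|x21] := leP `|x.2| `|x.1|.
  apply: (@le_trans _ _ (K1 x)); last by rewrite lerDl.
  by rewrite /K1 x12; exact: key.
apply: (@le_trans _ _ (K2 x)); last by rewrite lerDr.
by rewrite /K2 (ltW x21) /sqn addrC; apply: key; rewrite addrC.
Qed.

End Bound.
End RadialIntegral.

(** * Asymptotics *)

(** [J] stands for [burn a 1]. From b J >= 3 F / 4 one gets 4 / b <= 16 J / (3 F), so the rate 3 F /
    64 turns the first exponential into at most exp (J / 4), which exp (- J / 2) beats; with J <= 2
    sqrt a one gets a b >= 3 F J / 16. Both error terms are then O(1 / J), and 128 and 2048 are the
    resulting constants. *)
Lemma small_terms (R : realType) (F e N C y J a b : R) : 0 < F -> 0 < e -> 0 <= N ->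
  0 <= C -> 0 < y -> 0 < a -> 0 < b -> F / 4 <= J -> 4 / y <= J ->
  128 * N / (F * e) <= J -> 2048 * C / (F * e) <= J -> 3 * F / 4 <= b * J -> b * J < F ->
  J <= 2 * Num.sqrt a ->
  [/\ 1 <= 4 / b, 2 * expR (- (J / 2)) <= y, 8 * N / (a * b) <= e / 3 &
      4 / b * (C * expR (3 * F / 64 * (4 / b))) * (2 * expR (- (J / 2))) <= e / 3].
Proof.
move=> F0 e0 N0 C00 y0 a0 b0 JF Jy JN JC bJ bF Ja.
have J0 : 0 < J by lra.
have Fe : 0 < F * e by rewrite mulr_gt0.
have b4 : b <= 4 by nra.
have K1 : 1 <= 4 / b by rewrite ler_pdivlMr // mul1r.
have KJ : 4 / b <= 16 * J / (3 * F).
  rewrite ler_pdivrMr // mulrAC ler_pdivlMr ?mulr_gt0 //; lra.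
have expJ : expR (- (J / 2)) <= 2 / J.
  rewrite expRN -[leRHS]invrK lef_pV2 ?posrE ?expR_gt0 ?invr_gt0 ?divr_gt0 //.
  rewrite invf_div; have := expR_ge1Dx (J / 2); lra.
split=> //.
- apply: (@le_trans _ _ (2 * (2 / J))); first by rewrite ler_pM2l.
  by rewrite mulrA ler_pdivrMr //; move: Jy; rewrite ler_pdivrMr //; lra.
- have ab : 3 * F / 16 * J <= a * b.
    have J2 : J ^+ 2 <= 4 * a.
      have -> : 4 * a = (2 * Num.sqrt a) ^+ 2.
        by rewrite exprMn sqr_sqrtr ?(ltW a0) //; ring.
      by rewrite ler_pXn2r // nnegrE ?mulr_ge0 ?sqrtr_ge0 // ltW.
    have : J * (b * J) <= 4 * a * b by move: J2; rewrite expr2; nra.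
    have : J * (3 * F / 4) <= J * (b * J) by rewrite ler_pM2l.
    lra.
  rewrite ler_pdivrMr ?mulr_gt0 //.
  apply: (@le_trans _ _ (e / 3 * (3 * F / 16 * J))); last by rewrite ler_pM2l ?divr_gt0.
  by move: JN; rewrite ler_pdivrMr //; lra.
set K := 4 / b in K1 KJ *; clearbody K.
have E4 : expR (3 * F / 64 * K) <= expR (J / 4).
  rewrite ler_expR; have : 3 * F / 64 * K <= 3 * F / 64 * (16 * J / (3 * F)).
    by rewrite ler_pM2l // divr_gt0 // mulr_gt0.
  suff -> : 3 * F / 64 * (16 * J / (3 * F)) = J / 4 by [].
  by field; rewrite gt_eqF.
have QJ : K * (C * expR (3 * F / 64 * K)) <= 16 * J / (3 * F) * (C * expR (J / 4)).
  by apply: ler_pM; rewrite ?mulr_ge0 ?expR_ge0 ?ler_wpM2l //; lra.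
(* Squaring J <= 8 exp (J / 8) gives J^2 <= 64 exp (J / 4). *)
have J8 : expR (J / 4) * expR (- (J / 2)) * J ^+ 2 <= 64.
  have -> : expR (J / 4) * expR (- (J / 2)) = (expR (J / 8) ^+ 2)^-1.
    rewrite -expRD expr2 -expRD -expRN; congr expR; lra.
  rewrite mulrC ler_pdivrMr ?exprn_gt0 ?expR_gt0 //.
  have -> : 64 * expR (J / 8) ^+ 2 = (8 * expR (J / 8)) ^+ 2 by ring.
  rewrite ler_pXn2r ?nnegrE ?mulr_ge0 ?expR_ge0 ?(ltW J0) //.
  have := expR_ge1Dx (J / 8); lra.
apply: (@le_trans _ _ (16 * J / (3 * F) * (C * expR (J / 4)) * (2 * expR (- (J / 2))))).
  by apply: ler_wpM2r => //; rewrite mulr_ge0 ?expR_ge0.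
rewrite -(ler_pM2r J0).
have -> : 16 * J / (3 * F) * (C * expR (J / 4)) * (2 * expR (- (J / 2))) * J =
   32 * C / (3 * F) * (expR (J / 4) * expR (- (J / 2)) * J ^+ 2).
  by field; rewrite gt_eqF.
apply: (@le_trans _ _ (32 * C / (3 * F) * 64)).
  by apply: ler_wpM2l J8; rewrite divr_ge0 ?mulr_ge0 ?(ltW F0).
rewrite mulrAC ler_pdivrMr ?mulr_gt0 //.
by move: JC; rewrite ler_pdivrMr //; lra.
Qed.

Section Asymptotics.
Variables (R : realType) (f Phi Psi : R -> R).
Hypotheses (f_gt0 : forall s : R, 0 <= s -> 0 < f s)
    (f_C1 : C1_on_nonneg f)
    (f_convex : convex_function [set s : R | 0 <= s] f)
    (f_ndecr : forall s t : R, 0 <= s -> s <= t -> f s <= f t)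
    (f_int :
      (\int[@lebesgue_measure R]_(s in `[0%R, +oo[) ((f s)^-1)%:E < +oo)%E).
Hypotheses (cPhi : continuous Phi) (cPsi : continuous Psi)
  (Phi_ge0 : forall t : R, 0 <= Phi t) (Psi_ge0 : forall t : R, 0 <= Psi t)
  (Phi_le1 : forall t : R, Phi t <= 1) (Psi_le1 : forall t : R, Psi t <= 1)
  (Phi0 : Phi 0 = 1) (Psi0 : Psi 0 = 1)
  (Psi_nincr : forall s t : R, s <= t -> Psi t <= Psi s).

Local Notation fe := (extend_nonneg f).
Local Notation G := (primitive (fun s => (fe s)^-1)).
Local Notation F := (osgood_sup f).
Local Notation burn := (burn Phi Psi).

Variables (V P : R -> R -> R) (b : R -> R).
Hypotheses (b_gt0 : forall a, 0 < a -> 0 < b a)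
  (VP : forall a, 0 < a -> radial_profile f Phi Psi a (a * b a) (V a) (P a))
  (b_sharp : forall c, c < F -> \forall a \near +oo, c <= b a * burn a 1).

Lemma near_burn_ge N : \forall a \near +oo, N <= burn a 1.
Proof.
have [A A0 HA] := burn_unbounded cPhi cPsi Phi_ge0 Psi_ge0 Phi0 Psi0 N.
by near=> a; apply: HA; near: a; apply: nbhs_pinfty_ge; exact: num_real.
Unshelve. all: by end_near. Qed.

Let near_gt0 : \forall a \near +oo, 0 < a :> R.
Proof. by apply: nbhs_pinfty_gt; exact: num_real. Qed.

Let V_ge0 a t : 0 < a -> 0 <= t <= 1 -> 0 <= V a t.
Proof. by move=> /VP [_ + _ _ _]; exact. Qed.

Let burn_lt a : 0 < a -> b a * burn a 1 < F.
Proof.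
move=> a0; apply: le_lt_trans (profile_burn_le f_gt0 f_C1 f_ndecr cPhi cPsi Psi_ge0
  Phi_le1 Phi0 Psi_nincr a0 (b_gt0 a0) (VP a0)) _.
by apply: osgood_lt_sup => //; apply: V_ge0; rewrite // lexx ler01.
Qed.

Lemma profile_cvg0 (t e : R) : 0 < t <= 1 -> 0 < e -> \forall a \near +oo, V a t <= e.
Proof.
move=> t01 e0; have /andP[t0 t1] := t01; have F0 := osgood_sup_gt0 f_gt0 f_C1 f_int.
have Ge : 0 < G e by rewrite -(primitive0 (fun s => (fe s)^-1)) osgood_lt.
have lnt : 0 <= - ln t by rewrite oppr_ge0 ln_le0.
near=> a.
have a0 : 0 < a by near: a.
have J1 : 1 <= burn a 1 by near: a; exact: near_burn_ge.
(* Together with [b a * burn a 1 < F] this threshold gives [b a * - ln t <= G e / 2]; the next one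
   covers the other half of [G e]. *)
have JN : 2 * F * - ln t / G e <= burn a 1 by near: a; exact: near_burn_ge.
have bJ : F - G e / 2 <= b a * burn a 1 by near: a; apply: b_sharp; lra.
have b0 := b_gt0 a0.
have bF := burn_lt a0.
rewrite leNgt; apply/negP => Ve.
have Gt := osgood_lt f_gt0 f_C1 (ltW e0) Ve.
have := profile_osgood_lt f_gt0 f_C1 f_ndecr f_int cPhi cPsi Psi_ge0 Phi_le1 Phi0
  Psi_nincr a0 b0 (VP a0) (t := t).
rewrite (ltW t0) t1 => /(_ isT) H1.
have H2 := @burn_tail_le _ _ _ cPhi cPsi Phi_ge0 Psi_le1 Phi0 a t (ltW a0) t01.
have H3 : b a * - ln t <= G e / 2.
  have bl : b a <= F / burn a 1 by rewrite ler_pdivlMr; [exact: ltW|lra].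
  apply: (@le_trans _ _ (F / burn a 1 * - ln t)); first exact: ler_wpM2r.
  rewrite mulrAC ler_pdivrMr; last lra.
  move: JN; rewrite ler_pdivrMr // => JN; lra.
have H4 : b a * (burn a 1 - burn a t) <= b a * - ln t by apply: ler_wpM2l => //; exact: ltW.
lra.
Unshelve. all: by end_near. Qed.

Lemma profile_dvg0 (N : R) : 0 <= N -> \forall a \near +oo, N <= V a 0.
Proof.
move=> N0; near=> a.
have a0 : 0 < a by near: a.
have bJ : (G N + F) / 2 <= b a * burn a 1.
  by near: a; apply: b_sharp; have := osgood_lt_sup f_gt0 f_C1 f_int N0; lra.
rewrite leNgt; apply/negP => VN.
have V0 : 0 <= V a 0 by apply: V_ge0; rewrite // lexx ler01.
have := osgood_lt f_gt0 f_C1 V0 VN.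
have := profile_burn_le f_gt0 f_C1 f_ndecr cPhi cPsi Psi_ge0 Phi_le1 Phi0 Psi_nincr a0
  (b_gt0 a0) (VP a0).
have := osgood_lt_sup f_gt0 f_C1 f_int N0; lra.
Unshelve. all: by end_near. Qed.

(** No mass of f(u) concentrates at the origin although u(0) tends to infinity. [y] is fixed
    independently of [a], so that the pointwise convergence at [y] controls everything outside. *)
Lemma profile_integral_small (e : R) : 0 < e -> exists2 y : R, 0 < y < 1 &
  \forall a \near +oo, primitive (fun t => fe (V a t)) y <= e.
Proof.
have arith (x z : R) : 0 < x -> 3 * x / 4 <= z -> x - z / 2 <= 2 * x / 3 by lra.
move=> e0; have F0 := osgood_sup_gt0 f_gt0 f_C1 f_int.
have [t1 /andP[t10 t11] Ht1] := Psi_half cPhi cPsi Phi0 Psi0.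
(* Once b J >= 3 F / 4 one has F - b J / 2 <= 5 F / 8 < 2 F / 3, so this [N] serves for all large
   [a]. *)
have [|N N0 HN] := @osgood_gt _ f f_gt0 f_C1 f_int (2 * F / 3); first by lra.
have e1 : 0 < 3 * F / 64 by lra.
have [C0 C00 HC0] := superlinear f_gt0 f_C1 f_convex f_int e1.
have fN : 0 < fe N by exact: extend_nonneg_gt0.
pose y := Num.min t1 (e / (3 * fe N)).
have y0 : 0 < y by rewrite lt_min t10 divr_gt0 // mulr_gt0.
have yt1 : y <= t1 by rewrite ge_min lexx.
have ye : fe N * y <= e / 3.
  have : y <= e / (3 * fe N) by rewrite ge_min lexx orbT.
  rewrite -(ler_pM2l fN) => /le_trans; apply.
  by rewrite le_eqVlt; apply/orP; left; apply/eqP; field; rewrite gt_eqF.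
exists y; first by rewrite y0 /=; exact: le_lt_trans t11.
near=> a.
have a0 : 0 < a by near: a.
have b0 := b_gt0 a0.
have HJ : burn a 1 <= 2 * Num.sqrt a by apply: burn_le_sqrt => //; exact: ltW.
have JF : F / 4 <= burn a 1 by near: a; exact: near_burn_ge.
have Jy : 4 / y <= burn a 1 by near: a; exact: near_burn_ge.
have JN : 128 * N / (F * e) <= burn a 1 by near: a; exact: near_burn_ge.
have JC : 2048 * C0 / (F * e) <= burn a 1 by near: a; exact: near_burn_ge.
have bJ : 3 * F / 4 <= b a * burn a 1 by near: a; apply: b_sharp; rewrite ltr_pdivrMr //; lra.
have [K1 tauy T1 T2] := small_terms F0 e0 N0 C00 y0 a0 b0 JF Jy JN JC bJ (burn_lt a0) HJ.
have J0 : 0 < burn a 1 by apply: lt_le_trans JF; exact: divr_gt0.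
have Kb : 4 / b a * b a = 4 by rewrite divfK // gt_eqF.
have Q0 : 0 <= 4 / b a * (C0 * expR (3 * F / 64 * (4 / b a))).
  by apply: mulr_ge0; [apply: ltW; exact: divr_gt0|rewrite mulr_ge0 ?expR_ge0].
have h1 t : 0 <= t <= t1 -> 2^-1 <= Psi t by move=> /Ht1 [].
have h2 u : 0 <= u -> 4 / b a * u <= f u + 4 / b a * (C0 * expR (3 * F / 64 * (4 / b a))).
  by move=> u0; exact: HC0.
have y01 : 0 < y <= t1 by rewrite y0.
have HN' : F - b a * burn a 1 / 2 <= G N.
  apply: (le_trans _ (ltW HN)).
  exact: arith.
have := profile_integral_bound f_gt0 f_C1 f_ndecr f_int cPhi cPsi Phi_ge0 Psi_ge0 Phi_le1
  Psi_le1 Phi0 Psi_nincr a0 b0 (VP a0) y01 t11 Kb Q0 h1 h2 J0 tauy N0 HN'.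
move=> /le_trans; apply.
have -> : e = e / 3 + e / 3 + e / 3 by field.
by apply: lerD; [apply: lerD|exact: ye].
Unshelve. all: by end_near. Qed.

End Asymptotics.

(** * Comparison of disk integrals and limits at infinity *)

Section DiskIntegral.
Variable R : realType.
Notation leb := (@lebesgue_measure R).
Implicit Types (W p g : R -> R).

Lemma eq_disk_integral (u v : R * R -> R) : (forall x, disk x -> u x = v x) ->
  disk_integral u = disk_integral v.
Proof. by move=> uv; apply: eq_integral => x; rewrite inE => dx; rewrite uv. Qed.

Lemma measurable_comp_sqn W : continuous W ->
  measurable_fun setT (fun x : R * R => W (sqn x)).
Proof.
move=> cW; apply: (measurableT_comp (f := W)); last exact: measurable_sqn.
by apply: continuous_measurable_fun.
Qed.

Lemma le_disk_integral W p : continuous W -> continuous p ->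
  (forall t, 0 <= t < 1 -> 0 <= W t <= p t) ->
  (disk_integral (fun x => W (sqn x)) <= disk_integral (fun x => p (sqn x)))%E.
Proof.
move=> cW cp H.
have H' x : disk x -> 0 <= W (sqn x) <= p (sqn x).
  by move=> /diskE x1; apply: H; rewrite sqn_ge0.
apply: ge0_le_integral.
- exact: measurable_disk.
- by move=> x /H' /andP[]; rewrite lee_fin.
- by apply/measurable_EFinP; apply: measurable_funTS; exact: measurable_comp_sqn.
- by apply/measurable_EFinP; apply: measurable_funTS; exact: measurable_comp_sqn.
- by move=> x /H' /andP[_]; rewrite lee_fin.
Qed.

Lemma disk_integralZ c W : 0 <= c -> continuous W -> (forall t, 0 <= W t) ->
  disk_integral (fun x => c * W (sqn x)) = (c%:E * disk_integral (fun x => W (sqn x)))%E.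
Proof.
move=> c0 cW W0; rewrite /disk_integral -ge0_integralZl_EFin //.
- exact: measurable_disk.
- by move=> x _; rewrite lee_fin.
- by apply/measurable_EFinP; apply: measurable_funTS; exact: measurable_comp_sqn.
Qed.

Lemma disk_integral_cst_le (c : R) : 0 <= c ->
  (disk_integral (fun _ : R * R => c) <= (4 * c)%:E)%E.
Proof.
move=> c0; have cc : continuous (fun _ : R => c) by exact: cst_continuous.
have := @disk_integral_le R (fun=> c) cc (fun=> c0) 1 ltr01 (lexx 1)
  (fun _ _ _ _ _ => lexx c).
rewrite expr1n.
have -> : primitive (fun=> c) 1 = c.
  have H : primitive (fun=> c) 1 - primitive (fun=> c) 0 = c * 1 - c * 0.
    apply/eqP; rewrite eq_le; apply/andP; split.
      apply: (derive_le_le_in (d := fun=> c) (e := fun=> c) (G := fun x => c * x) ler01) => //.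
      - by move=> x x1; apply: (primitive_has_deriv (g := fun=> c)) => //; lra.
      - by move=> x _; apply: der_eq; [derive_tac|rewrite /=; ring].
    apply: (derive_le_le_in (d := fun=> c) (e := fun=> c) (F := fun x => c * x) ler01) => //.
    - by move=> x _; apply: der_eq; [derive_tac|rewrite /=; ring].
    - by move=> x x1; apply: (primitive_has_deriv (g := fun=> c)) => //; lra.
  by move: H; rewrite primitive0 mulr0 mulr1 !subr0.
rewrite (@eq_disk_integral _ (fun=> c)) // => x /diskE ->.
by [].
Qed.

(** Separates the core |x|^2 < y, where [W] may be large and only the integral of [g] is small, from
    its complement, where [p] alone bounds [W]. *)
Lemma disk_integral_split W p g c y : continuous W -> continuous p -> continuous g ->
  0 <= c -> 0 < y <= 1 ->
  (forall t, 0 <= p t) -> (forall t, 0 <= g t) ->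
  (forall s t, 0 <= s -> s <= t -> t <= 1 -> g t <= g s) ->
  (forall t, 0 <= t < 1 -> 0 <= W t) ->
  (forall t, 0 <= t < 1 -> W t <= p t + (if t < y then c * g t else 0)) ->
  (disk_integral (fun x => W (sqn x)) <=
    disk_integral (fun x => p (sqn x)) + (c * (4 * primitive g y))%:E)%E.
Proof.
move=> cW cp cg c0 /andP[y0 y1] p0 g0 gn W0 Wp.
pose d := Num.sqrt y.
have d0 : 0 < d by rewrite sqrtr_gt0.
have d1 : d <= 1 by rewrite -[leRHS]sqrtr1 ler_sqrt.
have dy : d ^+ 2 = y by rewrite sqr_sqrtr // ltW.
have Hd := disk_integral_le cg g0 d0 d1 gn.
rewrite dy in Hd.
have mg : measurable_fun setT (fun x : R * R => if sqn x < y then g (sqn x) else 0).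
  apply: measurable_fun_ifT; last exact: measurable_cst.
    by apply: measurable_fun_ltr; [exact: measurable_sqn|exact: measurable_cst].
  exact: measurable_comp_sqn.
have g0' (x : R * R) : 0 <= (if sqn x < y then g (sqn x) else 0) by case: ifP.
have mp := measurable_comp_sqn cp.
apply: (@le_trans _ _ (\int[leb \x leb]_(x in @disk R)
   ((p (sqn x))%:E + c%:E * (if (sqn x < y)%R then g (sqn x) else 0%R)%:E))%E).
  apply: ge0_le_integral.
  - exact: measurable_disk.
  - by move=> x /diskE x1; rewrite lee_fin; apply: W0; rewrite sqn_ge0.
  - by apply/measurable_EFinP; apply: measurable_funTS; exact: measurable_comp_sqn.
  - apply: emeasurable_funD; first by apply/measurable_EFinP; exact: measurable_funTS.
    have -> : (fun x : R * R => (c%:E * (if (sqn x < y)%R then g (sqn x) else 0%R)%:E)%E) =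
      (EFin \o (fun x : R * R => c * (if sqn x < y then g (sqn x) else 0))) by [].
    apply/measurable_EFinP; apply: measurable_funTS.
    by apply: measurable_funM => //; exact: measurable_cst.
  - move=> x /diskE x1; rewrite -EFinM -EFinD lee_fin.
    have := Wp (sqn x); rewrite sqn_ge0 x1 => /(_ isT).
    by case: ifP => //; rewrite mulr0.
rewrite ge0_integralD //; last first.
- have -> : (fun x : R * R => (c%:E * (if (sqn x < y)%R then g (sqn x) else 0%R)%:E)%E) =
    (EFin \o (fun x : R * R => c * (if sqn x < y then g (sqn x) else 0))) by [].
  apply/measurable_EFinP; apply: measurable_funTS.
  by apply: measurable_funM => //; exact: measurable_cst.
- by move=> x _; rewrite -EFinM lee_fin mulr_ge0.
- by apply/measurable_EFinP; exact: measurable_funTS.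
- by move=> x _; rewrite lee_fin.
- exact: measurable_disk.
apply: leeD => //.
rewrite ge0_integralZl_EFin //.
- by rewrite EFinM lee_wpmul2l ?lee_fin.
- exact: measurable_disk.
- by move=> x _; rewrite lee_fin.
- by apply/measurable_EFinP; exact: measurable_funTS.
Qed.

Lemma cvg_pinfty_squeeze (u : R -> \bar R) (l : R) :
  (forall e, 0 < e -> \forall x \near +oo, (l%:E <= u x <= (l + e)%:E)%E) ->
  u x @[x --> +oo] --> l%:E.
Proof.
move=> H.
have Hfin : \forall x \near +oo, u x \is a fin_num.
  have := H 1 ltr01; apply: filterS => x /andP[lu ul].
  by rewrite fin_numE -ltNye -ltey (lt_le_trans _ lu) ?ltNyr // (le_lt_trans ul) ?ltry.
apply/fine_cvgP; split=> //.
apply/cvgrPdist_le => e e0; have He := H e e0.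
near=> x.
have xf : u x \is a fin_num by near: x.
have /andP[] : (l%:E <= u x <= (l + e)%:E)%E by near: x.
rewrite -[u x]fineK // !lee_fin => h1 h2.
by rewrite /= distrC ger0_norm; lra.
Unshelve. all: by end_near. Qed.

Lemma near_pinfty_half (Q : R -> Prop) : (\forall a \near +oo, Q a) ->
  \forall x \near +oo, Q (x / 2).
Proof.
move=> [M [Mr HM]]; exists (2 * M); split; first exact: num_real.
by move=> x Mx; apply: HM; rewrite ltr_pdivlMr // mulrC.
Qed.

End DiskIntegral.

Theorem theorem1p2 (R : realType) (f phi psi : R -> R)
    (lambda_star : R -> R) (ustar : R -> R * R -> R)
    (* assumptions on f *)
    (f_gt0 : forall s : R, 0 <= s -> 0 < f s)
    (f_C1 : C1_on_nonneg f)
    (f_convex : convex_function [set s : R | 0 <= s] f)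
    (f_ndecr : forall s t : R, 0 <= s -> s <= t -> f s <= f t)
    (f_int :
      (\int[@lebesgue_measure R]_(s in `[0%R, +oo[) ((f s)^-1)%:E < +oo)%E)
    (* assumptions on phi and psi *)
    (phi_ge0 : forall r : R, 0 <= r <= 1 -> 0 <= phi r)
    (psi_ge0 : forall r : R, 0 <= r <= 1 -> 0 <= psi r)
    (phi_nincr : forall r s : R, 0 <= r -> r <= s -> s <= 1 -> phi s <= phi r)
    (psi_nincr : forall r s : R, 0 <= r -> r <= s -> s <= 1 -> psi s <= psi r)
    (phi_lip : [lipschitz phi r | r in `[0, 1]])
    (psi_lip : [lipschitz psi r | r in `[0, 1]])
    (phi0 : phi 0 = 1) (psi0 : psi 0 = 1)
    (phi_gt0 : forall r : R, 0 <= r < 1 -> 0 < phi r)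
    (ratio_int :
      (\int[@lebesgue_measure R]_(s in `[0%R, 1%R[) (max_ratio phi psi s)%:E
         < +oo)%E)
    (* extremal values and extremal solutions *)
    (lambda_starP : forall alpha : R, 0 < alpha ->
      extremal_value f phi psi alpha (lambda_star alpha))
    (ustarP : forall alpha : R, 0 < alpha ->
      extremal_solution f phi psi alpha (lambda_star alpha) (ustar alpha))
    (* known properties of the extremal solutions *)
    (ustar_sol : forall alpha : R, 0 < alpha ->
      classical_solution f phi psi alpha (lambda_star alpha) (ustar alpha))
    (ustar_rad : forall alpha : R, 0 < alpha ->
      radially_symmetric (ustar alpha))
    (ustar_decr : forall alpha : R, 0 < alpha ->
      radially_decreasing (ustar alpha)) :
  ((forall x, disk x -> x <> (0, 0) ->
      ustar alpha x @[alpha --> +oo] --> (0 : R)) /\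
   ustar alpha (0, 0) @[alpha --> +oo] --> +oo) /\
  (disk_integral (ustar alpha) @[alpha --> +oo] --> 0%E /\
   disk_integral (fun x => psi (enorm x) * f (ustar alpha x)) @[alpha --> +oo]
      --> ((f 0)%:E * disk_integral (fun x => psi (enorm x)))%E).
Proof.
pose Phi := radial_coef phi; pose Psi := radial_coef psi.
pose M t := max_ratio phi psi (Num.sqrt t).
have cPhi : continuous Phi by exact: continuous_radial_coef.
have cPsi : continuous Psi by exact: continuous_radial_coef.
have Phi_b t : 0 <= Phi t <= 1 by exact: radial_coef_bounds.
have Psi_b t : 0 <= Psi t <= 1 by exact: radial_coef_bounds.
have Phi_ge0 t : 0 <= Phi t by have /andP[] := Phi_b t.
have Psi_ge0 t : 0 <= Psi t by have /andP[] := Psi_b t.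
have Phi_le1 t : Phi t <= 1 by have /andP[] := Phi_b t.
have Psi_le1 t : Psi t <= 1 by have /andP[] := Psi_b t.
have Phi0 : Phi 0 = 1 by rewrite /Phi radial_coef0.
have Psi0 : Psi 0 = 1 by rewrite /Psi radial_coef0.
have Phi_gt0 t : t < 1 -> 0 < Phi t by exact: radial_coef_gt0.
have Phi_nincr s t : s <= t -> Phi t <= Phi s by exact: radial_coef_nincr.
have Psi_nincr s t : s <= t -> Psi t <= Psi s by exact: radial_coef_nincr.
have [B HB] := max_ratio_sqrt_int phi_ge0 psi_ge0 phi_nincr psi_nincr phi_lip psi_lip
  phi0 psi0 phi_gt0 ratio_int.
have [C C0 HC] := max_ratio_sqrt_near0 phi_ge0 psi_ge0 phi_nincr psi_nincr phi_lip psi_lip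
  phi0 psi0 phi_gt0.
pose fe := extend_nonneg f; pose F := osgood_sup f.
have F0 : 0 < F by exact: osgood_sup_gt0.
(* With alpha = 2 a this is lambda_star alpha / (2 alpha). *)
pose b a := lambda_star (2 * a) / (4 * a).
pose V a := profile_of (ustar (2 * a)).
pose P a t := Num.sqrt t * dx1 (ustar (2 * a)) (Num.sqrt t, 0) / 2.
have b_gt0 a : 0 < a -> 0 < b a.
  move=> a0; have a20 : 0 < 2 * a by rewrite mulr_gt0.
  by have [L0 _ _] := lambda_starP _ a20; rewrite /b divr_gt0 // mulr_gt0.
have VP a : 0 < a -> radial_profile f Phi Psi a (a * b a) (V a) (P a).
  move=> a0; have a20 : 0 < 2 * a by rewrite mulr_gt0.
  have := radial_profile_of_solution (ustar_sol _ a20) (ustar_rad _ a20) (ustar_decr _ a20).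
  have -> : 2 * a / 2 = a by field.
  by have -> : lambda_star (2 * a) / 4 = a * b a by rewrite /b; field; rewrite gt_eqF.
have D0 : 0 <= 2 * C + 4 * B.
  have B0 : 0 <= B by rewrite -(primitive0 M); apply: HB; rewrite lexx ltr01.
  by rewrite addr_ge0 // mulr_ge0.
have b_ge c : 0 < c < F ->
    \forall a \near +oo, c / (burn Phi Psi a 1 + (2 * C + 4 * B) + 1) <= b a.
  move=> cF.
  have [A A0 HA] := profile_exists f_gt0 f_C1 f_ndecr f_int cPhi cPsi Phi_ge0 Psi_ge0
    Phi_le1 Psi_le1 Phi0 Psi0 Phi_gt0 Phi_nincr
    (continuous_max_ratio_sqrt phi_ge0 psi_ge0 phi_nincr psi_nincr phi_lip psi_lip phi0
       psi0 phi_gt0)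
    (max_ratio_sqrt_ge0 phi_ge0 psi_ge0 phi_nincr psi_nincr phi0 psi0 phi_gt0)
    (max_ratio_sqrt_homo phi_ge0 psi_ge0 phi_nincr psi_nincr psi0 phi_gt0)
    (radial_coef_ratio phi_ge0 psi_ge0 phi_nincr psi_nincr psi0 phi_gt0)
    HB C0 HC cF.
  near=> a.
  have Aa : A <= a by near: a; apply: nbhs_pinfty_ge; exact: num_real.
  have a0 : 0 < a by exact: lt_le_trans Aa.
  have a20 : 0 < 2 * a by rewrite mulr_gt0.
  have [W [q [dW cq q0 [W1 q0E] dq]]] := HA a Aa.
  have [_ _ no_sol] := lambda_starP _ a20.
  have J0 : 0 <= burn Phi Psi a 1.
    by rewrite -(burn0 Phi Psi a); apply: burn_homo => //; exact: ltW.
  set mu := a * _ in dW dq.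
  have mu0 : 0 < mu.
    have /andP[c0 _] := cF.
    by rewrite /mu mulr_gt0 // divr_gt0 // ltr_wpDl // addr_ge0.
  have sol := classical_solution_of_profile f_C1 phi_lip psi_lip psi0 mu0 dW cq q0 W1 q0E dq.
  have le : 4 * mu <= lambda_star (2 * a).
    by rewrite leNgt; apply/negP => /no_sol; apply; exists (fun x => W (sqn x)).
  rewrite /b ler_pdivlMr ?mulr_gt0 //; apply: le_trans le.
  by rewrite le_eqVlt; apply/orP; left; apply/eqP; rewrite /mu; ring.
have b_sharp c : c < F -> \forall a \near +oo, c <= b a * burn Phi Psi a 1.
  (* [c1] makes the level positive, as [b_ge] requires; a second level c2 between c1 and F leaves
     room for c2 J / (J + D + 1) >= c1 with D = 2 C + 4 B, which holds as soon as J >= c1 (D + 1) /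
     (c2 - c1). *)
  move=> cF; pose c1 := Num.max c (F / 2).
  have c1F : 0 < c1 < F.
    by rewrite lt_max gt_max cF /= divr_gt0 ?orbT //= ltr_pdivrMr // ltr_pMr // ltr1n.
  have cc1 : c <= c1 by rewrite le_max lexx.
  clearbody c1; have /andP[c10 c11] := c1F.
  pose c2 := (c1 + F) / 2.
  have c2F : 0 < c2 < F by rewrite /c2; lra.
  have c12 : c1 < c2 by rewrite /c2; lra.
  clearbody c2.
  near=> a.
  have bc : c2 / (burn Phi Psi a 1 + (2 * C + 4 * B) + 1) <= b a by near: a; exact: b_ge.
  have J1 : 1 <= burn Phi Psi a 1 by near: a; exact: near_burn_ge.
  have JN : c1 * (2 * C + 4 * B + 1) / (c2 - c1) <= burn Phi Psi a 1.
    by near: a; exact: near_burn_ge.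
  move: bc J1 JN; move: (burn _ _ _ _) (2 * C + 4 * B) D0 (b a) => J D' D'0 ba bc J1 JN.
  apply: (le_trans cc1); have K0 : 0 < J + D' + 1 by lra.
  apply: (@le_trans _ _ (c2 / (J + D' + 1) * J)); last by apply: ler_wpM2r => //; lra.
  rewrite mulrAC ler_pdivlMr //.
  by move: JN; rewrite ler_pdivrMr ?subr_gt0 //; lra.
have cvg0 t e : 0 < t <= 1 -> 0 < e -> \forall a \near +oo, V a t <= e.
  exact: (profile_cvg0 f_gt0 f_C1 f_ndecr f_int cPhi cPsi Phi_ge0 Psi_ge0 Phi_le1 Psi_le1
    Phi0 Psi0 Psi_nincr b_gt0 VP b_sharp).
have dvg0 N : 0 <= N -> \forall a \near +oo, N <= V a 0.
  exact: (profile_dvg0 f_gt0 f_C1 f_ndecr f_int cPhi cPsi Psi_ge0 Phi_le1 Phi0 Psi_nincr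
    b_gt0 VP b_sharp).
have small e : 0 < e -> exists2 y : R, 0 < y < 1 &
    \forall a \near +oo, primitive (fun t => fe (V a t)) y <= e.
  exact: (profile_integral_small f_gt0 f_C1 f_convex f_ndecr f_int cPhi cPsi Phi_ge0
    Psi_ge0 Phi_le1 Psi_le1 Phi0 Psi0 Psi_nincr b_gt0 VP b_sharp).
have near_pos : \forall x \near +oo, 0 < x :> R.
  by apply: nbhs_pinfty_gt; exact: num_real.
have half2 (x : R) : 2 * (x / 2) = x by field.
have V_ge0 a t : 0 < a -> 0 <= t <= 1 -> 0 <= V a t.
  by move=> /VP [_ + _ _ _]; exact.
have V_nincr a s t : 0 < a -> 0 <= s -> s <= t -> t <= 1 -> V a t <= V a s.
  by move=> /VP [_ _ + _ _]; exact.
have cV a : 0 < a -> continuous (V a) by move=> /VP [].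
have cfV a : 0 < a -> continuous (fun t => fe (V a t)).
  move=> a0 t; apply: (@continuous_comp _ _ _ (V a) fe); first exact: cV.
  exact: continuous_extend_nonneg.
have fe_ge0 t : 0 <= fe t by exact: extend_nonneg_ge0.
have fe_homo s t : s <= t -> fe s <= fe t by exact: extend_nonneg_homo.
have UV alpha x : 0 < alpha -> closed_disk x -> ustar alpha x = V (alpha / 2) (sqn x).
  by move=> a0 cx; rewrite /V half2; apply: radial_solutionE => //; exact: ustar_rad.
have sub_cd (x : R * R) : disk x -> closed_disk x by exact: ltW.
have sqn00 : sqn (0, 0) = 0 :> R by rewrite /sqn /= expr0n addr0.
have cd0 : closed_disk (0, 0 : R) by apply/closed_diskE; rewrite sqn00.
split; first split.
- move=> x dx /eqP x0; have /diskE x1 := dx.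
  have s0 : 0 < sqn x by rewrite sqn_gt0.
  have s01 : 0 < sqn x <= 1 by rewrite s0 ltW.
  apply/cvgrPdist_le => e e0.
  near=> alpha.
  have a0 : 0 < alpha by near: alpha.
  have a20 : 0 < alpha / 2 by rewrite divr_gt0.
  rewrite sub0r normrN (UV _ _ a0 (sub_cd _ dx)).
  have s02 : 0 <= sqn x <= 1 by rewrite !ltW.
  rewrite (ger0_norm (V_ge0 _ _ a20 s02)).
  near: alpha; apply: (near_pinfty_half (Q := fun a => V a (sqn x) <= e)).
  exact: cvg0.
- apply/cvgryPge => N; near=> alpha.
  have a0 : 0 < alpha by near: alpha.
  rewrite (UV _ _ a0 cd0) sqn00; apply: (le_trans (ler_norm N)).
  near: alpha; apply: (near_pinfty_half (Q := fun a => `|N| <= V a 0)).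
  exact: dvg0.
split.
- apply: cvg_pinfty_squeeze => e e0.
  have [K K0 HK] := superlinear f_gt0 f_C1 f_convex f_int ltr01.
  (* [superlinear] at slope 1 bounds u by f(u) plus a constant, and that constant is a multiple of f
     0 <= f(u); so u <= c f(u) and the integral of u near the origin is controlled by that of
     f(u). *)
  pose c := 1 + K * expR 1 / f 0.
  have f0 : 0 < f 0 by exact: f_gt0.
  have c1 : 1 <= c by rewrite /c lerDl divr_ge0 ?mulr_ge0 ?expR_ge0 // ltW.
  have c0 : 0 < c by exact: lt_le_trans c1.
  have uf u : 0 <= u -> u <= c * fe u.
    move=> u0; have := HK 1 u (lexx 1) u0; rewrite !mul1r => H.
    rewrite /fe extend_nonnegE //; apply: le_trans H _; rewrite /c mulrDl mul1r lerD2l.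
    rewrite mulrAC -mulrA ler_peMr ?mulr_ge0 ?expR_ge0 //.
    by rewrite ler_pdivlMr // mul1r; exact: f_ndecr.
  (* Both parts of the split contribute at most e / 2: the constant e / 8 on the disk gives 4 (e /
     8), the core gives c * 4 * (e / (8 c)). *)
  have ec : 0 < e / (8 * c) by rewrite divr_gt0 // mulr_gt0.
  have [y /andP[y0 y1] Hy] := small _ ec.
  have y01 : 0 < y <= 1 by rewrite y0 ltW.
  have e8 : 0 < e / 8 by rewrite divr_gt0.
  near=> alpha.
  have a0 : 0 < alpha by near: alpha.
  have Iy : primitive (fun t => fe (V (alpha / 2) t)) y <= e / (8 * c).
    near: alpha; apply: (near_pinfty_half
      (Q := fun a => primitive (fun t => fe (V a t)) y <= e / (8 * c))).
    exact: Hy.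
  have Vy : V (alpha / 2) y <= e / 8.
    near: alpha; apply: (near_pinfty_half (Q := fun a => V a y <= e / 8)).
    exact: cvg0.
  set a := alpha / 2 in Iy Vy *.
  have a20 : 0 < a by rewrite divr_gt0.
  rewrite (@eq_disk_integral _ _ (fun x => V a (sqn x))); last first.
    by move=> x /sub_cd cx; rewrite UV.
  have V0 t : 0 <= t < 1 -> 0 <= V a t.
    by move=> /andP[t0 t1]; apply: V_ge0 => //; rewrite t0 ltW.
  apply/andP; split.
    by apply: integral_ge0 => x /diskE x1; rewrite lee_fin V0 // sqn_ge0.
  have ce : continuous (fun _ : R => e / 8) by exact: cst_continuous.
  have := disk_integral_split (cV a a20) ce (cfV a a20) (ltW c0) y01 (fun _ => ltW e8)
    (fun t => fe_ge0 (V a t)) _ V0 _.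
  move=> /(_ _ _)/le_trans; apply.
  - by move=> s t s0 st t1; apply: fe_homo; exact: V_nincr.
  - move=> t /andP[t0 t1]; case: ltP => ty.
      by apply: le_trans (uf _ (V0 t _)) _; [rewrite t0|rewrite lerDr ltW].
    by rewrite addr0; apply: le_trans Vy; apply: V_nincr => //; exact: ltW.
  have := disk_integral_cst_le (ltW e8).
  move=> /(@leeD _ _ _ (c * (4 * primitive (fun t => fe (V a t)) y))%:E
    (c * (4 * (e / (8 * c))))%:E) /(_ _)/le_trans; apply.
    by rewrite lee_fin ler_pM2l // ler_pM2l.
  rewrite -EFinD lee_fin add0r.
  by rewrite le_eqVlt; apply/orP; left; apply/eqP; field; rewrite gt_eqF.
- pose Ipsi := disk_integral (fun x => Psi (sqn x)).
  have psiE (x : R * R) : disk x -> psi (enorm x) = Psi (sqn x).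
    by move=> /diskE x1; rewrite /Psi radial_coefE ?ltW.
  have Ipsi_le : (Ipsi <= 4%:E)%E.
    have c1 : continuous (fun _ : R => 1 : R) by exact: cst_continuous.
    have := disk_integral_cst_le (ler01 : 0 <= 1 :> R); rewrite mulr1; apply: le_trans.
    by apply: (le_disk_integral cPsi c1) => t _.
  have Ipsi_ge : (0 <= Ipsi)%E by apply: integral_ge0 => x _; rewrite lee_fin.
  have Ipsi_fin : Ipsi \is a fin_num by rewrite ge0_fin_numE // (le_lt_trans Ipsi_le) ?ltry.
  rewrite (@eq_disk_integral _ (fun x => psi (enorm x)) _ psiE) -/Ipsi.
  rewrite -(fineK Ipsi_fin) -EFinM; set ip := fine Ipsi.
  have ip4 : ip <= 4 by rewrite -lee_fin fineK.
  have ip0 : 0 <= ip by rewrite -lee_fin fineK.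
  have f0 : 0 < f 0 by exact: f_gt0.
  apply: cvg_pinfty_squeeze => e e0.
  (* The lower bound is exact since f 0 <= f(u). Above, off the core f(u) <= f 0 + e / 8 costs (e /
     8) [ip] <= e / 2, and the core costs 4 (e / 8). *)
  have e8 : 0 < e / 8 by rewrite divr_gt0.
  have [y /andP[y0 y1] Hy] := small _ e8.
  have y01 : 0 < y <= 1 by rewrite y0 ltW.
  have [r r0 Hr] : exists2 r : R, 0 < r & forall v, 0 <= v <= r -> fe v <= f 0 + e / 8.
    have c0 : {for 0, continuous fe} by exact: continuous_extend_nonneg.
    have /cvgrPdist_lt /(_ _ e8) := c0; rewrite /fe extend_nonnegE // => /nbhs_ballP [d /= d0 Hd].
    exists (d / 2); first by rewrite divr_gt0.
    move=> v /andP[v0 vd]; have := Hd v; rewrite /ball /= sub0r normrN ger0_norm //.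
    move=> /(_ _)-/(_ ltac:(lra)); rewrite distrC => /ltW /(le_trans (ler_norm _)).
    by rewrite lerBlDl.
  near=> alpha.
  have a0 : 0 < alpha by near: alpha.
  have Iy : primitive (fun t => fe (V (alpha / 2) t)) y <= e / 8.
    near: alpha; apply: (near_pinfty_half
      (Q := fun a => primitive (fun t => fe (V a t)) y <= e / 8)).
    exact: Hy.
  have Vy : V (alpha / 2) y <= r.
    near: alpha; apply: (near_pinfty_half (Q := fun a => V a y <= r)).
    exact: cvg0.
  set a := alpha / 2 in Iy Vy *.
  have a20 : 0 < a by rewrite divr_gt0.
  have V0 t : 0 <= t < 1 -> 0 <= V a t.
    by move=> /andP[t0 t1]; apply: V_ge0 => //; rewrite t0 ltW.
  rewrite (@eq_disk_integral _ _ (fun x => Psi (sqn x) * fe (V a (sqn x)))); last first.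
    move=> x dx; have /diskE x1 := dx.
    have V1 : 0 <= V a (sqn x) by apply: V0; rewrite sqn_ge0.
    by rewrite psiE // (UV _ _ a0 (sub_cd _ dx)) -(extend_nonnegE f V1).
  have cW : continuous (fun t => Psi t * fe (V a t)).
    by move=> t; apply: continuousM; [exact: cPsi|exact: cfV].
  have W0 t : 0 <= Psi t * fe (V a t) by rewrite mulr_ge0.
  have cp k : continuous (fun t => k * Psi t).
    by move=> t; apply: continuousM; [exact: cst_continuous|exact: cPsi].
  have IZ k : 0 <= k -> disk_integral (fun x => k * Psi (sqn x)) = (k * ip)%:E.
    by move=> k0; rewrite disk_integralZ // -/Ipsi -(fineK Ipsi_fin) EFinM.
  apply/andP; split.
    rewrite -IZ ?(ltW f0) //; apply: (le_disk_integral (cp _) cW) => t t01.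
    rewrite mulr_ge0 ?(ltW f0) //= mulrC; apply: ler_wpM2l => //.
    by rewrite -(extend_nonnegE f (lexx 0)); apply: fe_homo; exact: V0.
  have fe0 : 0 <= f 0 + e / 8 by rewrite addr_ge0 // ltW.
  have p0 t : 0 <= (f 0 + e / 8) * Psi t by rewrite mulr_ge0.
  have := disk_integral_split cW (cp (f 0 + e / 8)) (cfV a a20) ler01 y01 p0
    (fun t => fe_ge0 (V a t)) _ (fun t _ => W0 t) _.
  move=> /(_ _ _)/le_trans; apply.
  - by move=> s t s0 st t1; apply: fe_homo; exact: V_nincr.
  - move=> t /andP[t0 t1]; case: ltP => ty.
      rewrite mul1r; apply: (@le_trans _ _ (fe (V a t))); last by rewrite lerDr.
      by rewrite ler_piMl.
    rewrite addr0 mulrC; apply: ler_wpM2r => //; apply: Hr; rewrite V0 ?t0 //=.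
    by apply: le_trans Vy; apply: V_nincr => //; exact: ltW.
  rewrite IZ // -EFinD lee_fin mul1r mulrDl -addrA lerD2l.
  have : e / 8 * ip <= e / 8 * 4 by rewrite ler_pM2l.
  move: Iy; set I := primitive _ _ => Iy H.
  lra.
Unshelve. all: by end_near. Qed.
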